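(* For every odd $m\in\mathbb Z_{\ge1}$ let $$\tilde\varsigma_m(z)=t_{i_1,\dots,i_{m+1}}\tilde I^{i_1}_{-1}(z)\cdots\tilde I^{i_{m+1}}_{-1}(z)|0\rangle+\hbar\,\frac{(m+1)(m+2)(m-1)}{2m}\,t_{i_1,\dots,i_{m-3}}f^{abc}\,\tilde I^a_{-2}(z)\tilde I^{b\prime}_{-1}(z)\tilde I^{(c}_{-1}(z)\tilde I^{i_1}_{-1}(z)\cdots\tilde I^{i_{m-3})}_{-1}(z)|0\rangle$$ modulo terms of order $\hbar^2$. Then for all odd $m,n\in\mathbb Z_{\ge1}$, $$\tilde\varsigma_m(z)_{(0)}\tilde\varsigma_n(w)=\big(nD^{(m)}_z-mD^{(n)}_w\big)\mathsf A_{m,n}(z,w)+T\,\mathsf B_{m,n}(z,w)+\mathcal O(\hbar^3),$$ where $\mathsf A_{m,n}(z,w),\mathsf B_{m,n}(z,w)\in\widetilde{\mathcal V}_{(z,w)}$ are given by $$\mathsf A_{m,n}(z,w)=\zeta_{m,n}\frac{\hbar^2}{z-w}\,t_{i_1,\dots,i_{m-1}}t_{j_1,\dots,j_{n-1}}\,T\Big(\tilde I^{(a}_{-1}(z)\tilde I^{i_1}_{-1}(z)\cdots\tilde I^{i_{m-1})}_{-1}(z)\Big)\tilde I^{(a}_{-1}(w)\tilde I^{j_1}_{-1}(w)\cdots\tilde I^{j_{n-1})}_{-1}(w)|0\rangle+\mathcal O(\hbar^3),$$ $$\mathsf B_{m,n}(z,w)=\zeta_{m,n}\frac{\hbar^2}{(z-w)^2}\,t_{i_1,\dots,i_{m-1}}t_{j_1,\dots,j_{n-1}}\,\tilde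 I^{(a}_{-1}(z)\tilde I^{i_1}_{-1}(z)\cdots\tilde I^{i_{m-1})}_{-1}(z)\,\tilde I^{(a}_{-1}(w)\tilde I^{j_1}_{-1}(w)\cdots\tilde I^{j_{n-1})}_{-1}(w)|0\rangle+\mathcal O(\hbar^3),$$ with $$\zeta_{m,n}=\frac{2(m+1)(n+1)}{mn}.$$ Moreover, $\mathsf A_{m,n}(z,w)$ is regular at $z=w$ modulo translates and modulo terms proportional to $\hbar^3$.
   Context: Basis of $\mathfrak{sl}_2$: $\{I^a\}_{a=1}^3$ is a basis of $\mathfrak{sl}_2(\mathbb C)$ orthonormal for $(x|y)=\mathrm{Tr}(xy)$ (trace in the defining representation), with $[I^a,I^b]=f^{abc}I^c$, $f^{abc}=i\sqrt2\,\epsilon^{abc}$. Repeated Lie algebra indices are summed. Round brackets on indices denote symmetrization with weight one; in $\mathsf A_{m,n},\mathsf B_{m,n}$ the symmetrizations over $(a,i_1,\dots,i_{m-1})$ (factors with parameter $z$) and over $(a,j_1,\dots,j_{n-1})$ (factors with parameter $w$) are performed separately, and then $a$ is summed over. $t_{i_1,\dots,i_{2r}}=\delta_{(i_1i_2}\delta_{i_3i_4}\cdots\delta_{i_{2r-1}i_{2r})}$, with $t=1$ for $r=0$. For $m=1$ the second term of $\tilde\varsigma_m$ is absent. Rescaled algebra: $\hbar$ is a formal parameter and everything is over $\mathbb C[[\hbar]]$. With rescaled generators $\tilde I^a=\hbar I^a$, $\tilde{\mathsf k}=\mathsf k$, consider the Lie algebra $\mathfrak L$ with basis the formal symbols $\tilde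 I^{a[p]}_r(z)$, $\tilde{\mathsf k}^{[p]}(z)$ ($r\in\mathbb Z$, $p\in\mathbb Z_{\ge0}$, $a=1,2,3$), $\tilde{\mathsf k}^{[p]}(z)$ central, and $$[\tilde I^{a[p]}_r(z),\tilde I^{b[q]}_s(z)]=-\frac{p!\,q!}{(p+q+1)!}\Big(\hbar f^{abc}\tilde I^{c[p+q+1]}_{r+s}(z)-\hbar^2s\,\delta^{ab}\delta_{r+s,0}\tilde{\mathsf k}^{[p+q+1]}(z)\Big).$$ A prime denotes $[p]=[1]$, no mark $[p]=[0]$. $\mathcal V$ is the module induced from the trivial module spanned by $|0\rangle$ over the subalgebra generated by the $\tilde I^{a[p]}_r(z)$ with $r\ge0$. Two-parameter version: $\mathfrak L_{(z,w)}$, over the ground ring $\mathbb C[(z-w)^{-1}]$ (extended by $\hbar$), has generators $\tilde I^{a[p]}_r(z),\tilde I^{a[p]}_r(w),\tilde{\mathsf k}^{[p]}(z),\tilde{\mathsf k}^{[p]}(w)$, the $\tilde{\mathsf k}$'s central, brackets $$[\tilde I^{a[p]}_r(u),\tilde I^{b[q]}_s(u)]=-\frac{p!\,q!}{(p+q+1)!}\Big(\hbar f^{abc}\tilde I^{c[p+q+1]}_{r+s}(u)-\hbar^2s\,\delta^{ab}\delta_{r+s,0}\tilde{\mathsf k}^{[p+q+1]}(u)\Big)$$ among generators with the same parameter $u$, for $u=z$ and for $u=w$, and $$[\tilde I^{a[p]}_r(z),\tilde I^{b[q]}_s(w)]=\sum_{j=0}^p(-1)^{p+1-j}\binom pj(p+q-j)!\frac{F^{[j]}(z)}{(z-w)^{p+q+1-j}}-\sum_{j=0}^q(-1)^{p+1}\binom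 qj(p+q-j)!\frac{F^{[j]}(w)}{(z-w)^{p+q+1-j}},$$ where $F^{[j]}(u)=\hbar f^{abc}\tilde I^{c[j]}_{r+s}(u)-\hbar^2s\,\delta_{r+s,0}\delta^{ab}\tilde{\mathsf k}^{[j]}(u)$. $\widetilde{\mathcal V}_{(z,w)}$ denotes the analogous module induced from the trivial one generated by $|0\rangle$ (on which all $\tilde I^{a[p]}_r(z),\tilde I^{a[p]}_r(w)$ with $r\ge0$ act as zero). There are two embeddings $\mathcal V\hookrightarrow\widetilde{\mathcal V}_{(z,w)}$, $\mathsf v\mapsto\mathsf v(z)$ and $\mathsf v\mapsto\mathsf v(w)$. $\mathcal O(\hbar^3)$ means an element of $\hbar^3\widetilde{\mathcal V}_{(z,w)}$. Vertex algebra structure: translation operator $T|0\rangle=0$, $[T,\tilde I^{a[p]}_r(u)]=-r\tilde I^{a[p]}_{r-1}(u)$, $[T,\tilde{\mathsf k}^{[p]}(u)]=0$; for a product $X$ of generators, $T(X)$ means $[T,X]$. State-field map $Y(X,x)=\sum_rX_{(r)}x^{-r-1}$ with $Y(\tilde I^{a[p]}_{-1}(u)|0\rangle,x)=\sum_r\tilde I^{a[p]}_r(u)x^{-r-1}$, $Y(\tilde{\mathsf k}^{[p]}(u)X,x)=\tilde{\mathsf k}^{[p]}(u)Y(X,x)$, $Y(TX,x)=\partial_xY(X,x)$, $Y(X_{(-1)}X',x)={:}Y(X,x)Y(X',x){:}$. $X_{(0)}X'$ is the $0$-th product. Twisted derivatives: $D^{(j)}_z=\partial_z-\frac j2\tilde{\mathsf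 k}(z)$, $D^{(j)}_w=\partial_w-\frac j2\tilde{\mathsf k}(w)$, where $\partial_z$ is the derivation sending $\tilde I^{a[p]}_r(z)\mapsto\tilde I^{a[p+1]}_r(z)$, $\tilde{\mathsf k}^{[p]}(z)\mapsto\tilde{\mathsf k}^{[p+1]}(z)$, annihilating $|0\rangle$ and the generators with parameter $w$, and acting on functions of $z-w$ as the usual derivative; similarly $\partial_w$. Regularity: the homomorphism $\mathfrak L_{(z,w)}\to\mathfrak L((w-z))$ that is the identity on generators with parameter $z$ and sends $\tilde I^{a[p]}_r(w)\mapsto\sum_{s\ge0}\frac{(w-z)^s}{s!}\tilde I^{a[p+s]}_r(z)$, $\tilde{\mathsf k}^{[p]}(w)\mapsto\sum_{s\ge0}\frac{(w-z)^s}{s!}\tilde{\mathsf k}^{[p+s]}(z)$ induces a map $\widetilde{\mathcal V}_{(z,w)}\to\mathcal V((w-z))$. A state $\mathsf v$ is regular at $z=w$ modulo translates and modulo $\hbar^3$ if there is $Z\in\widetilde{\mathcal V}_{(z,w)}$ such that the image of $\mathsf v-TZ$ has no terms singular in $z-w$ modulo $\hbar^3$.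
   Formalization: The coefficient of B_{m,n} is m·ζ_{m,n} instead of ζ_{m,n}: with ζ_{m,n} alone the formula for the zeroth product fails for every odd m>1, being off by (m−1) times T of the printed B_{m,n}, which is nonzero modulo ħ^3. *)

(* Defs.v *)
From HB Require Import structures.
From mathcomp Require Import all_boot all_order all_algebra perm.
From mathcomp Require Import boolp reals complex.
From mathcomp Require Import finmap monalg ring.

(* World: Mathematical Components (with the classical axioms of boolp).

   C is R[i] for a realType R.  The ground ring C[[hbar]] is the ring fps R[i]
   of formal power series; C[[hbar]][(z-w)^-1] is {poly fps R[i]}, whose
   variable stands for (z-w)^-1.  The enveloping algebra of a Lie algebra given
   by a basis G and its bracket table is the free associative algebra freealg
   on G modulo g h - h g = [g, h]; the induced module is the further quotient
   by the left ideal generated by the annihilating modes.  It is built as one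
   quotient of freealg and is a left module over freealg. *)

Set Implicit Arguments.
Unset Strict Implicit.
Unset Printing Implicit Defensive.

Import Order.TTheory GRing.Theory Num.Theory.
Local Open Scope ring_scope.

Definition freealg (K : comNzRingType) (G : choiceType) := {malg K[{fmonom G}]}.

Section FreeAlgebraRing.
Variables (K : comNzRingType) (G : choiceType).
Local Notation F := (freealg K G).
HB.instance Definition _ := GRing.Zmodule.on F.

Lemma malgC_comm (c : K) (x : {malg K[{fmonom G}]}) : c%:MP * x = x * c%:MP.
Proof.
rewrite {1 2}[x]monalgE mulr_sumr mulr_suml; apply: eq_bigr => m _.
by rewrite !malgM_def !fgmulUU mulm1 mul1m mulrC.
Qed.

(* Locked, so that unification does not unfold products. *)
Fact freealg_key : unit. Proof. by []. Qed.
Definition fa_mul : F -> F -> F :=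
  locked_with freealg_key (fun x y : {malg K[{fmonom G}]} => x * y).
Definition fa_one : F := locked_with freealg_key (1 : {malg K[{fmonom G}]}).
Definition fa_scale : K -> F -> F :=
  locked_with freealg_key (fun c (x : {malg K[{fmonom G}]}) => c *: x).
Lemma fa_mulE (x y : {malg K[{fmonom G}]}) : fa_mul x y = x * y.
Proof. by rewrite /fa_mul unlock. Qed.
Lemma fa_oneE : fa_one = (1 : {malg K[{fmonom G}]}).
Proof. by rewrite /fa_one unlock. Qed.
Lemma fa_scaleE c (x : {malg K[{fmonom G}]}) : fa_scale c x = c *: x.
Proof. by rewrite /fa_scale unlock. Qed.

Fact fa_mulA : associative fa_mul.
Proof. by move=> x y z; rewrite !fa_mulE mulrA. Qed.
Fact fa_mul1x : left_id fa_one fa_mul.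
Proof. by move=> x; rewrite fa_mulE fa_oneE mul1r. Qed.
Fact fa_mulx1 : right_id fa_one fa_mul.
Proof. by move=> x; rewrite fa_mulE fa_oneE mulr1. Qed.
Fact fa_mulDl : left_distributive fa_mul +%R.
Proof. move=> x y z; rewrite !fa_mulE; exact: mulrDl. Qed.
Fact fa_mulDr : right_distributive fa_mul +%R.
Proof. move=> x y z; rewrite !fa_mulE; exact: mulrDr. Qed.
Fact fa_one_neq0 : fa_one != 0.
Proof. rewrite fa_oneE; exact: oner_neq0. Qed.
HB.instance Definition _ := GRing.Zmodule_isNzRing.Build F
  fa_mulA fa_mul1x fa_mulx1 fa_mulDl fa_mulDr fa_one_neq0.

Fact fa_scaleA a b x : fa_scale a (fa_scale b x) = fa_scale (a * b) x.
Proof. rewrite !fa_scaleE; exact: scalerA. Qed.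
Fact fa_scale1 : left_id 1 fa_scale.
Proof. move=> x; rewrite fa_scaleE; exact: scale1r. Qed.
Fact fa_scaleDr : right_distributive fa_scale +%R.
Proof. move=> c x y; rewrite !fa_scaleE; exact: scalerDr. Qed.
Fact fa_scaleDl x : {morph fa_scale^~ x : a b / a + b}.
Proof. move=> a b; rewrite !fa_scaleE; exact: scalerDl. Qed.
HB.instance Definition _ := GRing.Zmodule_isLmodule.Build K F
  fa_scaleA fa_scale1 fa_scaleDr fa_scaleDl.
Fact fa_scaleAl (c : K) (x y : F) : c *: (x * y) = c *: x * y.
Proof.
rewrite [LHS]fa_scaleE [x * y]fa_mulE [RHS]fa_mulE [c *: x]fa_scaleE.
exact: scalerAl.
Qed.
HB.instance Definition _ := GRing.Lmodule_isLalgebra.Build K F fa_scaleAl.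
Fact fa_scaleAr (c : K) (x y : F) : c *: (x * y) = x * (c *: y).
Proof.
rewrite [LHS]fa_scaleE [x * y]fa_mulE [RHS]fa_mulE [c *: y]fa_scaleE.
by rewrite -!mul_malgC mulrA malgC_comm mulrA.
Qed.
HB.instance Definition _ := GRing.Lalgebra_isAlgebra.Build K F fa_scaleAr.
End FreeAlgebraRing.

Section FreeAlgebra.
Variables (K : comNzRingType) (G : choiceType).
Local Notation F := (freealg K G).
Implicit Types (x y : F) (s t : seq G).

(* Basis elements of the Lie algebra, as elements of the free algebra. *)
Definition letter (g : G) : F := (<< fmu g >> : {malg K[{fmonom G}]}).
Definition word s : F := \prod_(g <- s) letter g.

Lemma word_cat s t : word (s ++ t) = word s * word t.
Proof. exact: big_cat. Qed.
Lemma word_cons g s : word (g :: s) = letter g * word s.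
Proof. exact: big_cons. Qed.
Lemma word0 : word [::] = 1.
Proof. exact: big_nil. Qed.
Lemma word1 g : word [:: g] = letter g.
Proof. exact: big_seq1. Qed.

Lemma monoE (c : K) (s : seq G) :
  (<< c *g FMonom s >> : {malg K[{fmonom G}]}) = c *: word s :> F.
Proof.
have E : word s = (<< FMonom s >> : {malg K[{fmonom G}]}).
  elim: s => [|g s IH].
    by rewrite word0 [LHS]fa_oneE; congr (<< _ *g _ >>); rewrite -fmoneE.
  rewrite word_cons IH [LHS]fa_mulE malgM_def fgmulUU mulr1; congr << _ *g _ >>.
  by apply/eqP; rewrite fmP fmM fmU.
rewrite E [RHS]fa_scaleE -mul_malgC malgM_def fgmulUU mulr1; congr << _ *g _ >>.
exact/esym/mul1m.
Qed.

Lemma freealg_ind (P : F -> Prop) :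
  P 0 -> (forall x y, P x -> P y -> P (x + y)) ->
  (forall c s, P (c *: word s)) -> forall x, P x.
Proof.
move=> P0 PD Pm x; rewrite [x]monalgE; elim/big_ind: _ => // m _.
by case: m => s; rewrite monoE; apply: Pm.
Qed.

(* The additive map with wordext (c *: word s) = f c s, see wordextE. *)
Section LinearExtension.
Variables (V : zmodType) (f : K -> seq G -> V).
Hypothesis fD : forall a b s, f (a + b) s = f a s + f b s.

Definition wordext (x : F) : V :=
  \sum_(m <- msupp (x : {malg K[{fmonom G}]})) f (mcoeff m x) m.

Let f0 s : f 0 s = 0.
Proof. by apply: (addrI (f 0 s)); rewrite -fD !addr0. Qed.

Lemma wordextEw (d : {fset {fmonom G}}) (x : {malg K[{fmonom G}]}) :
  (msupp x `<=` d)%fset -> wordext x = \sum_(m <- d) f (mcoeff m x) m.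
Proof.
move=> le; apply: big_fset_incl => // m _ /mcoeff_outdom ->; exact: f0.
Qed.

Lemma wordextD : {morph wordext : x y / x + y}.
Proof.
move=> x y; pose d := (msupp (x : {malg K[{fmonom G}]})
  `|` msupp (y : {malg K[{fmonom G}]}))%fset.
rewrite (wordextEw (d := d)) ?msuppD_le //.
rewrite (@wordextEw d x) ?fsubsetUl // (@wordextEw d y) ?fsubsetUr //.
by rewrite -big_split /=; apply: eq_bigr => m _; rewrite mcoeffD fD.
Qed.
Lemma wordext0 : wordext 0 = 0.
Proof. by apply: (addrI (wordext 0)); rewrite -wordextD !addr0. Qed.
Lemma wordextN : {morph wordext : x / - x}.
Proof.
by move=> x; apply: (addrI (wordext x)); rewrite -wordextD !subrr wordext0.
Qed.
Lemma wordextB : {morph wordext : x y / x - y}.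
Proof. by move=> x y; rewrite wordextD wordextN. Qed.
Lemma wordext_sum I r (P : pred I) h :
  wordext (\sum_(i <- r | P i) h i) = \sum_(i <- r | P i) wordext (h i).
Proof. exact: (big_morph _ wordextD wordext0). Qed.
Lemma wordextE c s : wordext (c *: word s) = f c s.
Proof.
rewrite -monoE (wordextEw msuppU_le) big_seq_fset1 mcoeffUU.
by [].
Qed.
End LinearExtension.

Section Derivation.
Variables (d0 : {additive K -> K}) (d : G -> F).

Fixpoint der_word (s : seq G) : F :=
  if s is g :: s' then d g * word s' + letter g * der_word s' else 0.

(* The derivation extending d0 on scalars and d on letters. *)
Definition freeder : F -> F :=
  wordext (fun c s => d0 c *: word s + c *: der_word s).

Let fD a b s : d0 (a + b) *: word s + (a + b) *: der_word s =
  (d0 a *: word s + a *: der_word s) + (d0 b *: word s + b *: der_word s).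
Proof. by rewrite raddfD /= !scalerDl addrACA. Qed.

Lemma freederD : {morph freeder : x y / x + y}.
Proof. exact: wordextD. Qed.
Lemma freeder0 : freeder 0 = 0.
Proof. exact: wordext0. Qed.
Lemma freederN : {morph freeder : x / - x}.
Proof. exact: wordextN. Qed.
Lemma freederB : {morph freeder : x y / x - y}.
Proof. exact: wordextB. Qed.
Lemma freeder_sum I r (P : pred I) f :
  freeder (\sum_(i <- r | P i) f i) = \sum_(i <- r | P i) freeder (f i).
Proof. exact: wordext_sum. Qed.
Lemma freeder_word c s :
  freeder (c *: word s) = d0 c *: word s + c *: der_word s.
Proof. exact: wordextE. Qed.

Hypothesis d0M : forall a b : K, d0 (a * b) = d0 a * b + a * d0 b.

Lemma d0_1 : d0 1 = 0.
Proof.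
have := d0M 1 1; rewrite !mulr1 mul1r => /eqP.
by rewrite -subr_eq0 opprD addNKr oppr_eq0 => /eqP.
Qed.

Lemma freeder_letter g : freeder (letter g) = d g.
Proof.
rewrite -word1 -[word _]scale1r freeder_word d0_1 scale0r add0r scale1r /=.
by rewrite mulr0 addr0 word0 mulr1.
Qed.

Lemma der_word_cat s t :
  der_word (s ++ t) = der_word s * word t + word s * der_word t.
Proof.
elim: s => [|g s IH] /=; first by rewrite mul0r add0r word0 mul1r.
by rewrite IH word_cat word_cons mulrDr mulrDl !mulrA addrA.
Qed.

Lemma freederM x y : freeder (x * y) = freeder x * y + x * freeder y.
Proof.
elim/freealg_ind: x y => [y|x1 x2 h1 h2 y|c s y].
- by rewrite !mul0r freeder0 mul0r addr0.
- by rewrite !mulrDl !freederD h1 h2 !mulrDl addrACA.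
elim/freealg_ind: y => [|y1 y2 h1 h2|c' t].
- by rewrite !mulr0 freeder0 mulr0 addr0.
- by rewrite !mulrDr !freederD h1 h2 !mulrDr addrACA.
rewrite -scalerAl -scalerAr scalerA -word_cat !freeder_word word_cat.
rewrite der_word_cat d0M scalerDl scalerDr !mulrDl !mulrDr.
rewrite -!scalerAl -!scalerAr !scalerA.
by rewrite [LHS](AC (2*2) ((1*3)*(2*4))).
Qed.

Lemma freederZ c x : freeder (c *: x) = d0 c *: x + c *: freeder x.
Proof.
have E (z : F) : c *: z = (c *: word [::]) * z by rewrite word0 -scalerAl mul1r.
rewrite E freederM freeder_word /= scaler0 addr0 word0 -!scalerAl !mul1r.
by [].
Qed.
End Derivation.
End FreeAlgebra.

Record fps (A : Type) := Fps { fcoef : nat -> A }.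

Lemma fpsP (A : Type) (a b : fps A) : fcoef a =1 fcoef b -> a = b.
Proof. by case: a b => [a] [b] /= /funext ->. Qed.

HB.instance Definition _ (A : Type) := gen_eqMixin (fps A).
HB.instance Definition _ (A : Type) := gen_choiceMixin (fps A).

Section FpsZmod.
Variable A : zmodType.
Definition fps0 : fps A := Fps (fun=> 0).
Definition fpsopp (a : fps A) := Fps (fun n => - fcoef a n).
Definition fpsadd (a b : fps A) := Fps (fun n => fcoef a n + fcoef b n).
Lemma fpsaddA : associative fpsadd.
Proof. by move=> a b c; apply/fpsP => n /=; rewrite addrA. Qed.
Lemma fpsaddC : commutative fpsadd.
Proof. by move=> a b; apply/fpsP => n /=; rewrite addrC. Qed.
Lemma fpsadd0 : left_id fps0 fpsadd.
Proof. by move=> a; apply/fpsP => n /=; rewrite add0r. Qed.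
Lemma fpsaddN : left_inverse fps0 fpsopp fpsadd.
Proof. by move=> a; apply/fpsP => n /=; rewrite addNr. Qed.
HB.instance Definition _ :=
  GRing.isZmodule.Build (fps A) fpsaddA fpsaddC fpsadd0 fpsaddN.
End FpsZmod.

Section FpsRing.
Variable A : nzRingType.
Definition fpsC (c : A) : fps A := Fps (fun n => if n == 0%N then c else 0).
Definition fpsX : fps A := Fps (fun n => (n == 1%N)%:R).
Definition fpsmul (a b : fps A) : fps A :=
  Fps (fun n => \sum_(j < n.+1) fcoef a j * fcoef b (n - j)).

Let tr N (a : fps A) : {poly A} := \poly_(i < N.+1) fcoef a i.

Lemma fpsmulE N n (a b : fps A) : (n <= N)%N ->
  fcoef (fpsmul a b) n = (tr N a * tr N b)`_n.
Proof.
move=> nN; rewrite coefM; apply: eq_bigr => j _.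
rewrite !coef_poly !ltnS (leq_trans (leq_subr _ _) nN).
by rewrite (leq_trans _ nN) // -ltnS.
Qed.

Lemma fpsmulA : associative fpsmul.
Proof.
move=> a b c; apply/fpsP => n.
transitivity ((tr n a * (tr n b * tr n c))`_n).
  rewrite coefM; apply: eq_bigr => j _.
  rewrite (fpsmulE (N := n)) ?leq_subr //.
  by rewrite coef_poly (leq_trans (ltn_ord j)).
rewrite mulrA coefM; apply: eq_bigr => j _.
rewrite (fpsmulE (N := n)) -1?ltnS //.
by rewrite [(tr n c)`_ _]coef_poly ltnS leq_subr.
Qed.

Lemma fpsmul1l : left_id (fpsC 1) fpsmul.
Proof.
move=> a; apply/fpsP => n /=; rewrite big_ord_recl /= mul1r subn0.
by rewrite big1 ?addr0 // => i _; rewrite mul0r.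
Qed.
Lemma fpsmul1r : right_id (fpsC 1) fpsmul.
Proof.
move=> a; apply/fpsP => n /=; rewrite big_ord_recr /= subnn mulr1.
by rewrite big1 ?add0r // => i _; rewrite subn_eq0 leqNgt ltn_ord mulr0.
Qed.
Lemma fpsmulDl : left_distributive fpsmul +%R.
Proof.
move=> a b c; apply/fpsP => n /=; rewrite -big_split /=.
by apply: eq_bigr => i _; rewrite mulrDl.
Qed.
Lemma fpsmulDr : right_distributive fpsmul +%R.
Proof.
move=> a b c; apply/fpsP => n /=; rewrite -big_split /=.
by apply: eq_bigr => i _; rewrite mulrDr.
Qed.
Lemma fps1_neq0 : fpsC 1 != 0 :> fps A.
Proof.
apply/eqP => /(congr1 (fun a : fps A => fcoef a 0)) /= /eqP.
by rewrite oner_eq0.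
Qed.
HB.instance Definition _ := GRing.Zmodule_isNzRing.Build (fps A)
  fpsmulA fpsmul1l fpsmul1r fpsmulDl fpsmulDr fps1_neq0.
End FpsRing.

Section FpsComRing.
Variable A : comNzRingType.
Lemma fpsmulC : commutative (@fpsmul A).
Proof.
move=> a b; apply/fpsP => n; rewrite !(fpsmulE (N := n)) //.
by rewrite mulrC.
Qed.
HB.instance Definition _ :=
  GRing.PzRing_hasCommutativeMul.Build (fps A) fpsmulC.
Lemma fpsC_is_zmod_morphism : zmod_morphism (@fpsC A).
Proof.
by move=> a b; apply/fpsP => n /=; case: ifP; rewrite ?subr0.
Qed.
Lemma fpsC_is_monoid_morphism : monoid_morphism (@fpsC A).
Proof.
split=> // a b; apply/fpsP => -[|n] /=; first by rewrite big_ord1.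
by rewrite big1 // => -[[|i] Hi] _ /=; rewrite ?mul0r ?mulr0.
Qed.
HB.instance Definition _ :=
  GRing.isZmodMorphism.Build A (fps A) (@fpsC A) fpsC_is_zmod_morphism.
HB.instance Definition _ :=
  GRing.isMonoidMorphism.Build A (fps A) (@fpsC A) fpsC_is_monoid_morphism.
End FpsComRing.

Section InducedModule.
Variables (K : comNzRingType) (G : choiceType).

Local Notation F := (freealg K G).

Variables (br : G -> G -> F) (ann : pred G).

(* vanish x: the element x of the free algebra annihilates the vector |0> of the
   module induced from the trivial one; br is the bracket table and ann selects
   the modes acting as zero on |0>. *)
Inductive vanish : F -> Prop :=
| vanish0 : vanish 0
| vanishD x y : vanish x -> vanish y -> vanish (x + y)
| vanishM x y : vanish y -> vanish (x * y)
| vanish_br g h y :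
    vanish ((letter K g * letter K h - letter K h * letter K g - br g h) * y)
| vanish_ann g : ann g -> vanish (letter K g).

Definition vanishing : {pred F} := [pred x | `[< vanish x >]].

Lemma vanishing_zmod : zmod_closed vanishing.
Proof.
split=> [|x y]; rewrite !inE; first by apply/asboolP; exact: vanish0.
move=> /asboolP hx /asboolP hy; apply/asboolP; apply: vanishD => //.
by rewrite -mulN1r; apply: vanishM.
Qed.
HB.instance Definition _ := GRing.isZmodClosed.Build F vanishing vanishing_zmod.

Definition induced := Quotient.quot vanishing.
HB.instance Definition _ := GRing.Zmodule.on induced.

Definition cls (x : F) : induced := (\pi_(Quotient.quot vanishing) x)%qT.
Definition rep (v : induced) : F := repr (v : Quotient.quot vanishing).

Lemma repK : cancel rep cls.
Proof. exact: reprK. Qed.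

Lemma clsD : {morph cls : x y / x + y}.
Proof. by move=> x y; rewrite /cls raddfD. Qed.

Lemma cls_eq x y : cls x = cls y <-> vanish (x - y).
Proof.
split=> [/eqP|h]; last apply/eqP; rewrite /cls -Quotient.idealrBE inE.
  by move/asboolP.
exact/asboolP.
Qed.

Definition induced_scale (x : F) (v : induced) := cls (x * rep v).

Lemma cls_scale x y : induced_scale x (cls y) = cls (x * y).
Proof.
by apply/cls_eq; rewrite -mulrBr; apply/vanishM/cls_eq; rewrite repK.
Qed.

Lemma induced_scaleA x y v :
  induced_scale x (induced_scale y v) = induced_scale (x * y) v.
Proof. by rewrite -[v]repK !cls_scale mulrA. Qed.
Lemma induced_scale1 : left_id 1 induced_scale.
Proof. by move=> v; rewrite /induced_scale mul1r repK. Qed.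
Lemma induced_scaleDr : right_distributive induced_scale +%R.
Proof.
move=> x u v; rewrite -[u]repK -[v]repK -clsD !cls_scale mulrDr clsD.
by [].
Qed.
Lemma induced_scaleDl v : {morph induced_scale^~ v : x y / x + y}.
Proof. by move=> x y; rewrite /induced_scale mulrDl clsD. Qed.

HB.instance Definition _ := GRing.Zmodule_isLmodule.Build F induced
  induced_scaleA induced_scale1 induced_scaleDr induced_scaleDl.

Definition vacuum : induced := cls 1.

Lemma vacuumZ x : x *: vacuum = cls x.
Proof. by rewrite /vacuum [_ *: _]cls_scale mulr1. Qed.

Lemma cls_rep x : vanish (rep (cls x) - x).
Proof. by apply/cls_eq; rewrite repK. Qed.
End InducedModule.

Section Descent.
Variables (K : comNzRingType) (G : choiceType).
Local Notation F := (freealg K G).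
Variables (br : G -> G -> F) (ann : pred G).
Variables (d0 : {additive K -> K}) (c : G -> K) (sh : G -> G).
Hypothesis d0M : forall a b : K, d0 (a * b) = d0 a * b + a * d0 b.
Local Notation D := (freeder d0 (fun g => c g *: letter K (sh g))).
Hypothesis Dbr : forall g h,
  D (br g h) = c g *: br (sh g) h + c h *: br g (sh h).
Hypothesis Dann : forall g, ann g -> c g = 0 \/ ann (sh g).

Lemma vanishZ a x : vanish br ann x -> vanish br ann (a *: x).
Proof. have -> : a *: x = a%:A * x by rewrite -scalerAl mul1r.
exact: vanishM. Qed.

Lemma freeder_vanish x : vanish br ann x -> vanish br ann (D x).
Proof.
elim=> {x} [|x y _ hx _ hy|x y hy hDy|g h y|g hg].
- by rewrite freeder0; apply: vanish0.
- by rewrite freederD; apply: vanishD.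
- by rewrite freederM //; apply: vanishD; [apply: vanishM|apply: vanishM].
- rewrite freederM //; apply: vanishD; last exact: vanish_br.
  rewrite !freederB !freederM // !freeder_letter // Dbr.
  have -> : c g *: letter K (sh g) * letter K h
      + letter K g * (c h *: letter K (sh h))
      - (c h *: letter K (sh h) * letter K g
         + letter K h * (c g *: letter K (sh g)))
      - (c g *: br (sh g) h + c h *: br g (sh h)) =
    c g *: (letter K (sh g) * letter K h - letter K h * letter K (sh g)
             - br (sh g) h)
    + c h *: (letter K g * letter K (sh h) - letter K (sh h) * letter K g
             - br g (sh h)).
    rewrite -!scalerAr -!scalerAl !scalerBr !opprD.
    by rewrite [LHS](AC (2*2*2) ((1*4*5)*(2*3*6))).
  by rewrite mulrDl -!scalerAl; apply: vanishD; apply/vanishZ/vanish_br.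
- rewrite freeder_letter //; case: (Dann hg) => [->|h].
    by rewrite scale0r; apply: vanish0.
  exact/vanishZ/vanish_ann.
Qed.

(* The operator on the induced module given by the derivation that is d0 on
   scalars, maps each letter g to c g *: sh g, and kills |0>; indderE shows that
   it does not depend on the representative chosen by rep. *)
Definition indder (v : induced br ann) : induced br ann := cls br ann (D (rep v)).

Lemma indderE x : indder (cls br ann x) = cls br ann (D x).
Proof.
by apply/cls_eq; rewrite -freederB; apply/freeder_vanish/cls_rep.
Qed.
End Descent.

Section Embedding.
Variables (K K' : comNzRingType) (G G' : choiceType).
Variables (phi : {rmorphism K -> K'}) (ge : G -> G').
Local Notation F := (freealg K G).
Local Notation F' := (freealg K' G').

Definition freemap : F -> F' :=
  wordext (fun c s => phi c *: word K' (map ge s)).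

Let fD a b (s : seq G) : phi (a + b) *: word K' (map ge s) =
  phi a *: word K' (map ge s) + phi b *: word K' (map ge s).
Proof. by rewrite rmorphD scalerDl. Qed.

Lemma freemapD : {morph freemap : x y / x + y}.
Proof. exact: wordextD. Qed.
Lemma freemap0 : freemap 0 = 0.
Proof. exact: wordext0. Qed.
Lemma freemapB : {morph freemap : x y / x - y}.
Proof. exact: wordextB. Qed.
Lemma freemapN : {morph freemap : x / - x}.
Proof. exact: wordextN. Qed.
Lemma freemap_sum I r (P : pred I) f :
  freemap (\sum_(i <- r | P i) f i) = \sum_(i <- r | P i) freemap (f i).
Proof. exact: wordext_sum. Qed.
Lemma freemap_word c s :
  freemap (c *: word K s) = phi c *: word K' (map ge s).
Proof. exact: wordextE. Qed.

Lemma freemapM : {morph freemap : x y / x * y}.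
Proof.
move=> x y; elim/freealg_ind: x y => [y|x1 x2 h1 h2 y|c s y].
- by rewrite !mul0r freemap0 mul0r.
- by rewrite mulrDl !freemapD h1 h2 !mulrDl.
elim/freealg_ind: y => [|y1 y2 h1 h2|c' t].
- by rewrite !mulr0 freemap0 mulr0.
- by rewrite mulrDr !freemapD h1 h2 !mulrDr.
rewrite -scalerAl -scalerAr scalerA -word_cat !freemap_word map_cat.
by rewrite word_cat rmorphM -scalerAl -scalerAr scalerA.
Qed.

Lemma freemap_letter g : freemap (letter K g) = letter K' (ge g).
Proof.
by rewrite -word1 -[word _ _]scale1r freemap_word rmorph1 scale1r /= word1.
Qed.

Lemma freemapZ c x : freemap (c *: x) = phi c *: freemap x.
Proof.
have E (z : F) : c *: z = (c *: word K [::]) * z.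
  by rewrite word0 -scalerAl mul1r.
by rewrite E freemapM freemap_word /= word0 -scalerAl mul1r.
Qed.

Variables (br : G -> G -> F) (ann : pred G).
Variables (br' : G' -> G' -> F') (ann' : pred G').
Hypothesis gebr : forall g h, freemap (br g h) = br' (ge g) (ge h).
Hypothesis geann : forall g, ann g -> ann' (ge g).

Lemma freemap_vanish x : vanish br ann x -> vanish br' ann' (freemap x).
Proof.
elim=> {x} [|x y _ hx _ hy|x y _ hy|g h y|g hg].
- by rewrite freemap0; apply: vanish0.
- by rewrite freemapD; apply: vanishD.
- by rewrite freemapM; apply: vanishM.
- by rewrite freemapM !freemapB !freemapM !freemap_letter gebr; apply: vanish_br.
- by rewrite freemap_letter; apply/vanish_ann/geann.
Qed.

Definition indmap (v : induced br ann) : induced br' ann' :=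
  cls br' ann' (freemap (rep v)).

Lemma indmapE x : indmap (cls br ann x) = cls br' ann' (freemap x).
Proof. by apply/cls_eq; rewrite -freemapB; apply/freemap_vanish/cls_rep. Qed.
End Embedding.

(* Imode u a p r is I^{a[p]}_r(u) and Kmode u p is k^{[p]}(u); the indices
   a = 1, 2, 3 are the elements 0, 1, 2 of 'I_3. *)
Inductive mode (P : Type) :=
| Imode of P & 'I_3 & nat & int
| Kmode of P & nat.
Arguments Kmode {P}.

Section ModeChoice.
Variable P : choiceType.
Definition mode_encode (g : mode P) : P * 'I_3 * nat * int + P * nat :=
  match g with Imode u a p r => inl (u, a, p, r) | Kmode u p => inr (u, p) end.
Definition mode_decode (x : P * 'I_3 * nat * int + P * nat) : mode P :=
  match x with inl (u, a, p, r) => Imode u a p r | inr (u, p) => Kmode u p end.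
Lemma mode_encodeK : cancel mode_encode mode_decode.
Proof. by case. Qed.
HB.instance Definition _ := Choice.copy (mode P) (can_type mode_encodeK).
End ModeChoice.

Inductive point := ptz | ptw.
Definition point_eqb (u : point) := if u is ptz then true else false.
Lemma point_eqbK :
  cancel point_eqb (fun b : bool => if b then ptz else ptw).
Proof. by case. Qed.
HB.instance Definition _ := Choice.copy point (can_type point_eqbK).

(* On {0, 1, 2} the product of differences is 2 times the Levi-Civita symbol. *)
Definition levi_civita (a b c : 'I_3) : int :=
  (((b%:Z - a%:Z) * (c%:Z - a%:Z) * (c%:Z - b%:Z)) %/ 2)%Z.

Section Scalars.
Variable R : realType.

Definition Kone : comNzRingType := fps R[i].
Definition Ktwo : comNzRingType := {poly fps R[i]}.

(* Structure constants f^{abc} = i sqrt 2 epsilon^{abc}. *)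
Definition sl2f (a b c : 'I_3) : R[i] :=
  'i * sqrtC 2 * (levi_civita a b c)%:~R.

Section Current.
Variables (K : comNzRingType) (iota : {rmorphism fps R[i] -> K}).
Variable P : choiceType.
Local Notation F := (freealg K (mode P)).

Definition hbar : K := iota (fpsX R[i]).
Definition cst (c : R[i]) : K := iota (fpsC c).
Definition Igen u a p r : F := letter K (Imode u a p r).
Definition Kgen u p : F := letter K (Kmode u p).

(* F^{[j]}(u) = hbar f^{abc} I^{c[j]}_{r+s}(u)
             - hbar^2 s delta^{ab} delta_{r+s,0} k^{[j]}(u) *)
Definition current u (a b : 'I_3) (r s : int) (j : nat) : F :=
  (\sum_c (hbar * cst (sl2f a b c)) *: Igen u c j (r + s))
  - (hbar ^+ 2 * s%:~R * ((a == b) && (r + s == 0))%:R) *: Kgen u j.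

Definition bracket_same u a p r b q s : F :=
  - cst ((p`! * q`!)%:R / (p + q).+1`!%:R) *: current u a b r s (p + q).+1.

Definition annihilator (g : mode P) : bool :=
  if g is Imode _ _ _ r then 0 <= r else false.
End Current.

Definition bracket1 (g h : mode unit) : freealg Kone (mode unit) :=
  match g, h with
  | Imode u a p r, Imode _ b q s => bracket_same idfun u a p r b q s
  | _, _ => 0
  end.

Local Notation polyK := (polyC : {rmorphism fps R[i] -> {poly fps R[i]}}).

(* [I^{a[p]}_r(z), I^{b[q]}_s(w)] *)
Definition bracket_zw a p r b q s : freealg Ktwo (mode point) :=
  (\sum_(j < p.+1) ((-1) ^+ (p.+1 - j) * ('C(p, j) * (p + q - j)`!)%:R
      * 'X ^+ ((p + q).+1 - j)) *: current polyK ptz a b r s j)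
  - (\sum_(j < q.+1) ((-1) ^+ p.+1 * ('C(q, j) * (p + q - j)`!)%:R
      * 'X ^+ ((p + q).+1 - j)) *: current polyK ptw a b r s j).

Definition bracket2 (g h : mode point) : freealg Ktwo (mode point) :=
  match g, h with
  | Imode ptz a p r, Imode ptw b q s => bracket_zw a p r b q s
  | Imode ptw a p r, Imode ptz b q s => - bracket_zw b q s a p r
  | Imode u a p r, Imode _ b q s => bracket_same polyK u a p r b q s
  | _, _ => 0
  end.

Definition V1 := induced bracket1 (@annihilator unit).
Definition V2 := induced bracket2 (@annihilator point).
End Scalars.

Section CurrentDerivation.
Variable R : realType.
Variables (K : comNzRingType) (iota : {rmorphism fps R[i] -> K}).
Variable P : choiceType.
Local Notation F := (freealg K (mode P)).
Variable d0 : {additive K -> K}.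
Hypothesis d0M : forall a b : K, d0 (a * b) = d0 a * b + a * d0 b.
Hypothesis d0iota : forall x, d0 (iota x) = 0.

(* The derivations [T, -] and partial_v are given on modes by a coefficient and a
   relabelling: [T, I_r] = - r I_{r-1}, [T, k] = 0, and partial_v raises [p] to
   [p+1] on the modes with parameter v. *)
Definition translate_coef (g : mode P) : K :=
  if g is Imode _ _ _ r then - r%:~R else 0.
Definition translate_mode (g : mode P) : mode P :=
  if g is Imode u a p r then Imode u a p (r - 1) else g.
Definition raise_coef (v : P) (g : mode P) : K :=
  match g with Imode u _ _ _ => (u == v)%:R | Kmode u _ => (u == v)%:R end.
Definition raise_mode (g : mode P) : mode P :=
  match g with
  | Imode u a p r => Imode u a p.+1 r
  | Kmode u p => Kmode u p.+1
  end.

Definition free_translation : F -> F :=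
  freeder (\0 : {additive K -> K})
    (fun g => translate_coef g *: letter K (translate_mode g)).
Definition free_partial (v : P) : F -> F :=
  freeder d0 (fun g => raise_coef v g *: letter K (raise_mode g)).

Lemma null_derM (a b : K) :
  (\0 : {additive K -> K}) (a * b) =
  (\0 : {additive K -> K}) a * b + a * (\0 : {additive K -> K}) b.
Proof. by rewrite /= mul0r mulr0 addr0. Qed.

Let d0Z c x : d0 c = 0 -> forall v,
  free_partial v (c *: x) = c *: free_partial v x.
Proof. by move=> h v; rewrite /free_partial freederZ // h scale0r add0r. Qed.

Let TZ c x : free_translation (c *: x) = c *: free_translation x.
Proof.
by rewrite /free_translation freederZ; [rewrite /= scale0r add0r|exact: null_derM].
Qed.

Lemma d0_nat n : d0 n%:R = 0.
Proof. by rewrite -(rmorph_nat iota) d0iota. Qed.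
Lemma d0_int (n : int) : d0 n%:~R = 0.
Proof. by rewrite -(rmorph_int iota) d0iota. Qed.

Lemma free_partial_current v u a b r s j :
  free_partial v (current iota u a b r s j)
  = (u == v)%:R *: current iota u a b r s j.+1.
Proof.
rewrite /current [LHS]freederB [X in X - _]freeder_sum.
rewrite scalerBr scaler_sumr; congr (_ - _).
  apply: eq_bigr => c _; rewrite -/(free_partial v _) d0Z; last first.
    by rewrite d0M !d0iota mul0r mulr0 addr0.
  by rewrite /free_partial freeder_letter // !scalerA mulrC.
rewrite -/(free_partial v _) d0Z; last first.
  by rewrite !d0M d0_nat d0_int d0iota !(mul0r, mulr0, addr0).
by rewrite /free_partial freeder_letter // !scalerA mulrC.
Qed.

Lemma free_translation_current u a b r s j :
  free_translation (current iota u a b r s j)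
  = - r%:~R *: current iota u a b (r - 1) s j
    + - s%:~R *: current iota u a b r (s - 1) j.
Proof.
have nM := null_derM.
rewrite /current [LHS]freederB [X in X - _]freeder_sum.
rewrite -/(free_translation (_ *: Kgen _ _ _)) TZ.
have -> : free_translation (Kgen K u j) = 0.
  by rewrite /free_translation freeder_letter // scale0r.
rewrite scaler0 subr0 !scalerBr !scaler_sumr addrACA -opprD -big_split /=.
have -> : r - 1 + s = r + s - 1 by rewrite addrAC.
have -> : r + (s - 1) = r + s - 1 by rewrite addrA.
rewrite !scalerA -scalerDl [X in _ = _ - X](_ : _ = 0) ?subr0; last first.
  rewrite -[RHS](scale0r (Kgen K u j)); congr (_ *: _).
  case: (a == b) => /=; last by rewrite !mulr0 addr0.
  have [rs|_] := eqVneq (r + s - 1) 0; last by rewrite !mulr0 addr0.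
  have -> : r = 1 - s by move/eqP: rs; rewrite subr_eq0 => /eqP <-; rewrite addrK.
  rewrite rmorphB rmorph1 /= [(s - 1)%:~R]rmorphB rmorph1 /=; ring.
apply: eq_bigr => c _; rewrite -/(free_translation _) TZ.
rewrite /free_translation freeder_letter // /= !scalerA -scalerDl.
congr (_ *: _); rewrite rmorphD /= opprD mulrDr; congr (_ + _); exact: mulrC.
Qed.
End CurrentDerivation.

Section GroundPartial.
Variables (A : comNzRingType) (v : point).
(* d/dz and d/dw on polynomials in 'X = (z-w)^-1. *)
Definition ground_partial (p : {poly A}) : {poly A} :=
  (if v is ptz then -1 else 1) * (p^`() * 'X ^+ 2).
Lemma ground_partial_is_zmod_morphism : zmod_morphism ground_partial.
Proof. by move=> p q; rewrite /ground_partial derivB mulrBl mulrBr. Qed.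
HB.instance Definition _ := GRing.isZmodMorphism.Build {poly A} {poly A}
  ground_partial ground_partial_is_zmod_morphism.
Lemma ground_partialM p q :
  ground_partial (p * q) = ground_partial p * q + p * ground_partial q.
Proof. by rewrite /ground_partial derivM; ring. Qed.
Lemma ground_partialC c : ground_partial c%:P = 0.
Proof. by rewrite /ground_partial derivC mul0r mulr0. Qed.
Lemma ground_partialXn n :
  ground_partial ('X ^+ n) = (if v is ptz then -1 else 1) * n%:R * 'X ^+ n.+1.
Proof.
rewrite /ground_partial derivXn -mulr_natr -!mulrA; congr (_ * _).
case: n => [|n]; first by rewrite !(mulr0, mul0r).
by rewrite mulrCA -exprD addn2.
Qed.
End GroundPartial.

Lemma beta_split (C : fieldType) (x y X a b : C) : X != 0 -> a + b != 0 ->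
  x * y / X = a * x * y / ((a + b) * X) + x * (b * y) / ((a + b) * X).
Proof. by move=> hX hab; field; rewrite hX hab. Qed.

Lemma ring_coef (B : comNzRingType) (s n e N X X' : B) :
  (0 * N + e * 0) * X + e * N * (s * n * X') = s * n * (e * N * X').
Proof. by ring. Qed.
Lemma ring_coef1 (B : comNzRingType) (n e b f X : B) :
  n * (e * (b * f) * X) = e * (b * (n * f)) * X.
Proof. by ring. Qed.
Lemma ring_coef2 (B : comNzRingType) (n e b f X : B) :
  -1 * n * (e * (b * f) * X) = (-1 * e) * (b * (n * f)) * X.
Proof. by ring. Qed.

Section Modules.
Variable R : realType.
Local Notation A := (fps R[i]).
Local Notation iota := (polyC : {rmorphism A -> {poly A}}).
Local Notation F := (freealg (Ktwo R) (mode point)).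
Local Notation D v := (@free_partial (Ktwo R) point (@ground_partial A v) v).

Let dM v := @ground_partialM A v.
Let dC v : forall x, @ground_partial A v (iota x) = 0 := @ground_partialC A v.

Lemma partialZ v c (x : F) :
  D v (c *: x) = @ground_partial A v c *: x + c *: D v x.
Proof. by apply: freederZ; exact: ground_partialM. Qed.

Lemma partial_same v u a p r b q s :
  D v (bracket_same iota u a p r b q s) =
  (u == v)%:R *: bracket_same iota u a p.+1 r b q s
  + (u == v)%:R *: bracket_same iota u a p r b q.+1 s.
Proof.
rewrite /bracket_same addSn addnS partialZ.
rewrite (free_partial_current (@dM v) (@dC v)).
rewrite raddfN /= ground_partialC oppr0 scale0r add0r !scalerA -scalerDl.
congr (_ *: _); rewrite [LHS]mulrC -mulrDr -opprD; congr (_ * - _).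
rewrite -rmorphD -rmorphD /=; congr (polyC (fpsC _)).
have nz (n : nat) : n.+1%:R != 0 :> R[i] by rewrite pnatr_eq0.
have fz n : n`!%:R != 0 :> R[i] by rewrite pnatr_eq0 -lt0n fact_gt0.
rewrite (factS (p + q).+1) (factS p) (factS q).
have := fz (p + q).+1; move: ((p + q).+1`!) (p`!) (q`!) => X x y hX.
rewrite !natrM.
have -> : (p + q).+2%:R = p.+1%:R + q.+1%:R :> R[i].
  by rewrite -natrD addSn addnS.
have hpq : p.+1%:R + q.+1%:R != 0 :> R[i] by rewrite -natrD addSn.
exact: beta_split.
Qed.

Definition zw_coef1 p q j : {poly A} :=
  (-1) ^+ (p.+1 - j) * ('C(p, j) * (p + q - j)`!)%:R * 'X ^+ ((p + q).+1 - j).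
Definition zw_coef2 p q j : {poly A} :=
  (-1) ^+ p.+1 * ('C(q, j) * (p + q - j)`!)%:R * 'X ^+ ((p + q).+1 - j).

Let sgn v : {poly A} := if v is ptz then -1 else 1.

Lemma ground_nat v n : @ground_partial A v n%:R = 0.
Proof. by rewrite -(rmorph_nat iota) ground_partialC. Qed.
Lemma ground_sgn v n : @ground_partial A v ((-1) ^+ n) = 0.
Proof. by rewrite -(rmorph1 iota) -rmorphN -rmorphXn ground_partialC. Qed.

Lemma ground_coef1 v p q j : @ground_partial A v (zw_coef1 p q j) =
  sgn v * ((p + q).+1 - j)%:R * ((-1) ^+ (p.+1 - j) *
   ('C(p, j) * (p + q - j)`!)%:R * 'X ^+ ((p + q).+1 - j).+1).
Proof.
rewrite /zw_coef1 !ground_partialM ground_nat ground_sgn ground_partialXn /sgn.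
exact: ring_coef.
Qed.
Lemma ground_coef2 v p q j : @ground_partial A v (zw_coef2 p q j) =
  sgn v * ((p + q).+1 - j)%:R * ((-1) ^+ p.+1 *
   ('C(q, j) * (p + q - j)`!)%:R * 'X ^+ ((p + q).+1 - j).+1).
Proof.
rewrite /zw_coef2 !ground_partialM ground_nat ground_sgn ground_partialXn /sgn.
exact: ring_coef.
Qed.

Lemma ground_coef1w p q j : (j <= p)%N ->
  @ground_partial A ptw (zw_coef1 p q j) = zw_coef1 p q.+1 j.
Proof.
move=> jp; rewrite ground_coef1 /zw_coef1 /sgn mul1r addnS.
have jpq : (j <= p + q)%N := leq_trans jp (leq_addr _ _).
have E1 : ((p + q).+1 - j = (p + q - j).+1)%N by rewrite subSn.
have E2 : ((p + q).+2 - j = (p + q - j).+2)%N by rewrite subSn ?E1 // leqW.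
by rewrite E2 E1 factS !natrM; exact: ring_coef1.
Qed.
Lemma ground_coef2z p q j : (j <= q)%N ->
  @ground_partial A ptz (zw_coef2 p q j) = zw_coef2 p.+1 q j.
Proof.
move=> jp; rewrite ground_coef2 /zw_coef2 /sgn addSn.
have jpq : (j <= p + q)%N := leq_trans jp (leq_addl _ _).
have E1 : ((p + q).+1 - j = (p + q - j).+1)%N by rewrite subSn.
have E2 : ((p + q).+2 - j = (p + q - j).+2)%N by rewrite subSn ?E1 // leqW.
by rewrite E2 E1 factS !natrM [_ ^+ p.+2]exprS; exact: ring_coef2.
Qed.

Lemma pascal_sum n (f g h : nat -> {poly A}) (G : nat -> F) :
  h 0 = f 0 -> h n.+1 = g n ->
  (forall j, (j < n)%N -> h j.+1 = f j.+1 + g j) ->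
  \sum_(j < n.+1) (f j *: G j + g j *: G j.+1) = \sum_(j < n.+2) h j *: G j.
Proof.
move=> h0 hn hS; rewrite big_split /= big_ord_recl [X in _ + X]big_ord_recr /=.
rewrite [RHS]big_ord_recl [X in _ = _ + X]big_ord_recr /= h0 -addrA.
congr (_ + _); rewrite addrA; congr (_ + _); last by rewrite /bump /= add1n hn.
rewrite -big_split /=; apply: eq_bigr => j _.
by rewrite /bump /= !add1n hS // scalerDl.
Qed.

Lemma bracket_zwE a p r b q s : bracket_zw R a p r b q s =
  \sum_(j < p.+1) zw_coef1 p q j *: current iota ptz a b r s j
  - \sum_(j < q.+1) zw_coef2 p q j *: current iota ptw a b r s j.
Proof. by []. Qed.

Lemma partialB v (x y : F) : D v (x - y) = D v x - D v y.
Proof. exact: freederB. Qed.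
Lemma partial_sum v n (f : 'I_n -> F) :
  D v (\sum_(j < n) f j) = \sum_(j < n) D v (f j).
Proof. exact: freeder_sum. Qed.

Lemma partial_zw_z a p r b q s :
  D ptz (bracket_zw R a p r b q s) = bracket_zw R a p.+1 r b q s.
Proof.
rewrite !bracket_zwE partialB !partial_sum; congr (_ - _); last first.
  apply: eq_bigr => j _; rewrite partialZ.
  rewrite (free_partial_current (@dM ptz) (@dC ptz)) /= scale0r scaler0 addr0.
  by rewrite ground_coef2z // -ltnS.
pose G := current iota ptz a b r s.
transitivity (\sum_(j < p.+1) (@ground_partial A ptz (zw_coef1 p q j) *: G j
    + zw_coef1 p q j *: G j.+1)).
  apply: eq_bigr => j _; rewrite partialZ.
  by rewrite (free_partial_current (@dM ptz) (@dC ptz)) eqxx scale1r.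
apply: (@pascal_sum p (fun j => @ground_partial A ptz (zw_coef1 p q j)) (zw_coef1 p q)).
- rewrite ground_coef1 /zw_coef1 /sgn !subn0 !bin0 addSn factS !natrM exprS.
  exact/esym/ring_coef2.
- rewrite /zw_coef1 !binn addSn !subSS.
  by rewrite !subSn ?leq_addr // subnn.
move=> j jp; rewrite ground_coef1 /zw_coef1 /sgn addSn !subSS.
have jpq : (j < p + q)%N := leq_trans jp (leq_addr _ _).
rewrite binS !mulnDl !natrD mulrDr mulrDl; congr (_ + _).
have -> : (p + q - j = (p + q - j.+1).+1)%N by rewrite -subSS subSn.
have -> : ((p + q).+1 - j = (p + q - j.+1).+2)%N.
  by rewrite subSn 1?ltnW // -subSS [in LHS]subSn.
have -> : (p.+1 - j = (p - j).+1)%N by rewrite subSn // ltnW.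
by rewrite factS !natrM [_ ^+ (p - j).+1]exprS; exact/esym/ring_coef2.
Qed.

Lemma partial_zw_w a p r b q s :
  D ptw (bracket_zw R a p r b q s) = bracket_zw R a p r b q.+1 s.
Proof.
rewrite !bracket_zwE partialB !partial_sum; congr (_ - _).
  apply: eq_bigr => j _; rewrite partialZ.
  rewrite (free_partial_current (@dM ptw) (@dC ptw)) /= scale0r scaler0 addr0.
  by rewrite ground_coef1w // -ltnS.
pose G := current iota ptw a b r s.
transitivity (\sum_(j < q.+1) (@ground_partial A ptw (zw_coef2 p q j) *: G j
    + zw_coef2 p q j *: G j.+1)).
  apply: eq_bigr => j _; rewrite partialZ.
  by rewrite (free_partial_current (@dM ptw) (@dC ptw)) eqxx scale1r.
apply: (@pascal_sum q (fun j => @ground_partial A ptw (zw_coef2 p q j)) (zw_coef2 p q)).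
- rewrite ground_coef2 /zw_coef2 /sgn !subn0 !bin0 addnS factS !natrM mul1r.
  exact/esym/ring_coef1.
- rewrite /zw_coef2 !binn addnS !subSS.
  by rewrite !subSn ?leq_addl.
move=> j jp; rewrite ground_coef2 /zw_coef2 /sgn addnS !subSS.
have jpq : (j < p + q)%N := leq_trans jp (leq_addl _ _).
rewrite binS !mulnDl !natrD mulrDr mulrDl; congr (_ + _).
have -> : (p + q - j = (p + q - j.+1).+1)%N by rewrite -subSS subSn.
have -> : ((p + q).+1 - j = (p + q - j.+1).+2)%N.
  by rewrite subSn 1?ltnW // -subSS [in LHS]subSn.
by rewrite factS !natrM mul1r; exact/esym/ring_coef1.
Qed.
End Modules.

Section Operators.
Variable R : realType.
Local Notation A := (fps R[i]).
Local Notation iota := (polyC : {rmorphism A -> {poly A}}).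
Local Notation F1 := (freealg (Kone R) (mode unit)).
Local Notation F := (freealg (Ktwo R) (mode point)).

Lemma translation_bracket (g h : mode point) :
  free_translation (bracket2 R g h) =
  translate_coef (Ktwo R) g *: bracket2 R (translate_mode g) h
  + translate_coef (Ktwo R) h *: bracket2 R g (translate_mode h).
Proof.
have nM := @null_derM (Ktwo R).
have TN (x : F) : free_translation (- x) = - free_translation x by exact: freederN.
have TZ c (x : F) : free_translation (c *: x) = c *: free_translation x.
  by rewrite /free_translation freederZ // scale0r add0r.
have T0 : free_translation (0 : F) = 0 by exact: freeder0.
have Ts u a p r b q s : free_translation (bracket_same iota u a p r b q s) =
    - r%:~R *: bracket_same iota u a p (r - 1) b q s
    + - s%:~R *: bracket_same iota u a p r b q (s - 1) :> F.
  rewrite /bracket_same TZ free_translation_current scalerDr !scalerA.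
  by congr (_ *: _ + _ *: _); rewrite mulrC.
have Tzw a p r b q s : free_translation (bracket_zw R a p r b q s) =
    - r%:~R *: bracket_zw R a p (r - 1) b q s
    + - s%:~R *: bracket_zw R a p r b q (s - 1).
  rewrite !bracket_zwE [LHS]freederB !scalerBr [RHS]addrACA -opprD.
  congr (_ - _); rewrite [LHS]freeder_sum !scaler_sumr -big_split /=;
    apply: eq_bigr => j _; rewrite -/(free_translation _) TZ;
    rewrite free_translation_current scalerDr !scalerA;
    by congr (_ *: _ + _ *: _); rewrite mulrC.
case: g h => [[] a p r|u p] [[] b q s|v q] /=;
  rewrite ?scale0r ?scaler0 ?addr0 ?add0r ?T0 ?Ts ?Tzw //.
have oppZ (c d : Ktwo R) (x y : F) :
    - (c *: x + d *: y) = d *: - y + c *: - x by rewrite opprD addrC !scalerN.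
by rewrite TN Tzw oppZ.
Qed.

Lemma translation_annihilator (g : mode point) : annihilator g ->
  translate_coef (Ktwo R) g = 0 \/ annihilator (translate_mode g).
Proof.
case: g => [u a p r|//] /=; rewrite le_eqVlt => /orP[/eqP <-|r0].
  by left; rewrite oppr0.
by right; rewrite subr_ge0 -gtz0_ge1.
Qed.

Lemma partial_bracket v (g h : mode point) :
  free_partial (@ground_partial A v) v (bracket2 R g h) =
  raise_coef (Ktwo R) v g *: bracket2 R (raise_mode g) h
  + raise_coef (Ktwo R) v h *: bracket2 R g (raise_mode h).
Proof.
have PN (x : F) : free_partial (@ground_partial A v) v (- x)
  = - free_partial (@ground_partial A v) v x by exact: freederN.
have P0 : free_partial (@ground_partial A v) v (0 : F) = 0 by exact: freeder0.
case: g h => [[] a p r|u p] [[] b q s|w q] /=;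
  rewrite ?scaler0 ?addr0 ?P0 ?partial_same // ?PN;
  case: v PN P0 => PN P0;
  by rewrite ?partial_zw_z ?partial_zw_w ?scale0r ?scale1r ?addr0 ?add0r.
Qed.

Lemma partial_annihilator v (g : mode point) : annihilator g ->
  raise_coef (Ktwo R) v g = 0 \/ annihilator (raise_mode g).
Proof. by case: g => [u a p r|//] /=; right. Qed.

Definition translation : V2 R -> V2 R :=
  indder (br := @bracket2 R) (ann := @annihilator point)
    (\0 : {additive Ktwo R -> Ktwo R})
    (@translate_coef (Ktwo R) point) (@translate_mode point).

Definition partial (v : point) : V2 R -> V2 R :=
  indder (br := @bracket2 R) (ann := @annihilator point)
    (@ground_partial A v : {additive Ktwo R -> Ktwo R})
    (@raise_coef (Ktwo R) point v) (@raise_mode point).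

(* x |0> *)
Definition state2 (x : F) : V2 R := x *: vacuum (@bracket2 R) (@annihilator point).
Definition state1 (x : F1) : V1 R := x *: vacuum (@bracket1 R) (@annihilator unit).

Lemma translationE (x : F) : translation (state2 x) = state2 (free_translation x).
Proof.
rewrite /state2 !vacuumZ; apply: indderE.
- exact: null_derM.
- exact: translation_bracket.
- exact: translation_annihilator.
Qed.

Lemma partialE v (x : F) :
  partial v (state2 x) = state2 (free_partial (@ground_partial A v) v x).
Proof.
rewrite /state2 !vacuumZ; apply: indderE.
- exact: ground_partialM.
- exact: partial_bracket.
- exact: partial_annihilator.
Qed.

Definition mode_at (u : point) (g : mode unit) : mode point :=
  match g with Imode _ a p r => Imode u a p r | Kmode _ p => Kmode u p end.

(* The embeddings v |-> v(z) and v |-> v(w). *)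
Definition embed (u : point) : V1 R -> V2 R :=
  indmap (br := @bracket1 R) (ann := @annihilator unit)
    iota (mode_at u) (@bracket2 R) (@annihilator point).

Lemma freemap_bracket u (g h : mode unit) :
  freemap iota (mode_at u) (bracket1 R g h) = bracket2 R (mode_at u g) (mode_at u h).
Proof.
have E a p r b q s : freemap iota (mode_at u) (bracket_same idfun tt a p r b q s)
    = bracket_same iota u a p r b q s.
  rewrite /bracket_same /current freemapZ rmorphN; congr (_ *: _).
  rewrite freemapB freemap_sum freemapZ freemap_letter; congr (_ - _).
    apply: eq_bigr => c _; rewrite freemapZ freemap_letter rmorphM.
    by [].
  by rewrite !rmorphM rmorph_int rmorph_nat.
case: g h => [[] a p r|[] p] [[] b q s|[] q] /=; rewrite ?freemap0 ?E //;
  by case: u {E}.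
Qed.

Lemma embedE u (x : F1) :
  embed u (state1 x) = state2 (freemap iota (mode_at u) x).
Proof.
rewrite /state1 /state2 !vacuumZ; apply: indmapE; first exact: freemap_bracket.
by case.
Qed.
End Operators.

Fixpoint delta_pairs (C : nzRingType) (s : seq 'I_3) : C :=
  if s is a :: b :: s' then (a == b)%:R * delta_pairs C s' else 1.

Section LocalCharges.
Variable R : realType.
Local Notation C := R[i].
Local Notation A := (fps C).
Local Notation iota := (polyC : {rmorphism A -> {poly A}}).
Local Notation F1 := (freealg (Kone R) (mode unit)).
Local Notation F := (freealg (Ktwo R) (mode point)).

Definition permuted (s : seq 'I_3) (sigma : 'S_(size s)) : seq 'I_3 :=
  [seq tnth (in_tuple s) (sigma k) | k <- enum 'I_(size s)].

(* t_{i_1,...,i_2r}, with s the list of its indices. *)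
Definition sym_delta (s : seq 'I_3) : C :=
  (size s)`!%:R^-1 * \sum_(sigma : 'S_(size s)) delta_pairs C (permuted sigma).

(* I^{(a_1}_{-1}(u) ... I^{a_n)}_{-1}(u), symmetrized with weight one. *)
Section SymmetricProduct.
Variables (K : comNzRingType) (io : {rmorphism A -> K}) (P : choiceType).
Definition sym_prod (u : P) (s : seq 'I_3) : freealg K (mode P) :=
  cst io (size s)`!%:R^-1 *:
    \sum_(sigma : 'S_(size s)) \prod_(a <- permuted sigma) Igen K u a 0 (-1).
End SymmetricProduct.

Definition hbar1 : Kone R := hbar idfun.
Definition hbar2 : Ktwo R := hbar iota.
Definition cst1 : C -> Kone R := cst idfun.
Definition cst2 : C -> Ktwo R := cst iota.
Definition inv_zw : Ktwo R := 'X : {poly A}.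

Definition bigO1 (k : nat) (v : V1 R) : Prop :=
  exists u : V1 R, v = ((hbar1 ^+ k)%:A : F1) *: u.
Definition bigO2 (k : nat) (v : V2 R) : Prop :=
  exists u : V2 R, v = ((hbar2 ^+ k)%:A : F) *: u.

(* In the second sum the prefactor is zero for m = 1, where the truncated m - 3
   would be meaningless; the term is dropped explicitly. *)
Definition sigma_form (m : nat) : V1 R := state1 (
  \sum_(i : m.+1.-tuple 'I_3)
     cst1 (sym_delta i) *: \prod_(a <- i) Igen (Kone R) tt a 0 (-1)
  + if m == 1%N then 0 else
    (hbar1 * cst1 ((m.+1 * m.+2 * m.-1)%:R / (2 * m)%:R)) *:
    \sum_(i : (m - 3).-tuple 'I_3) \sum_a \sum_b \sum_c
      cst1 (sym_delta i * sl2f R a b c) *: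
        (Igen (Kone R) tt a 0 (- 2) * Igen (Kone R) tt b 1 (- 1)
         * sym_prod idfun tt (c :: i))).

Definition zeta (m n : nat) : C := (2 * m.+1 * n.+1)%:R / (m * n)%:R.

Definition A_form (m n : nat) : V2 R := state2 (
  (cst2 (zeta m n) * hbar2 ^+ 2 * inv_zw) *:
  \sum_(i : m.-1.-tuple 'I_3) \sum_(j : n.-1.-tuple 'I_3) \sum_a
    cst2 (sym_delta i * sym_delta j) *:
      (free_translation (sym_prod iota ptz (a :: i)) * sym_prod iota ptw (a :: j))).

(* The factor m%:R is needed: with zeta alone the formula for the 0-th product
   fails as soon as m > 1 (by a nonzero multiple of a translate). *)
Definition B_form (m n : nat) : V2 R := state2 (
  (cst2 (m%:R * zeta m n) * hbar2 ^+ 2 * inv_zw ^+ 2) *: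
  \sum_(i : m.-1.-tuple 'I_3) \sum_(j : n.-1.-tuple 'I_3) \sum_a
    cst2 (sym_delta i * sym_delta j) *:
      (sym_prod iota ptz (a :: i) * sym_prod iota ptw (a :: j))).

Definition twisted (v : point) (j : nat) (x : V2 R) : V2 R :=
  partial v x - (cst2 (j%:R / 2) *: Kgen (Ktwo R) v 0 : F) *: x.

(* Y X r v is X_(r) v.  These properties determine Y, since the states are
   generated from |0> by (-1)-st products, translations and the central modes;
   that such a Y exists is the reconstruction theorem.  In sf_translation,
   d/dx acts on sum_r X_(r) x^(-r-1).  In sf_normal_order,
   :A(x) B(x): = A(x)_+ B(x) + B(x) A(x)_-, where A(x)_+ collects the modes
   A_(r) with r < 0; the sum is finite on each vector, and N is any bound beyond
   which all terms vanish. *)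
Record is_state_field_map (Y : V2 R -> int -> V2 R -> V2 R) : Prop := {
  sf_linear_state : forall (c : Ktwo R) X X' r v,
    Y ((c%:A : F) *: X + X') r v = (c%:A : F) *: Y X r v + Y X' r v;
  sf_linear : forall X r (c : Ktwo R) v v',
    Y X r ((c%:A : F) *: v + v') = (c%:A : F) *: Y X r v + Y X r v';
  sf_field : forall X v, exists N : int, forall r, N <= r -> Y X r v = 0;
  sf_vacuum : forall r v, Y (state2 1) r v = if r == -1 then v else 0;
  sf_generator : forall u a p r v,
    Y (state2 (Igen (Ktwo R) u a p (-1))) r v = Igen (Ktwo R) u a p r *: v;
  sf_central : forall u p X r v,
    Y (Kgen (Ktwo R) u p *: X) r v = Kgen (Ktwo R) u p *: Y X r v;
  sf_translation : forall X r v,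
    Y (translation X) r v = - ((r%:~R : F) *: Y X (r - 1) v);
  sf_normal_order : forall X X' r v (N : nat),
    (forall j : nat, (N <= j)%N -> Y X j%:Z v = 0 /\ Y X' (r + j%:Z) v = 0) ->
    Y (Y X (-1) X') r v =
      \sum_(j < N) (Y X (- 1 - j%:Z) (Y X' (r + j%:Z) v)
                    + Y X' (r - 1 - j%:Z) (Y X j%:Z v)) }.

(* The homomorphism L_(z,w) -> L((w-z)), one power series in w - z per mode. *)
Definition expand_mode (g : mode point) : fps F1 :=
  match g with
  | Imode ptz a p r => fpsC (Igen (Kone R) tt a p r)
  | Kmode ptz p => fpsC (Kgen (Kone R) tt p)
  | Imode ptw a p r => Fps (fun s => cst1 s`!%:R^-1 *: Igen (Kone R) tt a (p + s) r)
  | Kmode ptw p => Fps (fun s => cst1 s`!%:R^-1 *: Kgen (Kone R) tt (p + s))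
  end.

(* expand x e is the coefficient of (w-z)^e in the image of x, where
   (z-w)^-k = (-1)^k (w-z)^-k. *)
Definition expand (x : F) (e : int) : F1 :=
  wordext (fun (c : {poly A}) s => \sum_(k < size c)
    (((-1) ^+ k * c`_k : Kone R) *:
      if e + k%:Z is Posz n then fcoef (\prod_(g <- s) expand_mode g) n else 0)) x.

(* Graph of the induced map from the two-parameter module to Laurent series in
   w - z over the one-parameter module. *)
Definition is_expansion (v : V2 R) (phi : int -> V1 R) : Prop :=
  exists2 x : F, v = state2 x & forall e, phi e = state1 (expand x e).

Definition regular_mod_translates (k : nat) (v : V2 R) : Prop :=
  exists Z phi, is_expansion (v - translation Z) phi
    /\ forall e, e < 0 -> bigO1 k (phi e).
End LocalCharges.

(* Main.v *)
From HB Require Import structures.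
Require Import Defs.
From mathcomp Require Import all_boot all_order all_algebra perm.
From mathcomp Require Import boolp reals complex.
From mathcomp Require Import finmap monalg ring zify.

Set Implicit Arguments.
Unset Strict Implicit.
Unset Printing Implicit Defensive.

Import Order.TTheory GRing.Theory Num.Theory.
Local Open Scope ring_scope.

(** All modes commute up to a multiple of h, so replacing the modes by commuting
    variables attaches to L|0>, modulo h, a polynomial, and to a vector congruent to
    h ^ k L|0> modulo h ^ (k + 1) a polynomial of order k, its symbol
    ([has_symbol]).  Two vectors with the same symbol of order k agree modulo
    h ^ (k + 1) ([has_symbol_inj]).  Both sides of the formula for the zeroth product
    are O(h ^ 2), so the first claim is an equality of two polynomials.

    On the left, a mode I_r with r >= 0 acts on a product of the I_{-1} with a factor
    h ^ (r + 1) ([U_ann]).  Modulo h ^ 3 the zeroth product of two such products is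
    therefore given by contracting one letter with its mode 0 or 1, or two letters with
    their modes 0 ([YU_0_3]); in the last two cases the remaining word is translated.
    The single contraction with mode 0 looks like a term of order h, but its
    coefficient vanishes by antisymmetry of the structure constants.  Its next
    coefficient depends on the order of the letters; since the tensors t are symmetric,
    both factors are invariant under reversal of words, and the sum of a reversed
    product and the product is O(h ^ 2) ([rev_symmetrized_Ok2]).  Hence half of a
    commutator remains ([has_symbol_half_commutator]).  The terms of order h in the
    charges enter through their first order products with the leading terms
    ([correction_left_product], [correction_right_product]).

    Contraction of t with vectors gives powers of norm2 ([sym_contract],
    [sym_contract1], [sym_contract2]), and brackets act on symbols as derivations
    ([comder]) built from cross products.  So do T and the partial derivatives on the
    right-hand side.  Products of two structure constants reduce everything to scalar
    products of the seven vectors that occur, and the equality becomes a polynomial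
    identity in these ([classical_identity]).

    For the regularity of A, the pole is simple, and at coinciding points the symbol
    of its residue is a multiple of T(norm2 a ^ (M + N + 1)), with m = 2 M + 1 and
    n = 2 N + 1.  Subtracting the translate of a multiple of the (M + N + 1)-st power
    of the Casimir element, divided by z - w, leaves a residue of order h besides the
    factor h ^ 2 ([expansion_singular]).

    The argument is carried out over an abstract algebra with the properties of a free
    algebra ([free_datum]) and an abstract module, and specialized at the end. *)

(** * Words of a free algebra up to reordering *)

Section WordPermutation.
Variables (K : comNzRingType) (G : eqType) (F : algType K) (l : G -> F).
Local Notation w s := (\prod_(g <- s) l g).

(** A permutation is a product of swaps of adjacent letters, so that the difference
    of two permuted words is a sum of differences of words that differ by one such
    swap.  The induction brings the head of the second word to the front. *)
Lemma perm_word_ind (P : F -> Prop) c :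
  P 0 -> (forall x y, P x -> P y -> P (x + y)) ->
  (forall s t g h, P (c *: (w s * l g * l h * w t - w s * l h * l g * w t))) ->
  forall s t, perm_eq s t -> P (c *: (w s - w t)).
Proof.
move=> P0 PD Psw s t st.
suff H : forall n u s t, size s = n -> perm_eq s t -> P (c *: (w u * w s - w u * w t)).
  by have := H _ [::] s t erefl st; rewrite big_nil !mul1r.
elim=> [|n IH] u {}s {st}t.
  by move=> /size0nil ->; rewrite perm_sym => /perm_nilP ->; rewrite subrr scaler0.
case: s => // a s [sn] st.
have /path.splitPr E : a \in t by rewrite -(perm_mem st) mem_head.
case: E st => t1 t2 st.
have st' : perm_eq s (t1 ++ t2).
  by rewrite -(perm_cons a) (perm_trans st) // perm_catC /= perm_cons perm_catC.
have H1 := IH (rcons u a) _ _ sn st'.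
have H2 : P (c *: (w u * w (a :: t1 ++ t2) - w u * w (t1 ++ a :: t2))).
  move: (t1) u {IH H1 st st'} => r; elim: r => [|b r IHr] u.
    by rewrite subrr scaler0.
  have := PD _ _ (Psw u (r ++ t2) a b) (IHr (rcons u b)); rewrite -scalerDr.
  by rewrite -cats1 /= !(big_cat, big_cons, big_nil) /= !mulr1 !mulrA addrA subrK.
have := PD _ _ H1 H2; rewrite -scalerDr -cats1 /= !(big_cat, big_cons, big_nil) /=.
by rewrite !mulr1 !mulrA addrA subrK.
Qed.
End WordPermutation.

Section CommutativeSymbol.
Variables (K : comNzRingType) (G : choiceType).
Local Notation F := (freealg K G).

Local Notation M := ({malg K[{cmonom G}]} : comNzRingType).

Definition monomial (s : seq G) : {cmonom G} :=
  foldr (fun g m => mmul (ucm g) m) mone s.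

Lemma monomialE s g : monomial s g = count_mem g s.
Proof.
elim: s => [|h s IH] /=; first by rewrite cm1.
by rewrite cmM cmU IH.
Qed.

Lemma monomial_cat s t : monomial (s ++ t) = mmul (monomial s) (monomial t).
Proof. by apply/eqP/cmP => g; rewrite cmM !monomialE count_cat. Qed.

(** A section of the abelianization: the letters of a monomial in an arbitrary
    fixed order. *)
Definition canonical_word (m : {cmonom G}) : seq G :=
  flatten [seq nseq (m g) g | g <- enum_fset (finsupp m)].

Lemma count_canonical_word m g : count_mem g (canonical_word m) = m g.
Proof.
rewrite /canonical_word count_flatten -map_comp sumnE big_map.
rewrite (eq_bigr (fun h => m h * (h == g))%N); last first.
  by move=> h _ /=; rewrite count_nseq /= mulnC.
case: (mdomP m g) => hg.
  rewrite (big_fsetD1 g) //= eqxx muln1 big_seq big1 ?addn0 // => h.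
  by rewrite in_fsetD1 => /andP[/negbTE-> _]; rewrite muln0.
rewrite big_seq big1 // => h hh.
case: eqP => [E|_]; last by rewrite muln0.
by rewrite -E hh in hg.
Qed.

Lemma perm_canonical_word s : perm_eq s (canonical_word (monomial s)).
Proof.
by apply/allP => g _ /=; rewrite count_canonical_word monomialE.
Qed.

Lemma monomial_canonical_word m : monomial (canonical_word m) = m.
Proof. by apply/eqP/cmP => g; rewrite monomialE count_canonical_word. Qed.

Definition msym : F -> M :=
  wordext (fun c s => (<< c *g monomial s >> : {malg K[{cmonom G}]}) : M).

Let fD a b s : (<< a + b *g monomial s >> : {malg K[{cmonom G}]}) =
  << a *g monomial s >> + << b *g monomial s >>.
Proof. exact: monalgUD. Qed.

Lemma msym_word c s :
  msym (c *: word K s) = (<< c *g monomial s >> : {malg K[{cmonom G}]}).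
Proof. exact: wordextE. Qed.

Lemma msym_is_zmod_morphism : zmod_morphism msym.
Proof. exact: wordextB. Qed.

Lemma msym_is_monoid_morphism : monoid_morphism msym.
Proof.
split.
  rewrite -(word0 K G) -[word _ _]scale1r msym_word /=; exact: mpolyC1E.
have s0 : msym 0 = 0 by exact: wordext0.
have sD : {morph msym : x y / x + y} by exact: wordextD.
move=> x y; elim/freealg_ind: x y => [y|x1 x2 h1 h2 y|c s y].
- by rewrite mul0r s0 mul0r.
- by rewrite mulrDl !sD h1 h2 mulrDl.
elim/freealg_ind: y => [|y1 y2 h1 h2|c' t].
- by rewrite mulr0 s0 mulr0.
- by rewrite mulrDr !sD h1 h2 mulrDr.
rewrite -scalerAl -scalerAr scalerA -word_cat !msym_word monomial_cat.
by rewrite [RHS]malgM_def fgmulUU.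
Qed.

HB.instance Definition _ := GRing.isZmodMorphism.Build F M msym
  msym_is_zmod_morphism.
HB.instance Definition _ := GRing.isMonoidMorphism.Build F M msym
  msym_is_monoid_morphism.

Lemma msymD : {morph msym : x y / x + y}. Proof. exact: raddfD. Qed.
Lemma msymB : {morph msym : x y / x - y}. Proof. exact: raddfB. Qed.
Lemma msym0 : msym 0 = 0. Proof. exact: raddf0. Qed.
Lemma msym1 : msym 1 = 1. Proof. exact: rmorph1. Qed.
Lemma msymM : {morph msym : x y / x * y}. Proof. exact: rmorphM. Qed.
Lemma msym_sum I r (P : pred I) f :
  msym (\sum_(i <- r | P i) f i) = \sum_(i <- r | P i) msym (f i).
Proof. exact: raddf_sum. Qed.

Definition unmsym (p : M) : F :=
  mmap (in_alg F) (fun m => word K (canonical_word m)) (p : {malg K[{cmonom G}]}).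

Lemma unmsym_msym_word c s :
  unmsym (msym (c *: word K s)) = c *: word K (canonical_word (monomial s)).
Proof. by rewrite msym_word /unmsym mmapU /= -scalerAl mul1r. Qed.

Lemma unmsymD p q : unmsym (p + q) = unmsym p + unmsym q.
Proof. exact: raddfD. Qed.

Lemma unmsym0 : unmsym 0 = 0.
Proof. exact: raddf0. Qed.

(** The kernel of the abelianization is the ideal generated by commutators of
    letters. *)
Lemma msym_kernel (P : F -> Prop) :
  P 0 -> (forall x y, P x -> P y -> P (x + y)) ->
  (forall c s t g h, P (c *: (word K s * letter K g * letter K h * word K t
                       - word K s * letter K h * letter K g * word K t))) ->
  forall x, msym x = 0 -> P x.
Proof.
move=> P0 PD Psw.
suff H x : P (x - unmsym (msym x)).
  by move=> x hx; have := H x; rewrite hx unmsym0 subr0.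
elim/freealg_ind: x => [|x y hx hy|c s].
- by rewrite msym0 unmsym0 subr0.
- have -> : x + y - unmsym (msym (x + y)) = (x - unmsym (msym x)) + (y - unmsym (msym y)).
    by rewrite msymD unmsymD opprD addrACA.
  exact: PD.
- rewrite unmsym_msym_word -scalerBr.
  exact: (@perm_word_ind K G F (@letter K G) P c P0 PD (Psw c) _ _ (perm_canonical_word s)).
Qed.

Lemma msym_unmsym p : msym (unmsym p) = p.
Proof.
rewrite {2}[p]monalgE /unmsym mmapE msym_sum; apply: eq_bigr => m _.
have -> c : GRing.in_alg F c * word K (canonical_word m) = c *: word K (canonical_word m).
  by rewrite -scalerAl mul1r.
by rewrite msym_word monomial_canonical_word.
Qed.

Definition freerev : F -> F := wordext (fun c s => c *: word K (rev s)).
Let rD a b (s : seq G) :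
  (a + b) *: word K (rev s) = a *: word K (rev s) + b *: word K (rev s).
Proof. exact: scalerDl. Qed.
Lemma freerevD : {morph freerev : x y / x + y}.
Proof. exact: wordextD. Qed.
Lemma freerev_word c s : freerev (c *: word K s) = c *: word K (rev s).
Proof. exact: wordextE. Qed.
Lemma freerevM x y : freerev (x * y) = freerev y * freerev x.
Proof.
have r0 : freerev 0 = 0 by exact: wordext0.
elim/freealg_ind: x y => [y|x1 x2 h1 h2 y|c s y].
- by rewrite mul0r r0 mulr0.
- by rewrite mulrDl !freerevD h1 h2 mulrDr.
elim/freealg_ind: y => [|y1 y2 h1 h2|c' t].
- by rewrite mulr0 r0 mul0r.
- by rewrite mulrDr !freerevD h1 h2 mulrDl.
rewrite -scalerAl -scalerAr scalerA -word_cat !freerev_word rev_cat word_cat.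
by rewrite -scalerAl -scalerAr scalerA [c * _]mulrC.
Qed.
Lemma freerevZ c x : freerev (c *: x) = c *: freerev x.
Proof.
have E (z : F) : c *: z = (c *: word K [::]) * z by rewrite word0 -scalerAl mul1r.
by rewrite E freerevM freerev_word word0 -scalerAr mulr1.
Qed.
Lemma freerev1 : freerev 1 = 1.
Proof. by rewrite -(word0 K G) -[word _ _]scale1r freerev_word. Qed.
Lemma freerev_letter g : freerev (letter K g) = letter K g.
Proof. by rewrite -word1 -[word _ _]scale1r freerev_word. Qed.

End CommutativeSymbol.

(** What the proof uses of the free algebra: induction on linear combinations of
    words, extension of a map on letters to a derivation, reversal of words, and the
    abelianization [sym] onto a commutative ring, with a section and with its kernel. *)
Record free_datum (K : comNzRingType) (G : Type) := FreeDatum {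
  fd_alg :> algType K;
  fd_letter : G -> fd_alg;
  fd_ind : forall P : fd_alg -> Prop, P 0 ->
    (forall x y, P x -> P y -> P (x + y)) ->
    (forall c s, P (c *: \prod_(g <- s) fd_letter g)) -> forall x, P x;
  fd_der : {additive K -> K} -> (G -> fd_alg) -> fd_alg -> fd_alg;
  fd_derD : forall d0 d, {morph fd_der d0 d : x y / x + y};
  fd_derM : forall (d0 : {additive K -> K}) d,
    (forall a b, d0 (a * b) = d0 a * b + a * d0 b) ->
    forall x y, fd_der d0 d (x * y) = fd_der d0 d x * y + x * fd_der d0 d y;
  fd_derZ : forall (d0 : {additive K -> K}) d,
    (forall a b, d0 (a * b) = d0 a * b + a * d0 b) ->
    forall c x, fd_der d0 d (c *: x) = d0 c *: x + c *: fd_der d0 d x;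
  fd_der_letter : forall (d0 : {additive K -> K}) d,
    (forall a b, d0 (a * b) = d0 a * b + a * d0 b) ->
    forall g, fd_der d0 d (fd_letter g) = d g;
  fd_rev : fd_alg -> fd_alg;
  fd_revD : {morph fd_rev : x y / x + y};
  fd_revM : forall x y, fd_rev (x * y) = fd_rev y * fd_rev x;
  fd_rev1 : fd_rev 1 = 1;
  fd_revZ : forall c x, fd_rev (c *: x) = c *: fd_rev x;
  fd_rev_letter : forall g, fd_rev (fd_letter g) = fd_letter g;
  comalg : comNzRingType;
  sym : fd_alg -> comalg;
  unsym : comalg -> fd_alg;
  fd_symB : {morph sym : x y / x - y};
  fd_symM : {morph sym : x y / x * y};
  fd_sym1 : sym 1 = 1;
  sym_unsym : cancel unsym sym;
  sym_kernel : forall (P : fd_alg -> Prop),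
    P 0 -> (forall x y, P x -> P y -> P (x + y)) ->
    (forall c s t g h, P (c *:
      (\prod_(k <- s) fd_letter k * fd_letter g * fd_letter h * \prod_(k <- t) fd_letter k
       - \prod_(k <- s) fd_letter k * fd_letter h * fd_letter g * \prod_(k <- t) fd_letter k))) ->
    forall x, sym x = 0 -> P x }.

Definition free_datum_of (K : comNzRingType) (G : choiceType) : free_datum K G :=
  @FreeDatum K G (freealg K G) (@letter K G) (@freealg_ind K G)
    (@freeder K G) (@freederD K G) (@freederM K G) (@freederZ K G)
    (@freeder_letter K G)
    (@freerev K G) (@freerevD K G) (@freerevM K G) (@freerev1 K G) (@freerevZ K G) (@freerev_letter K G)
    _ (@msym K G) (@unmsym K G) (@msymB K G) (@msymM K G) (@msym1 K G)
    (@msym_unmsym K G) (@msym_kernel K G).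

(** * Symbols and derivations *)

Section Symbol.
Variables (K : comNzRingType) (G : Type) (D : free_datum K G).
Implicit Types x y : D.
Local Notation S := (@sym K G D).

HB.instance Definition _ := GRing.isZmodMorphism.Build D (comalg D) S
  (@fd_symB K G D).
Lemma sym_is_monoid_morphism : monoid_morphism S.
Proof. by split; [exact: fd_sym1|exact: fd_symM]. Qed.
HB.instance Definition _ := GRing.isMonoidMorphism.Build D (comalg D) S
  sym_is_monoid_morphism.

Lemma symB : {morph S : x y / x - y}. Proof. exact: rmorphB. Qed.
Lemma symM : {morph S : x y / x * y}. Proof. exact: rmorphM. Qed.
Lemma sym1 : S 1 = 1. Proof. exact: rmorph1. Qed.
Lemma symD : {morph S : x y / x + y}. Proof. exact: rmorphD. Qed.
Lemma symN : {morph S : x / - x}. Proof. exact: rmorphN. Qed.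
Lemma sym0 : S 0 = 0. Proof. exact: rmorph0. Qed.
Lemma symX n : {morph S : x / x ^+ n}. Proof. exact: rmorphXn. Qed.
Lemma sym_sum I r (P : pred I) f :
  S (\sum_(i <- r | P i) f i) = \sum_(i <- r | P i) S (f i).
Proof. exact: rmorph_sum. Qed.
Lemma symbol_prod I r (P : pred I) f :
  S (\prod_(i <- r | P i) f i) = \prod_(i <- r | P i) S (f i).
Proof. exact: rmorph_prod. Qed.

Definition csc (c : K) : comalg D := S c%:A.
Lemma csc_is_zmod_morphism : zmod_morphism csc.
Proof. by move=> a b; rewrite /csc scalerBl symB. Qed.
Lemma csc_is_monoid_morphism : monoid_morphism csc.
Proof.
split; first by rewrite /csc scale1r sym1.
by move=> a b; rewrite /csc -symM -scalerAl mul1r scalerA.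
Qed.
HB.instance Definition _ := GRing.isZmodMorphism.Build K (comalg D) csc
  csc_is_zmod_morphism.
HB.instance Definition _ := GRing.isMonoidMorphism.Build K (comalg D) csc
  csc_is_monoid_morphism.

Lemma symZ c x : S (c *: x) = csc c * S x.
Proof. by rewrite /csc -symM -scalerAl mul1r. Qed.

Definition cvar (g : G) : comalg D := S (fd_letter D g).

Section CommutativeDerivation.
Variables (d0 : {additive K -> K}) (d : G -> D).
Hypothesis d0M : forall a b : K, d0 (a * b) = d0 a * b + a * d0 b.
Local Notation der := (fd_der d0 d).

Lemma fd_der0 : der 0 = 0.
Proof. by apply: (addrI (der 0)); rewrite -fd_derD !addr0. Qed.
Lemma fd_derN x : der (- x) = - der x.
Proof. by apply: (addrI (der x)); rewrite -fd_derD !subrr fd_der0. Qed.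
Lemma fd_derB x y : der (x - y) = der x - der y.
Proof. by rewrite fd_derD fd_derN. Qed.
Lemma fd_der_sum I r (P : pred I) f :
  der (\sum_(i <- r | P i) f i) = \sum_(i <- r | P i) der (f i).
Proof. exact: (big_morph _ (fd_derD (f := D) d0 d) fd_der0). Qed.

(** A derivation of the free algebra preserves the commutator ideal, hence it
    descends to the abelianization; [comder] is the induced derivation. *)
Lemma sym_der x y : S x = S y -> S (der x) = S (der y).
Proof.
move=> h; apply/eqP; rewrite -subr_eq0 -symB -fd_derB; apply/eqP.
have : S (x - y) = 0 by rewrite symB h subrr.
move: (x - y); apply: sym_kernel => [|u v hu hv|c s t g k].
- by rewrite fd_der0 sym0.
- by rewrite fd_derD symD hu hv addr0.
move: (fd_letter D g) (fd_letter D k) (\prod_(i <- s) _) (\prod_(i <- t) _) => a b u v.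
rewrite fd_derZ // fd_derB !fd_derM //.
rewrite !(symD, symZ, symN, symM); ring.
Qed.

Definition comder (p : comalg D) : comalg D := S (der (unsym p)).

Lemma comderE x : comder (S x) = S (der x).
Proof. by apply: sym_der; rewrite sym_unsym. Qed.

Lemma comder_is_zmod_morphism : zmod_morphism comder.
Proof.
move=> p q; rewrite -[p]sym_unsym -[q]sym_unsym -symB !comderE fd_derB symB.
by [].
Qed.
HB.instance Definition _ := GRing.isZmodMorphism.Build (comalg D) (comalg D) comder
  comder_is_zmod_morphism.

Lemma comderM p q : comder (p * q) = comder p * q + p * comder q.
Proof.
rewrite -[p]sym_unsym -[q]sym_unsym -symM !comderE fd_derM // symD !symM.
by [].
Qed.

Lemma comder_var g : comder (cvar g) = S (d g).
Proof. by rewrite comderE fd_der_letter. Qed.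

Lemma fd_der1 : der 1 = 0.
Proof.
have := fd_derM (f := D) d d0M 1 1; rewrite !mulr1 mul1r => /eqP.
by rewrite -subr_eq0 opprD addNKr oppr_eq0 => /eqP.
Qed.

Lemma comder_csc c : comder (csc c) = csc (d0 c).
Proof. by rewrite comderE fd_derZ // fd_der1 scaler0 addr0. Qed.

End CommutativeDerivation.
End Symbol.

(** * The classical limit *)

Section Semiclassical.
Variables (K : comNzRingType) (G : Type) (D : free_datum K G) (V : lmodType D).
Variables (h : K).

Definition sc (c : K) (v : V) : V := (c%:A : D) *: v.

Lemma scZ c (x : D) v : x *: sc c v = sc c (x *: v).
Proof. by rewrite /sc !scalerA -scalerAl -scalerAr mul1r mulr1. Qed.
Lemma scE c (x : D) v : sc c (x *: v) = (c *: x) *: v.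
Proof. by rewrite /sc scalerA -scalerAl mul1r. Qed.
Lemma scA a b v : sc a (sc b v) = sc (a * b) v.
Proof. by rewrite {2}/sc scE scalerA. Qed.
Lemma scDr c u v : sc c (u + v) = sc c u + sc c v.
Proof. exact: scalerDr. Qed.
Lemma scNr c u : sc c (- u) = - sc c u.
Proof. exact: scalerN. Qed.
Lemma scBr c u v : sc c (u - v) = sc c u - sc c v.
Proof. exact: scalerBr. Qed.
Lemma sc0r c : sc c 0 = 0.
Proof. exact: scaler0. Qed.
Lemma sc1 v : sc 1 v = v.
Proof. by rewrite /sc !scale1r. Qed.
Lemma scDl a b v : sc (a + b) v = sc a v + sc b v.
Proof. by rewrite /sc !scalerDl. Qed.
Lemma scNl a v : sc (- a) v = - sc a v.
Proof. by rewrite /sc !scaleNr. Qed.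
Lemma sc0l v : sc 0 v = 0.
Proof. by rewrite /sc !scale0r. Qed.
Lemma sc_sumr c I r (P : pred I) f :
  sc c (\sum_(i <- r | P i) f i) = \sum_(i <- r | P i) sc c (f i).
Proof. exact: scaler_sumr. Qed.

(** The filtration of the module by powers of h, and congruence modulo h ^ k. *)
Definition Ok (k : nat) (v : V) : Prop := exists u, v = sc (h ^+ k) u.
Definition eqm k (u v : V) : Prop := Ok k (u - v).

Lemma Ok0 k : Ok k 0.
Proof. by exists 0; rewrite sc0r. Qed.
Lemma OkD k u v : Ok k u -> Ok k v -> Ok k (u + v).
Proof. by move=> [a ->] [b ->]; exists (a + b); rewrite scDr. Qed.
Lemma OkN k u : Ok k u -> Ok k (- u).
Proof. by move=> [a ->]; exists (- a); rewrite scNr. Qed.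
Lemma OkZ k (x : D) u : Ok k u -> Ok k (x *: u).
Proof. by move=> [a ->]; exists (x *: a); rewrite scZ. Qed.
Lemma Ok_sc k l u : Ok k u -> Ok (l + k) (sc (h ^+ l) u).
Proof. by move=> [a ->]; exists a; rewrite scA exprD. Qed.
Lemma Ok_scc k c u : Ok k u -> Ok k (sc c u).
Proof. exact: OkZ. Qed.
Lemma Ok_sc1 k u : Ok k u -> Ok k.+1 (sc h u).
Proof. by move=> H; rewrite -[h]expr1 -add1n; apply: Ok_sc. Qed.
Lemma Ok_sum k I r (P : pred I) f : (forall i, P i -> Ok k (f i)) ->
  Ok k (\sum_(i <- r | P i) f i).
Proof. by move=> H; elim/big_ind: _ => //; [exact: Ok0|exact: OkD]. Qed.
Lemma Ok_le k l u : (l <= k)%N -> Ok k u -> Ok l u.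
Proof.
move=> lk [a ->]; exists (sc (h ^+ (k - l)) a); by rewrite scA -exprD subnKC.
Qed.
Lemma Ok_0 u : Ok 0 u.
Proof. by exists u; rewrite sc1. Qed.

Lemma eqm_refl k u : eqm k u u.
Proof. by rewrite /eqm subrr; exact: Ok0. Qed.
Lemma eqm_eq k u v : u = v -> eqm k u v.
Proof. by move=> ->; exact: eqm_refl. Qed.
Lemma eqm_sym k u v : eqm k u v -> eqm k v u.
Proof. by move/OkN; rewrite opprB. Qed.
Lemma eqm_trans k v u w : eqm k u v -> eqm k v w -> eqm k u w.
Proof. by move=> a /(OkD a); rewrite addrA subrK. Qed.
Lemma eqmD k u v u' v' : eqm k u u' -> eqm k v v' -> eqm k (u + v) (u' + v').
Proof. by move=> a /(OkD a); rewrite addrACA -opprD. Qed.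
Lemma eqmN k u v : eqm k u v -> eqm k (- u) (- v).
Proof. by move=> /OkN; rewrite opprD. Qed.
Lemma eqmB k u v u' v' : eqm k u u' -> eqm k v v' -> eqm k (u - v) (u' - v').
Proof. by move=> a b; apply: eqmD => //; apply: eqmN. Qed.
Lemma eqmZ k (x : D) u v : eqm k u v -> eqm k (x *: u) (x *: v).
Proof. by move=> /(OkZ x); rewrite scalerBr. Qed.
Lemma eqm_sc k l u v : eqm k u v -> eqm (l + k) (sc (h ^+ l) u) (sc (h ^+ l) v).
Proof. by move=> /(Ok_sc l); rewrite scBr. Qed.
Lemma eqm_sc1 k u v : eqm k u v -> eqm k.+1 (sc h u) (sc h v).
Proof. by move=> /Ok_sc1; rewrite scBr. Qed.
Lemma eqm_scc k c u v : eqm k u v -> eqm k (sc c u) (sc c v).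
Proof. exact: eqmZ. Qed.
Lemma eqm_sum k I r (P : pred I) f g : (forall i, P i -> eqm k (f i) (g i)) ->
  eqm k (\sum_(i <- r | P i) f i) (\sum_(i <- r | P i) g i).
Proof. by move=> H; rewrite /eqm -sumrB; apply: Ok_sum. Qed.
Lemma eqm0 k u : eqm k u 0 <-> Ok k u.
Proof. by rewrite /eqm subr0. Qed.
Lemma eqm_Ok k u v : eqm k u v -> Ok k v -> Ok k u.
Proof. by move=> a /(OkD a); rewrite subrK. Qed.

Variables (vac : V) (beta : G -> G -> D) (ann : pred G).
Local Notation lt := (fd_letter D).
Hypothesis comm : forall g k v,
  lt g *: (lt k *: v) = lt k *: (lt g *: v) + sc h (beta g k *: v).
Hypothesis gen : forall v, exists x : D, v = x *: vac.
Hypothesis annv : forall g, ann g -> lt g *: vac = 0.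

Lemma commutator_act g k v :
  (lt g * lt k - lt k * lt g) *: v = sc h (beta g k *: v).
Proof. by rewrite scalerBl -!scalerA comm addrAC subrr add0r. Qed.

(** Commutators of letters act as multiples of h, so that modulo h the action of an
    element depends only on its abelianization. *)
Lemma sym_congr (x y : D) v : sym x = sym y -> eqm 1 (x *: v) (y *: v).
Proof.
move=> E; rewrite /eqm -scalerBl.
have : sym (x - y) = 0 by rewrite symB E subrr.
move: (x - y) v {E} => z + E.
apply: (sym_kernel (P := fun z => forall v, Ok 1 (z *: v))) E => {z} [v|a b ha hb v|c s t g k v].
- by rewrite scale0r; exact: Ok0.
- by rewrite scalerDl; apply: OkD.
rewrite -scE; apply: Ok_scc; move: (\prod_(i <- s) _) (\prod_(i <- t) _) => a b.
have -> : a * lt g * lt k * b - a * lt k * lt g * b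
  = a * (lt g * lt k - lt k * lt g) * b by rewrite !(mulrBl, mulrBr) !mulrA.
rewrite -!scalerA commutator_act; apply/OkZ/Ok_sc1; exact: Ok_0.
Qed.

Lemma commute_mod1 (x y : D) v : eqm 1 (x *: (y *: v)) (y *: (x *: v)).
Proof. by rewrite !scalerA; apply: sym_congr; rewrite !symM mulrC. Qed.

(** Modulo h a nonnegative mode can be moved to the right, up to the vacuum. *)
Lemma ann_Ok g v : ann g -> Ok 1 (lt g *: v).
Proof.
move=> hg; have [x ->] := gen v.
by apply: eqm_Ok (commute_mod1 _ _ _) _; rewrite annv // scaler0; exact: Ok0.
Qed.

Lemma fd_rev0 : fd_rev (0 : D) = 0.
Proof. by apply: (addrI (fd_rev 0)); rewrite -fd_revD !addr0. Qed.
Lemma fd_revB (x y : D) : fd_rev (x - y) = fd_rev x - fd_rev y.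
Proof.
rewrite fd_revD; congr (_ + _); apply: (addrI (fd_rev y)).
by rewrite -fd_revD !subrr fd_rev0.
Qed.
Lemma fd_rev_word s : fd_rev (\prod_(i <- s) lt i) = \prod_(i <- rev s) lt i.
Proof.
elim: s => [|a s IH].
  by rewrite !big_nil fd_rev1.
rewrite big_cons fd_revM IH rev_cons -cats1 big_cat big_seq1 fd_rev_letter.
by [].
Qed.

(** For a single commutator u [g, k] v, the reversed word carries the opposite
    commutator in reversed surroundings; the two terms cancel up to reordering these
    surroundings, which costs a second factor h. *)
Lemma rev_symmetrized_Ok2 (x : D) :
  sym x = 0 -> forall v, Ok 2 ((x + fd_rev x) *: v).
Proof.
move: x; apply: (sym_kernel (P := fun x => forall v, Ok 2 ((x + fd_rev x) *: v))).
- by move=> v; rewrite fd_rev0 addr0 scale0r; exact: Ok0.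
- move=> a b ha hb u; rewrite fd_revD addrACA scalerDl; exact: OkD.
move=> c s t g k u; rewrite fd_revZ -scalerDr -scE; apply: Ok_scc.
rewrite fd_revB !fd_revM !fd_rev_letter !fd_rev_word.
set a := \prod_(i <- s) _; set b := \prod_(i <- t) _.
set a' := \prod_(i <- rev s) _; set b' := \prod_(i <- rev t) _.
have Ea : sym a' = sym a by rewrite !symbol_prod big_rev.
have Eb : sym b' = sym b by rewrite !symbol_prod big_rev.
have -> : a * lt g * lt k * b - a * lt k * lt g * b
    + (b' * (lt k * (lt g * a')) - b' * (lt g * (lt k * a')))
  = a * ((lt g * lt k - lt k * lt g) * b) - b' * ((lt g * lt k - lt k * lt g) * a').
  by rewrite !(mulrBl, mulrBr) !mulrA opprB.
rewrite scalerBl -!scalerA !commutator_act !scZ -scBr; apply: Ok_sc1.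
by rewrite !scalerA; apply: sym_congr; rewrite !symM Ea Eb; ring.
Qed.
End Semiclassical.

(** * Modes of products of generating fields *)

Section Pull.
Variables (A : Type) (V : zmodType).

(** Sums over the ways to pull one letter, or an ordered pair of letters, out of a
    word; they organize the terms of Wick's formula. *)
Fixpoint pull1 (G : A -> seq A -> V) (s : seq A) : V :=
  if s is a :: s' then G a s' + pull1 (fun b r => G b (a :: r)) s' else 0.

Fixpoint pull2 (G : A -> A -> seq A -> V) (s : seq A) : V :=
  if s is a :: s' then
    pull1 (G a) s' + pull2 (fun b c r => G b c (a :: r)) s'
  else 0.

Lemma pull1_cons G a s :
  pull1 G (a :: s) = G a s + pull1 (fun b r => G b (a :: r)) s.
Proof. by []. Qed.
Lemma pull2_cons G a s :
  pull2 G (a :: s) = pull1 (G a) s + pull2 (fun b c r => G b c (a :: r)) s.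
Proof. by []. Qed.

Lemma eq_pull1 G H s : (forall a r, G a r = H a r) -> pull1 G s = pull1 H s.
Proof.
elim: s G H => //= a s IH G H E; rewrite E; congr (_ + _); apply: IH => b r.
exact: E.
Qed.
Lemma eq_pull2 G H s : (forall a b r, G a b r = H a b r) -> pull2 G s = pull2 H s.
Proof.
elim: s G H => //= a s IH G H E; congr (_ + _); last by apply: IH => b c r; exact: E.
by apply: eq_pull1 => b r; exact: E.
Qed.
Lemma pull1D G H s : pull1 (fun a r => G a r + H a r) s = pull1 G s + pull1 H s.
Proof.
by elim: s G H => [|a s IH] G H /=; rewrite ?addr0 // IH addrACA.
Qed.
Lemma pull2D G H s : pull2 (fun a b r => G a b r + H a b r) s = pull2 G s + pull2 H s.
Proof.
by elim: s G H => [|a s IH] G H /=; rewrite ?addr0 // IH pull1D addrACA.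
Qed.
End Pull.

Lemma pull1_morph (A : Type) (V W : zmodType) (f : V -> W) :
  f 0 = 0 -> {morph f : x y / x + y} -> forall G (s : seq A),
  f (pull1 G s) = pull1 (fun a r => f (G a r)) s.
Proof. by move=> f0 fD G s; elim: s G => //= a s IH G; rewrite fD IH. Qed.
Lemma pull2_morph (A : Type) (V W : zmodType) (f : V -> W) :
  f 0 = 0 -> {morph f : x y / x + y} -> forall G (s : seq A),
  f (pull2 G s) = pull2 (fun a b r => f (G a b r)) s.
Proof.
move=> f0 fD G s; elim: s G => //= a s IH G.
by rewrite fD IH (pull1_morph f0 fD).
Qed.
Lemma pull1Ml (A : Type) (B : pzRingType) (x : B) G (s : seq A) :
  pull1 (fun a r => x * G a r) s = x * pull1 G s.
Proof. by rewrite (pull1_morph (f := *%R x)) ?mulr0 //; exact: mulrDr. Qed.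
Lemma pull1Mr (A : Type) (B : pzRingType) (x : B) G (s : seq A) :
  pull1 (fun a r => G a r * x) s = pull1 G s * x.
Proof.
rewrite [RHS](pull1_morph (f := fun y => y * x)) ?mul0r // => a b.
exact: mulrDl.
Qed.
Lemma pull2Ml (A : Type) (B : pzRingType) (x : B) G (s : seq A) :
  pull2 (fun a b r => x * G a b r) s = x * pull2 G s.
Proof. by rewrite (pull2_morph (f := *%R x)) ?mulr0 //; exact: mulrDr. Qed.

Section StateField.
Variables (K : comNzRingType) (P : choiceType) (D : free_datum K (mode P)).
Variables (V : lmodType D) (h : K) (vac : V) (beta : mode P -> mode P -> D).
Local Notation lt := (fd_letter D).
Local Notation Ok := (@Ok K (mode P) D V h).
Local Notation eqm := (@eqm K (mode P) D V h).
Local Notation sc := (@sc K (mode P) D V).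

Hypothesis comm : forall g k v,
  lt g *: (lt k *: v) = lt k *: (lt g *: v) + sc h (beta g k *: v).
Hypothesis gen : forall v, exists x : D, v = x *: vac.
Hypothesis annv : forall g, @annihilator P g -> lt g *: vac = 0.
Hypothesis divK : forall n, exists c : K, n.+1%:R * c = 1.

Inductive Ispan (r : int) : D -> Prop :=
| Ispan0 : Ispan r 0
| IspanD x y : Ispan r x -> Ispan r y -> Ispan r (x + y)
| IspanZ c u a p : Ispan r (c *: lt (Imode u a p r)).
Inductive Kspan : D -> Prop :=
| Kspan0 : Kspan 0
| KspanD x y : Kspan x -> Kspan y -> Kspan (x + y)
| KspanZ c u p : Kspan (c *: lt (Kmode u p)).

Hypothesis betaII : forall u a p r v b q s, exists x y,
  [/\ Ispan (r + s) x, Kspan y &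
  beta (Imode u a p r) (Imode v b q s) =
    x + (h * s%:~R * (r + s == 0)%:R) *: y].
Hypothesis betaIK : forall g v q, beta g (Kmode v q) = 0.

(** The vectors built without modes I_r, r < -1.  On them a nonnegative mode gains
    more powers of h than on a general vector. *)
Inductive U : V -> Prop :=
| U_vac : U vac
| U_D v w : U v -> U w -> U (v + w)
| U_sc c v : U v -> U (sc c v)
| U_I u a p v : U v -> U (lt (Imode u a p (-1)) *: v)
| U_K u p v : U v -> U (lt (Kmode u p) *: v).

Definition UO (k : nat) (v : V) := exists2 w, U w & v = sc (h ^+ k) w.

Lemma U_0 : U 0.
Proof.
have -> : 0 = sc 0 vac by rewrite /sc !scale0r.
by apply: U_sc; exact: U_vac.
Qed.
Lemma UO_0 k : UO k 0.
Proof. by exists 0; [exact: U_0|rewrite sc0r]. Qed.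
Lemma UO_D k v w : UO k v -> UO k w -> UO k (v + w).
Proof. by move=> [a ha ->] [b hb ->]; exists (a + b); rewrite ?scDr //; exact: U_D. Qed.
Lemma UO_sc k c v : UO k v -> UO k (sc c v).
Proof.
by move=> [a ha ->]; exists (sc c a); [exact: U_sc|rewrite !scA mulrC].
Qed.
Lemma UO_h k v : UO k v -> UO k.+1 (sc h v).
Proof. by move=> [a ha ->]; exists a => //; rewrite scA exprS. Qed.
Lemma UO_I k u a p v : UO k v -> UO k (lt (Imode u a p (-1)) *: v).
Proof. by move=> [w hw ->]; exists (lt (Imode u a p (-1)) *: w); [exact: U_I|rewrite scZ]. Qed.
Lemma UO_K k u p v : UO k v -> UO k (lt (Kmode u p) *: v).
Proof. by move=> [w hw ->]; exists (lt (Kmode u p) *: w); [exact: U_K|rewrite scZ]. Qed.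
Lemma UO_Ok k v : UO k v -> Ok k v.
Proof. by move=> [w _ ->]; exists w. Qed.
Lemma U_UO v : U v -> UO 0 v.
Proof. by exists v; rewrite // sc1. Qed.

Lemma Ispan_UO k r x v : (forall u a p, UO k (lt (Imode u a p r) *: v)) ->
  Ispan r x -> UO k (x *: v).
Proof.
move=> H; elim=> {x} [|x y _ hx _ hy|c u a p].
- by rewrite scale0r; exact: UO_0.
- by rewrite scalerDl; exact: UO_D.
- by rewrite -scE; exact: UO_sc.
Qed.
Lemma Kspan_UO k y v : UO k v -> Kspan y -> UO k (y *: v).
Proof.
move=> H; elim=> {y} [|x y _ hx _ hy|c u p].
- by rewrite scale0r; exact: UO_0.
- by rewrite scalerDl; exact: UO_D.
- by rewrite -scE; apply/UO_sc/UO_K.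
Qed.

(** Each commutation of I_r with some I_{-1} yields a factor h and lowers r by one;
    for r = 1 it also yields a central term, with a factor h ^ 2.  So r + 1 factors h
    are needed before a negative mode is reached. *)
Lemma U_ann v : U v -> forall (r : nat) u a p, UO r.+1 (lt (Imode u a p r%:Z) *: v).
Proof.
elim=> {v} [|v w _ hv _ hw|c v _ hv|w b q v Uv hv|w q v Uv hv] r u a p.
- by rewrite annv //; exact: UO_0.
- by rewrite scalerDr; exact: UO_D.
- by rewrite scZ; exact: UO_sc.
- rewrite comm; apply: UO_D; first exact: UO_I.
  have [x [y [hx hy ->]]] := betaII u a p r%:Z w b q (-1).
  rewrite scalerDl scDr; apply: UO_D.
    case: r hx {hy} => [|r] hx; apply: UO_h.
      by apply: Ispan_UO hx => ? ? ?; apply/UO_I/U_UO.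
    have E : r.+1%:Z + -1 = r%:Z :> int by rewrite -addn1 PoszD addrK.
    by rewrite E in hx; apply: Ispan_UO hx.
  rewrite -scE !scA; have [E|_] := eqVneq (r%:Z + -1) 0; last first.
    rewrite mulr0 mulr0; have -> : sc 0 (y *: v) = 0 by rewrite /sc !scale0r.
    exact: UO_0.
  have -> : r = 1%N by move/eqP: E; rewrite addr_eq0 opprK => /eqP[].
  rewrite mulrA mulrA -expr2 mulr1 mulrC -scA; apply: UO_sc.
  have [z hz E'] := Kspan_UO (U_UO Uv) hy.
  by exists z; rewrite // E' sc1.
- rewrite comm betaIK scale0r sc0r addr0; exact: UO_K.
Qed.

Lemma U_annOk v (r : nat) u a p : U v -> Ok r.+1 (lt (Imode u a p r%:Z) *: v).
Proof. by move=> Uv; apply/UO_Ok/U_ann. Qed.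

Variables (Tv : V -> V) (Y : V -> int -> V -> V).
Local Notation tcoef := (@translate_coef K P).
Definition trans : D -> D :=
  fd_der (\0 : {additive K -> K}) (fun g => tcoef g *: lt (translate_mode g)).
Hypothesis TvE : forall x : D, Tv (x *: vac) = trans x *: vac.
Hypothesis Ylin_state : forall c X X' r v, Y (sc c X + X') r v = sc c (Y X r v) + Y X' r v.
Hypothesis Ylin : forall X r c v v', Y X r (sc c v + v') = sc c (Y X r v) + Y X r v'.
Hypothesis Yfield : forall X v, exists N : int, forall r, N <= r -> Y X r v = 0.
Hypothesis Yvac : forall r v, Y vac r v = if r == -1 then v else 0.
Hypothesis Ygen : forall u a p r v,
  Y (lt (Imode u a p (-1)) *: vac) r v = lt (Imode u a p r) *: v.
Hypothesis Ycen : forall u p X r v, Y (lt (Kmode u p) *: X) r v = lt (Kmode u p) *: Y X r v.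
Hypothesis Ytrans : forall X r v, Y (Tv X) r v = - ((r%:~R : D) *: Y X (r - 1) v).
Hypothesis Yno : forall X X' r v (N : nat),
    (forall j : nat, (N <= j)%N -> Y X j%:Z v = 0 /\ Y X' (r + j%:Z) v = 0) ->
    Y (Y X (-1) X') r v =
      \sum_(j < N) (Y X (- 1 - j%:Z) (Y X' (r + j%:Z) v)
                    + Y X' (r - 1 - j%:Z) (Y X j%:Z v)).

Lemma Y0l r v : Y 0 r v = 0.
Proof.
have := Ylin_state 1 0 0 r v; rewrite !sc1 addr0 => E.
by apply: (addrI (Y 0 r v)); rewrite addr0 -E.
Qed.
Lemma YDl X X' r v : Y (X + X') r v = Y X r v + Y X' r v.
Proof. by have := Ylin_state 1 X X' r v; rewrite !sc1. Qed.
Lemma Yscl c X r v : Y (sc c X) r v = sc c (Y X r v).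
Proof. by have := Ylin_state c X 0 r v; rewrite Y0l !addr0. Qed.
Lemma Y0r X r : Y X r 0 = 0.
Proof.
have := Ylin X r 1 0 0; rewrite !sc1 addr0 => E.
by apply: (addrI (Y X r 0)); rewrite addr0 -E.
Qed.
Lemma YDr X r v v' : Y X r (v + v') = Y X r v + Y X r v'.
Proof. by have := Ylin X r 1 v v'; rewrite !sc1. Qed.
Lemma Yscr X r c v : Y X r (sc c v) = sc c (Y X r v).
Proof. by have := Ylin X r c v 0; rewrite Y0r !addr0. Qed.
Lemma YNr X r v : Y X r (- v) = - Y X r v.
Proof. by apply: (addrI (Y X r v)); rewrite -YDr !subrr Y0r. Qed.
Lemma YNl X r v : Y (- X) r v = - Y X r v.
Proof. by apply: (addrI (Y X r v)); rewrite -YDl !subrr Y0l. Qed.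
Lemma YOkr k X r v : Ok k v -> Ok k (Y X r v).
Proof. by move=> [u ->]; exists (Y X r u); rewrite Yscr. Qed.
Lemma YOkl k X r v : Ok k X -> Ok k (Y X r v).
Proof. by move=> [u ->]; exists (Y u r v); rewrite Yscl. Qed.

(** The sum in the normally ordered product may be cut where its terms vanish
    modulo h ^ k; the true bound comes from the field property. *)
Lemma Y_normal_order k X X' r v n :
  (forall j : nat, (n <= j)%N ->
    Ok k (Y X (- 1 - j%:Z) (Y X' (r + j%:Z) v) + Y X' (r - 1 - j%:Z) (Y X j%:Z v))) ->
  eqm k (Y (Y X (-1) X') r v)
   (\sum_(j < n) (Y X (- 1 - j%:Z) (Y X' (r + j%:Z) v)
                    + Y X' (r - 1 - j%:Z) (Y X j%:Z v))).
Proof.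
move=> H; have [N1 h1] := Yfield X v; have [N2 h2] := Yfield X' v.
pose N := maxn n (maxn `|N1| `|N2 - r|).
have nN : (n <= N)%N by rewrite leq_maxl.
rewrite (@Yno X X' r v N); last first.
  move=> j; rewrite !geq_max => /and3P[_ j1 j2]; split.
    by apply: h1; apply: le_trans (lez_abs N1) _; rewrite lez_nat.
  apply: h2; rewrite -lerBlDl; apply: le_trans (lez_abs _) _.
  by rewrite lez_nat.
pose f j := Y X (- 1 - j%:Z) (Y X' (r + j%:Z) v) + Y X' (r - 1 - j%:Z) (Y X j%:Z v).
rewrite /eqm -/(f _) -(big_mkord xpredT f) -(big_mkord xpredT f) (@big_cat_nat _ _ _ n) //=.
rewrite addrAC subrr add0r big_seq; apply: Ok_sum => j.
by rewrite mem_index_iota => /andP[nj _]; apply: H.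
Qed.

Lemma intZ (r : int) (v : V) : (r%:~R : D) *: v = sc r%:~R v.
Proof. by rewrite /sc [(r%:~R)%:A]scaler_int. Qed.

(** The state of I_{-1-e} is the divided power T^e / e! applied to that of I_{-1}, so
    its field is a divided derivative of a generating field; the coefficients vanish on
    the modes 0, ..., e - 1. *)
Lemma Y_translates (e : nat) u a p : exists2 c : int -> K,
  forall r v, Y (lt (Imode u a p (- 1 - e%:Z)) *: vac) r v
              = sc (c r) (lt (Imode u a p (r - e%:Z)) *: v)
  & (forall n : nat, c (- 1 - n%:Z) = 'C(n + e, e)%:R)
    /\ forall r : nat, (r < e)%N -> c r%:Z = 0.
Proof.
elim: e => [|e [c hY [hn hp]]].
  by exists (fun=> 1) => [r v|]; [rewrite !subr0 sc1 Ygen|split=> // n; rewrite bin0].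
have [d hd] := divK e.
exists (fun r => - d * r%:~R * c (r - 1)).
  move=> r v; have := Ytrans (lt (Imode u a p (- 1 - e%:Z)) *: vac) r v.
  rewrite TvE /trans fd_der_letter; last exact: null_derM.
  rewrite /= -scE Yscl hY.
  have -> : - (-1 - e%:Z)%:~R = e.+1%:R :> K.
    by rewrite -mulrNz opprB opprK addrC -intS.
  have -> : -1 - e%:Z - 1 = - 1 - e.+1%:Z :> int by rewrite intS; ring.
  have -> : r - 1 - e%:Z = r - e.+1%:Z by rewrite intS; ring.
  rewrite intZ => E; rewrite -[LHS]sc1 -[X in sc X _ = _]hd [e.+1%:R * d]mulrC -scA E scNr !scA.
  by rewrite -scNl; congr (sc _ _); ring.
split=> [n|r re]; last first.
  case: r re => [|r] re; first by rewrite mulr0 mul0r.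
  have -> : r.+1%:Z - 1 = r%:Z by rewrite -addn1 PoszD addrK.
  by rewrite hp ?mulr0.
have -> : -1 - n%:Z - 1 = - 1 - n.+1%:Z :> int by rewrite intS; ring.
rewrite hn.
have -> : - d * (-1 - n%:Z)%:~R = d * n.+1%:R :> K.
  by rewrite mulNr -mulrN -mulrNz opprB opprK addrC -intS.
have H : (e.+1 * 'C(n + e.+1, e.+1) = n.+1 * 'C(n.+1 + e, e))%N.
  by rewrite mul_bin_left addnS -addSn addnK.
by rewrite -mulrA -natrM -H natrM mulrA [d * _]mulrC hd mul1r.
Qed.

Lemma Y_translate_m1 e u a p v :
  Y (lt (Imode u a p (- 1 - e%:Z)) *: vac) (-1) v = lt (Imode u a p (-1 - e%:Z)) *: v.
Proof.
have [c hc [hn _]] := Y_translates e u a p.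
by have := hn 0%N; rewrite subr0 add0n binn hc => ->; rewrite sc1.
Qed.

(** In a nonnegative mode of a normally ordered product each term contains a
    nonnegative mode of one of the factors. *)
Lemma Y_Ok1 X (r : nat) v : Ok 1 (Y X r%:Z v).
Proof.
have [x ->] := gen X; elim/fd_ind: x r v => [|x y hx hy|c s] r v.
- by rewrite scale0r Y0l; exact: Ok0.
- by rewrite scalerDl YDl; exact: OkD.
rewrite -scE Yscl; apply: Ok_scc.
elim: s r v => [|g s IH] r v; first by rewrite big_nil scale1r Yvac; exact: Ok0.
rewrite big_cons -scalerA; case: g => [u a p [e|e]|u p]; last by rewrite Ycen; exact: OkZ.
  by apply: YOkl; apply: (ann_Ok comm gen annv).
have -> : Negz e = -1 - e%:Z by rewrite NegzE intS opprD.
rewrite -Y_translate_m1.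
apply: (@eqm_Ok _ _ _ _ h 1 _ _ (@Y_normal_order 1 _ _ _ _ 0 _)); last first.
  by rewrite big_ord0; exact: Ok0.
move=> j _; apply: OkD; first by apply: YOkr; exact: IH.
apply: YOkr; have [c' hc [_ hp]] := Y_translates e u a p; rewrite hc.
have [je|ej] := ltnP j e.
  by rewrite hp // /sc !scale0r; exact: Ok0.
by apply: Ok_scc; apply: (ann_Ok comm gen annv) => /=; rewrite subr_ge0 lez_nat.
Qed.

Local Notation field := (P * 'I_3 * nat)%type.
Implicit Types (f g : field) (s : seq field).

(** A triple (u, a, p) names the generating field I^{a[p]}(u). *)
Definition field_mode f (r : int) : D := lt (Imode f.1.1 f.1.2 f.2 r).
Definition field_word s : D := \prod_(f <- s) field_mode f (-1).
Local Notation st s := (field_word s *: vac).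

(** The contraction terms: one letter is replaced by its mode r, or two letters by
    their zero modes, and in [dann1] and [dann2] the remaining word is translated. *)
Definition ann1 s (r : int) : D := pull1 (fun f s' => field_word s' * field_mode f r) s.
Definition dann1 s (r : int) : D := pull1 (fun f s' => trans (field_word s') * field_mode f r) s.
Definition ann2 s : D := pull2 (fun f g s' => field_word s' * field_mode g 0 * field_mode f 0) s.
Definition dann2 s : D := pull2 (fun f g s' => trans (field_word s') * field_mode g 0 * field_mode f 0) s.

Lemma field_word_nil : field_word [::] = 1. Proof. exact: big_nil. Qed.
Lemma field_word_cons f s : field_word (f :: s) = field_mode f (-1) * field_word s. Proof. exact: big_cons. Qed.

Lemma transM x y : trans (x * y) = trans x * y + x * trans y.
Proof. by rewrite /trans fd_derM //; exact: null_derM. Qed.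
Lemma trans_field_mode f (r : int) : trans (field_mode f r) = (- r%:~R) *: field_mode f (r - 1).
Proof. by rewrite /trans /field_mode fd_der_letter //; exact: null_derM. Qed.
Lemma trans_field_word_nil : trans (field_word [::]) = 0.
Proof. by rewrite field_word_nil /trans fd_der1 //; exact: null_derM. Qed.
Lemma trans_field_word_cons f s :
  trans (field_word (f :: s)) = field_mode f (-2) * field_word s + field_mode f (-1) * trans (field_word s).
Proof. by rewrite field_word_cons transM trans_field_mode opprK scale1r. Qed.

Lemma ann1_cons f s r : ann1 (f :: s) r = field_word s * field_mode f r + field_mode f (-1) * ann1 s r.
Proof.
rewrite /ann1 /= -pull1Ml; congr (_ + _); apply: eq_pull1 => g s'.
by rewrite field_word_cons mulrA.
Qed.
Lemma dann1_cons f s r : dann1 (f :: s) r =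
  trans (field_word s) * field_mode f r + field_mode f (-1) * dann1 s r + field_mode f (-2) * ann1 s r.
Proof.
rewrite /dann1 /ann1 /= -!pull1Ml -addrA -pull1D; congr (_ + _).
by apply: eq_pull1 => g s'; rewrite trans_field_word_cons mulrDl !mulrA addrC.
Qed.
Lemma ann2_cons f s : ann2 (f :: s) = ann1 s 0 * field_mode f 0 + field_mode f (-1) * ann2 s.
Proof.
rewrite /ann2 /ann1 /= -pull1Mr -pull2Ml; congr (_ + _).
by apply: eq_pull2 => g k s'; rewrite field_word_cons !mulrA.
Qed.
Lemma dann2_cons f s : dann2 (f :: s) =
  dann1 s 0 * field_mode f 0 + field_mode f (-1) * dann2 s + field_mode f (-2) * ann2 s.
Proof.
rewrite /dann2 /ann2 /dann1 /= -pull1Mr -!pull2Ml -addrA -pull2D; congr (_ + _).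
by apply: eq_pull2 => g k s'; rewrite trans_field_word_cons !mulrDl !mulrA addrC.
Qed.

Lemma field_mode_Ok1 f (r : nat) v : Ok 1 (field_mode f r%:Z *: v).
Proof. exact: (ann_Ok comm gen annv). Qed.

(** Only the first two summands of the normally ordered product matter below. *)
Lemma Y_step k f s (r : int) v :
  (forall j : nat, (2 <= j)%N -> Ok k (field_mode f (- 1 - j%:Z) *: Y (st s) (r + j%:Z) v
     + Y (st s) (r - 1 - j%:Z) (field_mode f j%:Z *: v))) ->
  eqm k (Y (st (f :: s)) r v)
    (field_mode f (-1) *: Y (st s) r v + Y (st s) (r - 1) (field_mode f 0 *: v)
     + (field_mode f (-2) *: Y (st s) (r + 1) v + Y (st s) (r - 2) (field_mode f 1 *: v))).
Proof.
move=> H; rewrite field_word_cons -scalerA -(Ygen _ _ _ (-1)).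
have := @Y_normal_order k (lt (Imode f.1.1 f.1.2 f.2 (-1)) *: vac) (st s) r v 2.
rewrite !big_ord_recl big_ord0 addr0 /= !subr0 addr0 /bump /= !addn0.
rewrite !Ygen -addrA => E.
have -> : r - 2 = r - 1 - 1 by rewrite -addrA.
by rewrite -addrA; apply: E => j hj; rewrite !Ygen; apply: H.
Qed.

Lemma Y_m1_1 s v : eqm 1 (Y (st s) (-1) v) (field_word s *: v).
Proof.
elim: s v => [|f s IH] v.
  by rewrite field_word_nil !scale1r Yvac eqxx; exact: eqm_refl.
apply: eqm_trans (Y_step _) _.
  move=> j hj; apply: OkD; last by apply/YOkr/field_mode_Ok1.
  by apply: OkZ; case: j hj => // j _; rewrite intS addrA addNr add0r; exact: Y_Ok1.
rewrite field_word_cons -scalerA -[X in eqm _ _ X]addr0; apply: eqmD.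
  rewrite -[X in eqm _ _ X]addr0; apply: eqmD; first exact/eqmZ/IH.
  by apply/eqm0/YOkr/field_mode_Ok1.
apply/eqm0/OkD; first exact/OkZ/(Y_Ok1 _ 0).
by apply/YOkr/field_mode_Ok1.
Qed.

Lemma Y_m2_1 s v : eqm 1 (Y (st s) (-2) v) (trans (field_word s) *: v).
Proof.
elim: s v => [|f s IH] v.
  by rewrite trans_field_word_nil field_word_nil scale1r scale0r Yvac; exact: eqm_refl.
apply: eqm_trans (Y_step _) _.
  move=> j hj; apply: OkD; last by apply/YOkr/field_mode_Ok1.
  apply: OkZ; case: j hj => // -[//|j] _.
  have -> : -2 + j.+2%:Z = j%:Z :> int by rewrite !intS; ring.
  exact: Y_Ok1.
rewrite trans_field_word_cons scalerDl -!scalerA addrC; apply: eqmD.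
  rewrite -[X in eqm _ _ X]addr0; apply: eqmD; first exact/eqmZ/Y_m1_1.
  by apply/eqm0/YOkr/field_mode_Ok1.
rewrite -[X in eqm _ _ X]addr0; apply: eqmD; first exact/eqmZ/IH.
by apply/eqm0/YOkr/field_mode_Ok1.
Qed.

Section Order2.
Variable v : V.
Hypothesis v2 : forall f (j : nat), (2 <= j)%N -> Ok 2 (field_mode f j%:Z *: v).

Lemma Ok2_h X r w : Ok 1 w -> Ok 2 (Y X r%:Z w).
Proof. by move=> [u ->]; rewrite expr1 Yscr; apply/Ok_sc1/Y_Ok1. Qed.

Lemma Y_ge2_2 s (r : nat) : (2 <= r)%N -> Ok 2 (Y (st s) r%:Z v).
Proof.
elim: s r => [|f s IH] r hr.
  by rewrite field_word_nil scale1r Yvac; case: r hr => //= r _; exact: Ok0.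
have H j : Ok 2 (Y (st s) (r%:Z - 1 - j%:Z) (field_mode f j%:Z *: v)).
  have [jr|rj] := ltnP j 2; last by apply/YOkr/v2.
  have -> : r%:Z - 1 - j%:Z = (r - 1 - j)%N%:Z.
    rewrite -!subzn // ?leq_sub2l //; first by apply: leq_trans hr.
    by case: r hr {IH} => [|[|r]] // _; case: j jr => [|[|j]].
  by apply/Ok2_h/field_mode_Ok1.
apply: eqm_Ok (Y_step _) _ => [j hj|].
  by apply: OkD; [rewrite -PoszD; apply/OkZ/IH/(leq_trans hr)/leq_addr|exact: H].
apply: OkD; apply: OkD; [exact/OkZ/IH| |by rewrite -PoszD; apply/OkZ/IH/(leq_trans hr)/leq_addr|].
  by have := H 0%N; rewrite subr0.
by have := H 1%N; rewrite -addrA -opprD.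
Qed.

Lemma Y_1_2 s : eqm 2 (Y (st s) 1 v) (ann1 s 1 *: v).
Proof.
elim: s => [|f s IH].
  by rewrite field_word_nil !scale1r scale0r Yvac; exact: eqm_refl.
apply: eqm_trans (Y_step _) _ => [j hj|].
  apply: OkD; last exact/YOkr/v2.
  by rewrite -PoszD; apply/OkZ/Y_ge2_2/(leq_trans hj)/leq_addl.
rewrite ann1_cons scalerDl -!scalerA addrC; apply: eqmD.
  rewrite -[X in eqm _ _ X]add0r; apply: eqmD; first by apply/eqm0/OkZ; exact: (@Y_ge2_2 s 2).
  have [w E] := field_mode_Ok1 f 1 v; rewrite E expr1 scZ Yscr; apply: eqm_sc1.
  exact: Y_m1_1.
rewrite -[X in eqm _ _ X]addr0; apply: eqmD; first exact: eqmZ.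
by apply/eqm0; apply: (@Ok2_h _ 0); exact: (field_mode_Ok1 f 0).
Qed.

(** Modulo h ^ 2 only single contractions survive: a second contraction, or a mode
    beyond 1, costs another factor h. *)
Lemma Y_0_2 s : eqm 2 (Y (st s) 0 v) ((ann1 s 0 + dann1 s 1) *: v).
Proof.
elim: s => [|f s IH].
  by rewrite field_word_nil !scale1r /ann1 /dann1 /= addr0 scale0r Yvac; exact: eqm_refl.
apply: eqm_trans (Y_step _) _ => [j hj|].
  by apply: OkD; [rewrite add0r; exact/OkZ/Y_ge2_2|exact/YOkr/v2].
rewrite ann1_cons dann1_cons; set w := (X in eqm _ _ X).
have -> : w = field_mode f (-1) *: ((ann1 s 0 + dann1 s 1) *: v) + field_word s *: (field_mode f 0 *: v)
     + (field_mode f (-2) *: (ann1 s 1 *: v) + trans (field_word s) *: (field_mode f 1 *: v)).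
  rewrite /w !scalerA -!scalerDl mulrDr; congr (_ *: _).
  by rewrite [LHS](AC (2*3) ((2*4)*1*(5*3))).
apply: eqmD; apply: eqmD.
- exact: eqmZ.
- have [u E] := field_mode_Ok1 f 0 v; rewrite E expr1 scZ Yscr; apply: eqm_sc1.
  exact: Y_m1_1.
- exact/eqmZ/Y_1_2.
- have [u E] := field_mode_Ok1 f 1 v; rewrite E expr1 scZ Yscr; apply: eqm_sc1.
  exact: Y_m2_1.
Qed.
End Order2.

(** The analogue of [U_ann] for all words. *)
Lemma YU_ge s (r : nat) v : U v -> Ok r.+1 (Y (st s) r%:Z v).
Proof.
elim: s r v => [|f s IH] r v Uv.
  by rewrite field_word_nil scale1r Yvac; exact: Ok0.
have H j : Ok r.+1 (Y (st s) (r%:Z - 1 - j%:Z) (field_mode f j%:Z *: v)).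
  have [jr|rj] := ltnP j r; last first.
    by apply/YOkr/(Ok_le (k := j.+1)) => //; exact: U_annOk.
  have -> : r%:Z - 1 - j%:Z = (r - j.+1)%N%:Z.
    by rewrite -subzn // intS; ring.
  have [w Uw E] := U_ann Uv j f.1.1 f.1.2 f.2.
  rewrite /field_mode E Yscr (_ : r.+1 = j.+1 + (r - j.+1).+1)%N; last by rewrite addnS subnKC.
  exact/Ok_sc/IH.
apply: eqm_Ok (Y_step _) _ => [j hj|].
  apply: OkD; last exact: H.
  by rewrite -PoszD; apply/OkZ/(Ok_le (k := (r + j).+1)); [rewrite ltnS leq_addr|exact: IH].
apply: OkD; apply: OkD; [exact/OkZ/IH| | |].
- by have := H 0%N; rewrite subr0.
- by rewrite -PoszD; apply/OkZ/(Ok_le (k := (r + 1).+1)); [rewrite ltnS leq_addr|exact: IH].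
- by have := H 1%N; rewrite -addrA -opprD.
Qed.

Lemma U_Ok2 v : U v -> forall f (j : nat), (2 <= j)%N -> Ok 2 (field_mode f j%:Z *: v).
Proof.
move=> Uv f j hj; apply: (Ok_le (k := j.+1)); first exact: leqW.
exact: U_annOk.
Qed.

Lemma YU_0_2 s v : U v -> eqm 2 (Y (st s) 0 v) (ann1 s 0 *: v).
Proof.
move=> Uv; apply: eqm_trans (Y_0_2 (U_Ok2 Uv) s) _.
rewrite scalerDl -[X in eqm _ _ X]addr0; apply: eqmD; first exact: eqm_refl.
apply/eqm0; elim: s => [|f s IH]; first by rewrite /dann1 /= scale0r; exact: Ok0.
have hf g : Ok 2 (field_mode g 1 *: v) by apply: (U_annOk 1).
rewrite dann1_cons !scalerDl -!scalerA; apply: OkD; first apply: OkD.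
- exact: OkZ.
- exact: OkZ.
- apply: OkZ; elim: s {IH} => [|g s IH]; first by rewrite /ann1 /= scale0r; exact: Ok0.
  by rewrite ann1_cons scalerDl -!scalerA; apply: OkD; exact: OkZ.
Qed.

Lemma YU_m1_2 s v : U v -> eqm 2 (Y (st s) (-1) v) ((field_word s + dann1 s 0) *: v).
Proof.
move=> Uv; elim: s => [|f s IH].
  by rewrite field_word_nil /dann1 /= addr0 !scale1r Yvac eqxx; exact: eqm_refl.
apply: eqm_trans (Y_step _) _ => [j hj|].
  apply: OkD; last by apply/YOkr/U_Ok2.
  case: j hj => // -[//|j] _.
  have -> : -1 + j.+2%:Z = j.+1%:Z :> int by rewrite !intS; ring.
  by apply/OkZ/(Ok_le (k := j.+2)) => //; exact: YU_ge.
set w := (X in eqm _ _ X).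
have -> : w = field_mode f (-1) *: ((field_word s + dann1 s 0) *: v) + trans (field_word s) *: (field_mode f 0 *: v)
     + (field_mode f (-2) *: (ann1 s 0 *: v) + 0).
  rewrite /w addr0 field_word_cons dann1_cons !scalerA -!scalerDl mulrDr; congr (_ *: _).
  by rewrite [LHS](AC (1*3) ((1*3)*2*4)).
apply: eqmD; apply: eqmD.
- exact: eqmZ.
- have [u E] := field_mode_Ok1 f 0 v; rewrite E expr1 scZ Yscr; apply: eqm_sc1.
  exact: Y_m2_1.
- exact/eqmZ/YU_0_2.
- by apply/eqm0/YOkr; apply: (U_annOk 1).
Qed.

Lemma YU_1_3 s v : U v -> eqm 3 (Y (st s) 1 v) ((ann1 s 1 + ann2 s) *: v).
Proof.
move=> Uv; elim: s => [|f s IH].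
  by rewrite field_word_nil /ann1 /ann2 /= addr0 scale0r !scale1r Yvac; exact: eqm_refl.
apply: eqm_trans (Y_step _) _ => [j hj|].
  apply: OkD; last first.
    by apply/YOkr/(Ok_le (k := j.+1)) => //; exact: U_annOk.
  rewrite -PoszD; apply/OkZ/(Ok_le (k := (1 + j).+1)); last exact: YU_ge.
  by rewrite add1n ltnS ltnW.
set w := (X in eqm _ _ X).
have -> : w = field_mode f (-1) *: ((ann1 s 1 + ann2 s) *: v) + ann1 s 0 *: (field_mode f 0 *: v)
     + (0 + field_word s *: (field_mode f 1 *: v)).
  rewrite /w add0r ann1_cons ann2_cons !scalerA -!scalerDl mulrDr; congr (_ *: _).
  by rewrite [LHS](AC (2*2) ((2*4)*3*1)).
apply: eqmD; apply: eqmD.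
- exact: eqmZ.
- have [u Uu E] := U_ann Uv 0 f.1.1 f.1.2 f.2; rewrite /field_mode E expr1 scZ Yscr; apply: eqm_sc1.
  exact: YU_0_2.
- by apply/eqm0/OkZ; exact: (@YU_ge _ 2).
- have [u E] : Ok 2 (field_mode f 1 *: v) by apply: (U_annOk 1).
  by rewrite E scZ Yscr; apply: (eqm_sc 2); exact: Y_m1_1.
Qed.

(** By [U_ann] a mode r costs h ^ (r + 1), so modulo h ^ 3 there remain the
    contractions of one letter with mode 0 or 1 and of two letters with modes 0. *)
Lemma YU_0_3 s v : U v ->
  eqm 3 (Y (st s) 0 v) ((ann1 s 0 + dann1 s 1 + dann2 s) *: v).
Proof.
move=> Uv; elim: s => [|f s IH].
  rewrite field_word_nil /ann1 /dann1 /dann2 /= !addr0 scale0r !scale1r Yvac.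
  exact: eqm_refl.
apply: eqm_trans (Y_step _) _ => [j hj|].
  apply: OkD; last first.
    by apply/YOkr/(Ok_le (k := j.+1)) => //; exact: U_annOk.
  by rewrite -PoszD; apply/OkZ/(Ok_le (k := (0 + j).+1)); [|exact: YU_ge].
set w := (X in eqm _ _ X).
have -> : w = field_mode f (-1) *: ((ann1 s 0 + dann1 s 1 + dann2 s) *: v)
     + (field_word s + dann1 s 0) *: (field_mode f 0 *: v)
     + (field_mode f (-2) *: ((ann1 s 1 + ann2 s) *: v) + trans (field_word s) *: (field_mode f 1 *: v)).
  rewrite /w ann1_cons dann1_cons dann2_cons !scalerA -!scalerDl !mulrDr mulrDl.
  congr (_ *: _).
  by rewrite [LHS](AC (2*3*3) ((2*4*7)*(1*6)*((5*8)*3))).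
apply: eqmD; apply: eqmD.
- exact: eqmZ.
- have [u Uu E] := U_ann Uv 0 f.1.1 f.1.2 f.2; rewrite /field_mode E expr1 scZ Yscr; apply: eqm_sc1.
  exact: YU_m1_2.
- exact/eqmZ/YU_1_3.
- have [u E] : Ok 2 (field_mode f 1 *: v) by apply: (U_annOk 1).
  by rewrite E scZ Yscr; apply: (eqm_sc 2); exact: Y_m2_1.
Qed.

(** The field of the first letter is a derivative of a generating field: its mode
    -1 is I_{-2}, its mode 0 vanishes and its mode 1 is - I_0, whence the sign. *)
Lemma YU_translate_0_2 f s v : U v ->
  eqm 2 (Y ((field_mode f (-2) * field_word s) *: vac) 0 v)
    ((field_mode f (-2) * ann1 s 0 - trans (field_word s) * field_mode f 0) *: v).
Proof.
move=> Uv; pose X := Tv (field_mode f (-1) *: vac).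
have EX : X = field_mode f (-2) *: vac.
  by rewrite /X TvE trans_field_mode opprK scale1r.
have hX r w : Y X r w = - sc r%:~R (field_mode f (r - 1) *: w).
  by rewrite /X Ytrans Ygen intZ.
have -> : (field_mode f (-2) * field_word s) *: vac = Y X (-1) (st s).
  by rewrite -scalerA hX -scNl opprK sc1.
have := @Y_normal_order 2 X (st s) 0 v 2.
rewrite !big_ord_recl big_ord0 addr0 /= !subr0 addr0 /bump /= !addn0 !add0r.
move=> H; apply: eqm_trans (H _) _ => [j hj|].
  rewrite add0r; apply: OkD.
    by apply/YOkr/(Ok_le (k := j.+1)); [exact: leqW|exact: YU_ge].
  rewrite hX YNr Yscr; apply/OkN/Ok_scc/YOkr.
  case: j hj => // j hj; have -> : j.+1%:Z - 1 = j%:Z by rewrite intS addrC addKr.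
  by apply: (Ok_le (k := j.+1)) => //; exact: U_annOk.
set w := (X in eqm _ _ X).
have -> : w = field_mode f (-2) *: (ann1 s 0 *: v) + 0 + (0 - trans (field_word s) *: (field_mode f 0 *: v)).
  by rewrite /w addr0 add0r !scalerA -scalerBl.
apply: eqmD; apply: eqmD.
- by rewrite hX -scNl opprK sc1; exact/eqmZ/YU_0_2.
- by rewrite hX /= sc0l oppr0 Y0r; exact: eqm_refl.
- by apply/eqm0/YOkr; exact: (@YU_ge _ 1).
- rewrite hX subrr sc1 YNr; apply: eqmN.
  have [u E] := field_mode_Ok1 f 0 v; rewrite E expr1 scZ Yscr; apply: eqm_sc1.
  exact: Y_m2_1.
Qed.
End StateField.

(** * Symmetric tensors built from the invariant form *)

Section Tsum.
Variable V : zmodType.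
Implicit Types (F : seq 'I_3 -> V).

Definition tsum n F : V := \sum_(i : n.-tuple 'I_3) F i.

Lemma eq_tsum n F F' : (forall s, size s = n -> F s = F' s) -> tsum n F = tsum n F'.
Proof. by move=> E; apply: eq_bigr => i _; apply: E; rewrite size_tuple. Qed.

Lemma tsum0 F : tsum 0 F = F [::].
Proof.
rewrite /tsum (big_pred1 [tuple]) // => i.
by apply/esym/eqP/val_inj; case: i => -[].
Qed.

Lemma tsumS n F : tsum n.+1 F = \sum_a tsum n (fun s => F (a :: s)).
Proof.
rewrite /tsum pair_big /=.
rewrite (reindex (fun p : 'I_3 * n.-tuple 'I_3 => [tuple of p.1 :: p.2])) //=.
exists (fun t : n.+1.-tuple 'I_3 => (thead t, [tuple of behead t])) => [[a t] _|t _] /=.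
  by congr (_, _); apply/val_inj.
by rewrite [RHS]tuple_eta; apply/val_inj.
Qed.

Lemma tsumD n F F' : tsum n (fun s => F s + F' s) = tsum n F + tsum n F'.
Proof. exact: big_split. Qed.

(** Under a permutation invariant weight all positions of the pulled letter
    contribute alike.  The weight W is an operation so that it may be a scaling. *)
Lemma tsum_pull1 n (W : seq 'I_3 -> V -> V) G :
  (forall s, W s 0 = 0) -> (forall s x y, W s (x + y) = W s x + W s y) ->
  (forall s t x, perm_eq s t -> W s x = W t x) ->
  tsum n.+1 (fun s => W s (pull1 G s))
  = (\sum_a tsum n (fun s => W (a :: s) (G a s))) *+ n.+1.
Proof.
elim: n W G => [|n IH] W G W0 WD Wp.
  by rewrite tsumS mulr1n; apply: eq_bigr => a _; rewrite !tsum0 /= addr0.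
rewrite tsumS; under eq_bigr => a _.
  rewrite (eq_tsum (F' := fun s => W (a :: s) (G a s)
     + W (a :: s) (pull1 (fun b r => G b (a :: r)) s))) => [|s _]; last by rewrite -WD.
  rewrite tsumD (IH (fun s => W (a :: s))) => [|s|s x y|s t x st]; last first.
  - by apply: Wp; rewrite perm_cons.
  - exact: WD.
  - exact: W0.
  over.
rewrite big_split /= sumrMnl [RHS]mulrS; congr (_ + _ *+ _).
rewrite exchange_big /=; apply: eq_bigr => b _; rewrite [RHS]tsumS.
apply: eq_bigr => a _; apply: eq_tsum => s _; apply: Wp.
by rewrite -[a :: b :: s]/([:: a] ++ [:: b] ++ s) perm_catCA.
Qed.

Lemma tsum_pull2 n (W : seq 'I_3 -> V -> V) G :
  (forall s, W s 0 = 0) -> (forall s x y, W s (x + y) = W s x + W s y) ->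
  (forall s t x, perm_eq s t -> W s x = W t x) ->
  tsum n.+2 (fun s => W s (pull2 G s))
  = (\sum_a \sum_b tsum n (fun s => W (a :: b :: s) (G a b s))) *+ 'C(n.+2, 2).
Proof.
elim: n W G => [|n IH] W G W0 WD Wp.
  rewrite tsumS binn mulr1n; apply: eq_bigr => a _.
  by rewrite tsumS; apply: eq_bigr => b _; rewrite !tsum0 /= !addr0.
rewrite tsumS; under eq_bigr => a _.
  rewrite (eq_tsum (F' := fun s => W (a :: s) (pull1 (G a) s)
     + W (a :: s) (pull2 (fun b c r => G b c (a :: r)) s))) => [|s _]; last by rewrite -WD.
  rewrite tsumD (IH (fun s => W (a :: s))) => [|s|s x y|s t x st]; last first.
  - by apply: Wp; rewrite perm_cons.
  - exact: WD.
  - exact: W0.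
  rewrite (tsum_pull1 _ (W := fun s => W (a :: s))) => [|s|s x y|s t x st]; last first.
  - by apply: Wp; rewrite perm_cons.
  - exact: WD.
  - exact: W0.
  over.
have -> : 'C(n.+3, 2) = ('C(n.+2, 2) + n.+2)%N by rewrite binS bin1.
rewrite big_split /= !sumrMnl [RHS]mulrnDr [LHS]addrC; congr (_ *+ _ + _ *+ _).
rewrite exchange_big /=; apply: eq_bigr => b _.
rewrite exchange_big /=; apply: eq_bigr => c _; rewrite [RHS]tsumS.
apply: eq_bigr => a _; apply: eq_tsum => s _; apply: Wp.
by rewrite -[a :: b :: c :: s]/([:: a] ++ [:: b; c] ++ s) perm_catCA.
Qed.
End Tsum.

Section SymmetricSum.
Variable V : zmodType.
Implicit Types (F : seq 'I_3 -> V) (s t : seq 'I_3).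

Definition permsum F s : V := \sum_(sigma : 'S_(size s)) F (permuted sigma).

Definition tuple_act n (u : n.-tuple 'I_3) (p : 'S_n) : n.-tuple 'I_3 :=
  [tuple tnth u (p i) | i < n].

Lemma permsum_tuple F n (u : n.-tuple 'I_3) :
  permsum F u = \sum_(p : 'S_n) F (tuple_act u p).
Proof.
case: u => s hs; have E := eqP hs; case: n / E in hs *.
rewrite /permsum /=; apply: eq_bigr => p _; congr F; rewrite /permuted /=.
by apply: eq_map => k; congr (tnth _ _); apply: val_inj.
Qed.

Lemma tuple_actM n (u : n.-tuple 'I_3) p q :
  tuple_act (tuple_act u p) q = tuple_act u (q * p)%g.
Proof. by apply: eq_from_tnth => i; rewrite !tnth_mktuple permM. Qed.

Lemma permsum_perm F s t : perm_eq s t -> permsum F s = permsum F t.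
Proof.
move=> st; have /tuple_permP [p ->] : perm_eq s (in_tuple t) by [].
rewrite -[RHS]/(permsum F (in_tuple t)).
rewrite -[X in permsum F X]/(tval (tuple_act (in_tuple t) p)) !permsum_tuple.
rewrite [RHS](reindex_inj (mulIg p)) /=; apply: eq_bigr => q _.
exact: (congr1 (fun u : (size t).-tuple _ => F u) (tuple_actM (in_tuple t) p q)).
Qed.

Lemma permuted_perm s (sigma : 'S_(size s)) : perm_eq (permuted sigma) s.
Proof.
apply/(@tuple_permP _ _ _ (in_tuple s)); exists sigma.
by [].
Qed.
End SymmetricSum.

Section Contraction.
Variables (R : realType) (A : comNzRingType) (c : {rmorphism R[i] -> A}).
Local Notation t := (@sym_delta R).

Lemma sym_deltaE s : t s = (size s)`!%:R^-1 * permsum (delta_pairs R[i]) s.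
Proof. by []. Qed.

Lemma sym_delta_perm s s' : perm_eq s s' -> t s = t s'.
Proof.
move=> ss'; rewrite !sym_deltaE.
by rewrite (permsum_perm (delta_pairs R[i]) ss') (perm_size ss').
Qed.

Definition xprod (x : 'I_3 -> A) (s : seq 'I_3) : A := \prod_(a <- s) x a.
Lemma xprod_perm x s s' : perm_eq s s' -> xprod x s = xprod x s'.
Proof. exact: perm_big. Qed.
Lemma xprod_cons x a s : xprod x (a :: s) = x a * xprod x s.
Proof. exact: big_cons. Qed.
Lemma xprod_nil x : xprod x [::] = 1.
Proof. exact: big_nil. Qed.

Definition norm2 (x : 'I_3 -> A) : A := \sum_a x a * x a.

(** Consecutive pairs of equal indices contribute one factor norm2 each. *)
Lemma delta_contract x r :
  tsum (2 * r) (fun s => c (delta_pairs R[i] s) * xprod x s) = norm2 x ^+ r.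
Proof.
elim: r => [|r IH]; first by rewrite muln0 tsum0 rmorph1 xprod_nil mulr1.
rewrite mulnS tsumS exprS -IH mulr_suml; apply: eq_bigr => a _.
rewrite tsumS (bigD1 a) //= [X in _ + X]big1 ?addr0 => [|b ba].
  rewrite /tsum mulr_sumr; apply: eq_bigr => s _.
  by rewrite eqxx mul1r !xprod_cons; ring.
rewrite /tsum big1 // => s _; rewrite eq_sym (negbTE ba) mul0r rmorph0 mul0r.
by [].
Qed.

(** The product of the x_i is invariant under permutations of the indices, so the
    symmetrization of the product of deltas does not change the contraction. *)
Lemma sym_contract x r :
  tsum (2 * r) (fun s => c (t s) * xprod x s) = norm2 x ^+ r.
Proof.
rewrite -delta_contract; set n := (2 * r)%N.
pose f (u : seq 'I_3) := c (delta_pairs R[i] u) * xprod x u.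
have E (s : n.-tuple 'I_3) : c (t s) * xprod x s = c n`!%:R^-1 * permsum f s.
  rewrite sym_deltaE size_tuple rmorphM /= -mulrA; congr (_ * _).
  rewrite /permsum rmorph_sum /= mulr_suml; apply: eq_bigr => p _; rewrite /f.
  by rewrite (xprod_perm x (permuted_perm p)).
rewrite /tsum (eq_bigr _ (fun s _ => E s)) -mulr_sumr.
rewrite (eq_bigr _ (fun s _ => permsum_tuple f s)) exchange_big /=.
rewrite (eq_bigr (fun=> \sum_(s : n.-tuple 'I_3) f s)) => [|p _]; last first.
  rewrite [RHS](reindex_inj (h := fun u => tuple_act u p)) //= => u v E'.
  have := congr1 (fun w => tuple_act w p^-1%g) E'; rewrite !tuple_actM mulVg.
  move=> E2; apply: eq_from_tnth => i; have := congr1 (fun w => tnth w i) E2.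
  by rewrite !tnth_mktuple perm1.
rewrite sumr_const card_Sn -[X in _ * X]mulr_natl mulrA -(rmorph_nat c) -rmorphM mulVf ?rmorph1 ?mul1r //.
by rewrite pnatr_eq0 -lt0n fact_gt0.
Qed.
End Contraction.

Section Polarization.
Variables (R : realType) (A : comNzRingType) (c : {rmorphism R[i] -> A}).
Local Notation t := (@sym_delta R).

Lemma mulrn_inj n (x y : A) : x *+ n.+1 = y *+ n.+1 -> x = y.
Proof.
move=> E; have nz : n.+1%:R != 0 :> R[i] by rewrite pnatr_eq0.
have H (z : A) : z = c n.+1%:R^-1 * (z *+ n.+1).
  by rewrite -[z *+ _]mulr_natr mulrCA -(rmorph_nat c) -rmorphM mulVf // rmorph1 mulr1.
by rewrite (H x) (H y) E.
Qed.

Lemma deriv_xprod (x : 'I_3 -> {poly A}) s :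
  (xprod x s)^`() = pull1 (fun a s' => (x a)^`() * xprod x s') s.
Proof.
elim: s => [|a s IH]; first by rewrite xprod_nil derivC.
rewrite xprod_cons derivM IH /= -pull1Ml; congr (_ + _).
by apply: eq_pull1 => b u; rewrite xprod_cons mulrCA.
Qed.

Lemma deriv_tsum n (F : seq 'I_3 -> {poly A}) :
  (tsum n F)^`() = tsum n (fun s => (F s)^`()).
Proof. exact: raddf_sum. Qed.

Local Notation cP := (polyC \o c).

(** The line through x in direction e: differentiating along it frees one index of
    a contraction. *)
Definition ray (x : 'I_3 -> A) (e a : 'I_3) : {poly A} := (x a)%:P + (a == e)%:R *: 'X.

Lemma deriv_ray x e a : (ray x e a)^`() = (a == e)%:R%:P.
Proof. by rewrite /ray derivD derivC add0r derivZ derivX -alg_polyC. Qed.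
Lemma ray_at0 x e a : (ray x e a).[0] = x a.
Proof. by rewrite /ray hornerD hornerC hornerZ hornerX mulr0 addr0. Qed.
Lemma xprod_ray_at0 x e s : (xprod (ray x e) s).[0] = xprod x s.
Proof. by rewrite /xprod horner_prod; apply: eq_bigr => a _; rewrite ray_at0. Qed.
Lemma norm2_ray_at0 x e : (norm2 (ray x e)).[0] = norm2 x.
Proof. by rewrite /norm2 horner_sum; apply: eq_bigr => a _; rewrite hornerM ray_at0. Qed.
Lemma deriv_norm2_ray x e : ((norm2 (ray x e))^`()).[0] = x e *+ 2.
Proof.
rewrite /norm2 raddf_sum /= horner_sum (bigD1 e) //= big1 ?addr0 => [|a ae].
  by rewrite derivM hornerD !hornerM deriv_ray ray_at0 eqxx hornerC mul1r mulr1 mulr2n.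
by rewrite derivM hornerD !hornerM deriv_ray (negbTE ae) hornerC mul0r mulr0 addr0.
Qed.

Lemma deriv_tsum_ray n (tau : seq 'I_3 -> R[i]) x e :
  (forall s s', perm_eq s s' -> tau s = tau s') ->
  ((tsum n.+1 (fun s => cP (tau s) * xprod (ray x e) s))^`()).[0]
  = tsum n (fun s => c (tau (e :: s)) * xprod x s) *+ n.+1.
Proof.
move=> tp; rewrite deriv_tsum.
rewrite (eq_tsum (F' := fun s => cP (tau s) *
   pull1 (fun a s' => (ray x e a)^`() * xprod (ray x e) s') s)); last first.
  by move=> s _; rewrite derivM derivC mul0r add0r deriv_xprod.
rewrite (tsum_pull1 _ (W := fun s y => cP (tau s) * y)) => [|s|s u v|s s' u ss'].
- rewrite hornerMn; congr (_ *+ _); rewrite horner_sum (bigD1 e) //= big1 ?addr0.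
    rewrite horner_sum; apply: eq_bigr => s _.
    by rewrite !hornerM deriv_ray eqxx !hornerC xprod_ray_at0 mul1r.
  move=> a ae; rewrite horner_sum big1 // => s _.
  by rewrite !hornerM deriv_ray (negbTE ae) !hornerC mul0r mulr0.
- exact: mulr0.
- exact: mulrDr.
- by rewrite (tp _ _ ss').
Qed.

(** The gradient of norm2 ^ (r + 1), divided by its degree 2 r + 2. *)
Lemma sym_contract1 x r e :
  tsum (2 * r).+1 (fun s => c (t (e :: s)) * xprod x s) = x e * norm2 x ^+ r.
Proof.
have H := @deriv_tsum_ray (2 * r).+1 t x e (@sym_delta_perm R).
apply: (@mulrn_inj (2 * r).+1); rewrite -H.
have -> : ((2 * r).+2 = 2 * r.+1)%N by rewrite mulnS.
rewrite (@sym_contract R _ cP) deriv_exp hornerMn hornerM horner_exp norm2_ray_at0 deriv_norm2_ray /=.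
by rewrite mulrnAl -mulrnA.
Qed.

End Polarization.

(** The gradient of [sym_contract1], multiplied by 2 r + 1 to stay integral. *)
Lemma sym_contract2 (R : realType) (A : comNzRingType) (c : {rmorphism R[i] -> A})
    (x : 'I_3 -> A) r e e' :
  tsum (2 * r) (fun s => c (@sym_delta R (e :: e' :: s)) * xprod x s) *+ (2 * r).+1
  = (e == e')%:R * norm2 x ^+ r + x e * x e' * norm2 x ^+ r.-1 *+ (2 * r).
Proof.
have tp s s' : perm_eq s s' -> @sym_delta R (e :: s) = @sym_delta R (e :: s').
  by move=> h; apply: sym_delta_perm; rewrite perm_cons.
have := @deriv_tsum_ray R A c (2 * r) (fun s => @sym_delta R (e :: s)) x e' tp.
rewrite (@sym_contract1 R _ (polyC \o c)) derivM hornerD !hornerM deriv_ray ray_at0.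
rewrite deriv_exp hornerMn hornerM !horner_exp norm2_ray_at0 deriv_norm2_ray hornerC.
move=> E; rewrite -E; congr (_ + _).
by rewrite mulrnAl -mulrnA mulrnAr mulrA.
Qed.

(** * Leading coefficients in h *)

Section HasSymbol.
Variables (K : comNzRingType) (G : Type) (D : free_datum K G) (V : lmodType D).
Variables (h : K) (vac : V) (beta : G -> G -> D) (ann : pred G).
Local Notation lt := (fd_letter D).
Local Notation Ok := (@Ok K G D V h).
Local Notation eqm := (@eqm K G D V h).
Local Notation sc := (@sc K G D V).
Hypothesis comm : forall g k v,
  lt g *: (lt k *: v) = lt k *: (lt g *: v) + sc h (beta g k *: v).
Hypothesis annv : forall g, ann g -> lt g *: vac = 0.

(** The coefficient of h ^ k in v modulo h, as a commutative polynomial; a relation,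
    because different L may represent v. *)
Definition has_symbol (k : nat) (v : V) (p : comalg D) : Prop :=
  exists2 L : D, eqm k.+1 v (sc (h ^+ k) (L *: vac)) & sym L = p.

Lemma has_symbol_eqm k v w p : eqm k.+1 v w -> has_symbol k w p -> has_symbol k v p.
Proof. by move=> E [L hL sL]; exists L => //; exact: eqm_trans E hL. Qed.
Lemma has_symbol_state (x : D) : has_symbol 0 (x *: vac) (sym x).
Proof. by exists x; rewrite // expr0 sc1; exact: eqm_refl. Qed.
Lemma has_symbol_Ok k v : Ok k.+1 v -> has_symbol k v 0.
Proof.
by move=> H; exists 0; [rewrite scale0r sc0r; exact/eqm0|exact: sym0].
Qed.
Lemma has_symbolD k v w p q :
  has_symbol k v p -> has_symbol k w q -> has_symbol k (v + w) (p + q).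
Proof.
move=> [L hL <-] [M hM <-]; exists (L + M); last exact: symD.
by rewrite scalerDl scDr; exact: eqmD.
Qed.
Lemma has_symbolN k v p : has_symbol k v p -> has_symbol k (- v) (- p).
Proof.
move=> [L hL <-]; exists (- L); last exact: symN.
by rewrite scaleNr scNr; exact: eqmN.
Qed.
Lemma has_symbolB k v w p q :
  has_symbol k v p -> has_symbol k w q -> has_symbol k (v - w) (p - q).
Proof. by move=> hv hw; apply: has_symbolD => //; exact: has_symbolN. Qed.
Lemma has_symbolZ k (x : D) v p : has_symbol k v p -> has_symbol k (x *: v) (sym x * p).
Proof.
move=> [L hL <-]; exists (x * L); last exact: symM.
by rewrite -scalerA -scZ; exact: eqmZ.
Qed.
Lemma has_symbol_sc k c v p : has_symbol k v p -> has_symbol k (sc c v) (csc D c * p).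
Proof. exact: has_symbolZ. Qed.
Lemma has_symbol_h k v p : has_symbol k v p -> has_symbol k.+1 (sc h v) p.
Proof.
by move=> [L hL <-]; exists L => //; rewrite exprS -scA; exact: eqm_sc1.
Qed.
Lemma has_symbol_hn k l v p : has_symbol k v p -> has_symbol (l + k) (sc (h ^+ l) v) p.
Proof.
elim: l => [|l IH] H; first by rewrite expr0 sc1.
by rewrite exprS -scA; apply: has_symbol_h; exact: IH.
Qed.
Lemma has_symbol0 k : has_symbol k 0 0.
Proof. exact/has_symbol_Ok/Ok0. Qed.
Lemma has_symbol_sum k I (r : seq I) (P : pred I) f p :
  (forall i, P i -> has_symbol k (f i) (p i)) ->
  has_symbol k (\sum_(i <- r | P i) f i) (\sum_(i <- r | P i) p i).
Proof.
move=> H; elim/big_ind2: _ => // [|x1 x2 y1 y2 hx hy]; first exact: has_symbol0.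
exact: has_symbolD.
Qed.
Lemma has_symbolMn k v p n : has_symbol k v p -> has_symbol k (v *+ n) (p *+ n).
Proof.
move=> H; elim: n => [|n IH]; rewrite ?mulr0n; first exact: has_symbol0.
by rewrite !mulrS; exact: has_symbolD.
Qed.
(** This reduces congruences in the module to identities of polynomials. *)
Lemma has_symbol_inj k v w p : has_symbol k v p -> has_symbol k w p -> eqm k.+1 v w.
Proof.
move=> [L hL <-] [M hM E]; apply: eqm_trans hL (eqm_trans _ (eqm_sym hM)).
by rewrite -(addn1 k); apply/eqm_sc/(sym_congr comm).
Qed.

(** Commutation with a letter, divided by h. *)
Definition ad g : D -> D := fd_der (\0 : {additive K -> K}) (beta g).
Lemma adM g x y : ad g (x * y) = ad g x * y + x * ad g y.
Proof. by rewrite /ad fd_derM //; exact: null_derM. Qed.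
Lemma adZ g c x : ad g (c *: x) = c *: ad g x.
Proof. by rewrite /ad fd_derZ; [rewrite scale0r add0r|exact: null_derM]. Qed.
Lemma ad_letter g k : ad g (lt k) = beta g k.
Proof. by rewrite /ad fd_der_letter //; exact: null_derM. Qed.
Lemma ad1 g : ad g 1 = 0.
Proof. by rewrite /ad fd_der1 //; exact: null_derM. Qed.

Lemma ad_act g (y : D) v : lt g *: (y *: v) = y *: (lt g *: v) + sc h (ad g y *: v).
Proof.
elim/fd_ind: y v => [|x y hx hy|c s] v.
- by rewrite /ad fd_der0 !scale0r scaler0 sc0r addr0.
- by rewrite /ad fd_derD !scalerDl scalerDr hx hy scDr addrACA.
rewrite adZ -!scE scZ; suff -> : lt g *: ((\prod_(i <- s) lt i) *: v)
  = \prod_(i <- s) lt i *: (lt g *: v) + sc h (ad g (\prod_(i <- s) lt i) *: v).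
  by rewrite scDr !scA [c * h]mulrC.
elim: s v => [|k s IH] v; first by rewrite big_nil ad1 !scale1r scale0r sc0r addr0.
rewrite big_cons -!scalerA comm IH scalerDr adM ad_letter scalerDl scDr scZ.
by rewrite -!scalerA -addrA [X in _ + X]addrC.
Qed.

Lemma ann_state g (y : D) : ann g -> lt g *: (y *: vac) = sc h (ad g y *: vac).
Proof. by move=> hg; rewrite ad_act annv // scaler0 add0r. Qed.

Local Notation cad g := (comder (\0 : {additive K -> K}) (beta g)).

Lemma sym_ad g y : sym (ad g y) = cad g (sym y).
Proof. by rewrite comderE //; exact: null_derM. Qed.

Lemma fd_rev_der (d : G -> D) x : (forall k, fd_rev (d k) = d k) ->
  fd_rev (fd_der (\0 : {additive K -> K}) d x)
  = fd_der (\0 : {additive K -> K}) d (fd_rev x).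
Proof.
move=> hd; have nM := @null_derM K; elim/fd_ind: x => [|x y hx hy|k s].
- by rewrite (fd_rev0 D) fd_der0 (fd_rev0 D).
- by rewrite !(fd_derD, fd_revD) hx hy.
rewrite fd_revZ !fd_derZ // !scale0r !add0r fd_revZ; congr (_ *: _).
elim: s => [|g s IH]; first by rewrite big_nil fd_der1 // fd_rev1 fd_der1 // (fd_rev0 D).
rewrite big_cons fd_derM // fd_revD !fd_revM fd_derM // IH fd_der_letter //.
by rewrite fd_rev_letter fd_der_letter // hd addrC.
Qed.

(** The Leibniz rule for the commutator with a word; the order of the factors does
    not matter after the overall factor h. *)
Lemma commutator_word (s : seq G) (y : D) v :
  eqm 2 ((\prod_(i <- s) lt i * y - y * \prod_(i <- s) lt i) *: v)
    (sc h (pull1 (fun g s' => \prod_(i <- s') lt i * ad g y) s *: v)).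
Proof.
elim: s v => [|g s IH] v.
  by rewrite big_nil mul1r mulr1 subrr /= !scale0r sc0r; exact: eqm_refl.
rewrite big_cons /=; set w := \prod_(i <- s) lt i.
have -> : lt g * w * y - y * (lt g * w) = lt g * (w * y - y * w) + (lt g * y - y * lt g) * w.
  by rewrite mulrBr mulrBl !mulrA addrA subrK.
rewrite !scalerDl scDr addrC; apply: eqmD.
  rewrite -scalerA scalerBl -!scalerA ad_act addrAC subrr add0r.
  apply: eqm_sc1. exact: (commute_mod1 comm (ad g y) w v).
rewrite -scalerA; apply: eqm_trans (eqmZ _ (IH v)) _.
rewrite scZ scalerA -pull1Ml; apply: eqm_eq; congr (sc h (_ *: v)).
by apply: eq_pull1 => k u; rewrite big_cons mulrA.
Qed.

(** Let z be the sum of the x_i y_i.  Its reversal is the sum of the y_i x_i, and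
    z plus its reversal acts as O(h ^ 2) because the abelianization of z vanishes
    ([rev_symmetrized_Ok2]).  So z acts as half of the sum of the commutators. *)
Lemma has_symbol_half_commutator (c2 : K) I (r : seq I) (x y : I -> D) p :
  c2 + c2 = 1 ->
  (forall i, fd_rev (x i) = x i) -> (forall i, fd_rev (y i) = y i) ->
  \sum_(i <- r) sym (x i) * sym (y i) = 0 ->
  has_symbol 1 (\sum_(i <- r) (x i * y i - y i * x i) *: vac) p ->
  has_symbol 1 (\sum_(i <- r) (x i * y i) *: vac) (csc D c2 * p).
Proof.
move=> c2E rx ry s0 H; pose z := \sum_(i <- r) x i * y i.
have Ez : fd_rev z = \sum_(i <- r) y i * x i.
  rewrite /z (big_morph _ (fd_revD (f := D)) (fd_rev0 D)).
  by apply: eq_bigr => i _; rewrite fd_revM rx ry.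
have sz : sym z = 0 by rewrite sym_sum -[RHS]s0; apply: eq_bigr => i _; rewrite symM.
have := rev_symmetrized_Ok2 comm sz vac => hz.
rewrite -scaler_suml -/z.
apply: has_symbol_eqm (has_symbol_sc c2 H).
rewrite -scaler_suml sumrB -/z -Ez /eqm.
have -> : z *: vac - sc c2 ((z - fd_rev z) *: vac) = sc c2 ((z + fd_rev z) *: vac).
  rewrite -{1}[z *: vac]sc1 -c2E scDl !scalerBl !scalerDl !scDr scNr.
  by rewrite opprB addrACA subrr addr0.
exact: Ok_scc.
Qed.
End HasSymbol.

(** * Vector algebra *)

Section VectorAlgebra.
Variables (A : comNzRingType) (phi : A).
Implicit Types (u v w x y : 'I_3 -> A).

Definition dot u v : A := \sum_i u i * v i.
Definition eps (i j k : 'I_3) : A := (levi_civita i j k)%:~R.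
(** The contraction of v with the structure constants phi * eps of sl2; below,
    phi is i sqrt 2. *)
Definition str v (i j : 'I_3) : A := \sum_k phi * eps i j k * v k.

Let i0 : 'I_3 := ord0.
Let i1 : 'I_3 := lift ord0 ord0.
Let i2 : 'I_3 := lift ord0 (lift ord0 ord0).

Lemma sum3 (V : zmodType) (F : 'I_3 -> V) : \sum_i F i = F i0 + F i1 + F i2.
Proof. by rewrite !big_ord_recl big_ord0 addr0 addrA. Qed.

Lemma ord3P (P : 'I_3 -> Prop) : P i0 -> P i1 -> P i2 -> forall i, P i.
Proof.
move=> h0 h1 h2 i; case: (unliftP ord0 i) => [j ->|-> //].
case: (unliftP ord0 j) => [k ->|-> //].
case: (unliftP ord0 k) => [[]//|->]; exact: h2.
Qed.

Let e_ i j k n : levi_civita i j k = n -> eps i j k = n%:~R.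
Proof. by move=> <-. Qed.

Let epsE := (@e_ i0 i0 i0 0 erefl, @e_ i0 i0 i1 0 erefl, @e_ i0 i0 i2 0 erefl,
 @e_ i0 i1 i0 0 erefl, @e_ i0 i1 i1 0 erefl, @e_ i0 i1 i2 1 erefl,
 @e_ i0 i2 i0 0 erefl, @e_ i0 i2 i1 (-1) erefl, @e_ i0 i2 i2 0 erefl,
 @e_ i1 i0 i0 0 erefl, @e_ i1 i0 i1 0 erefl, @e_ i1 i0 i2 (-1) erefl,
 @e_ i1 i1 i0 0 erefl, @e_ i1 i1 i1 0 erefl, @e_ i1 i1 i2 0 erefl,
 @e_ i1 i2 i0 1 erefl, @e_ i1 i2 i1 0 erefl, @e_ i1 i2 i2 0 erefl,
 @e_ i2 i0 i0 0 erefl, @e_ i2 i0 i1 1 erefl, @e_ i2 i0 i2 0 erefl,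
 @e_ i2 i1 i0 (-1) erefl, @e_ i2 i1 i1 0 erefl, @e_ i2 i1 i2 0 erefl,
 @e_ i2 i2 i0 0 erefl, @e_ i2 i2 i1 0 erefl, @e_ i2 i2 i2 0 erefl).

Lemma dotC u v : dot u v = dot v u.
Proof. by apply: eq_bigr => i _; rewrite mulrC. Qed.
Lemma norm2E u : norm2 u = dot u u. Proof. by []. Qed.

Definition triple u v w : A := \sum_i \sum_j u i * v j * str w i j.

Lemma str0 w : str w i0 i0 = 0 /\ str w i0 i1 = phi * w i2 /\ str w i0 i2 = - (phi * w i1)
  /\ str w i1 i0 = - (phi * w i2) /\ str w i1 i1 = 0 /\ str w i1 i2 = phi * w i0
  /\ str w i2 i0 = phi * w i1 /\ str w i2 i1 = - (phi * w i0) /\ str w i2 i2 = 0.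
Proof. by rewrite /str !sum3 !epsE; do !split; ring. Qed.

Let s_ w := (let: conj h0 (conj h1 (conj h2 (conj h3 (conj h4 (conj h5 (conj h6 (conj h7 h8)))))))
  := str0 w in (h0, h1, h2, h3, h4, h5, h6, h7, h8)).

Lemma tripleE u v w : triple u v w = phi *
  (u i0 * v i1 * w i2 - u i0 * v i2 * w i1 - u i1 * v i0 * w i2
   + u i1 * v i2 * w i0 + u i2 * v i0 * w i1 - u i2 * v i1 * w i0).
Proof. by rewrite /triple !sum3 !s_; ring. Qed.

Lemma triple_cyc u v w : triple u v w = triple w u v.
Proof. by rewrite !tripleE; ring. Qed.

Lemma triple_str u v x y :
  triple u v (fun k => \sum_j x j * str y k j)
  = phi * phi * (dot u x * dot v y - dot u y * dot v x).
Proof. by rewrite tripleE /dot !sum3 !s_; ring. Qed.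

Lemma triple_str_contract u v x y :
  triple (fun j => \sum_a x a * str y a j) u v
  = phi * phi * (dot y u * dot x v - dot y v * dot x u).
Proof. by rewrite tripleE /dot !sum3 !s_; ring. Qed.

Lemma str_trace (p q : 'I_3 -> A) : \sum_i \sum_j str p i j * str q i j = phi * phi * dot p q *+ 2.
Proof. by rewrite /dot !sum3 !s_; ring. Qed.
Lemma str_str_trace b r : \sum_i \sum_j b j * \sum_k phi * eps i j k * str r i k
  = - (phi * phi * dot b r *+ 2).
Proof. by rewrite /dot !sum3 !epsE !s_; ring. Qed.
Lemma str_contract (p q : 'I_3 -> A) u v :
  \sum_i \sum_a u i * v a * (\sum_j str p i j * str q a j)
  = phi * phi * (dot p q * dot u v - dot p v * dot u q).
Proof. by rewrite /dot !sum3 !s_; ring. Qed.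
Lemma str_str_contract b r u v :
  \sum_i \sum_a u i * v a * (\sum_j b j * \sum_k phi * eps a j k * str r i k)
  = phi * phi * (dot v r * dot b u - dot v u * dot b r).
Proof. by rewrite /dot !sum3 !epsE !s_; ring. Qed.
Lemma str_str_diag s a : \sum_j \sum_k phi * eps a j k * str s k j = - (phi * phi * s a *+ 2).
Proof. by elim/ord3P: a; rewrite !sum3 !epsE !s_; ring. Qed.
Lemma str_str_double b s a :
  \sum_j \sum_j' b j * b j' * (\sum_k phi * eps a j k * str s k j')
  = phi * phi * (b a * dot b s - s a * dot b b).
Proof. by elim/ord3P: a; rewrite /dot !sum3 !epsE !s_; ring. Qed.

Lemma strD u v i j : str (fun k => u k + v k) i j = str u i j + str v i j.
Proof. by rewrite /str -big_split; apply: eq_bigr => k _; rewrite mulrDr. Qed.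
Lemma strB u v i j : str (fun k => u k - v k) i j = str u i j - str v i j.
Proof. by rewrite /str -sumrB; apply: eq_bigr => k _; rewrite mulrBr. Qed.
Lemma strZ (x : A) u i j : str (fun k => x * u k) i j = x * str u i j.
Proof. by rewrite /str mulr_sumr; apply: eq_bigr => k _; rewrite mulrCA. Qed.
Lemma dotDl u v w : dot (fun k => u k + v k) w = dot u w + dot v w.
Proof. by rewrite /dot -big_split; apply: eq_bigr => k _; rewrite mulrDl. Qed.
Lemma dotBl u v w : dot (fun k => u k - v k) w = dot u w - dot v w.
Proof. by rewrite /dot -sumrB; apply: eq_bigr => k _; rewrite mulrBl. Qed.
Lemma dotZl (x : A) u w : dot (fun k => x * u k) w = x * dot u w.
Proof. by rewrite /dot mulr_sumr; apply: eq_bigr => k _; rewrite mulrA. Qed.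
Lemma dotDr u v w : dot w (fun k => u k + v k) = dot w u + dot w v.
Proof. by rewrite !(dotC w) dotDl. Qed.
Lemma dotBr u v w : dot w (fun k => u k - v k) = dot w u - dot w v.
Proof. by rewrite !(dotC w) dotBl. Qed.
Lemma dotZr (x : A) u w : dot w (fun k => x * u k) = x * dot w u.
Proof. by rewrite !(dotC w) dotZl. Qed.

Lemma str_dot_sum b p q :
  \sum_i (\sum_j b j * str p i j) * (\sum_j b j * str q i j)
  = phi * phi * (dot b b * dot p q - dot b p * dot b q).
Proof. by rewrite /dot !sum3 !s_; ring. Qed.

(** The contraction of f_{ijk} with a_i b_j and with a combination of a_k and b_k
    vanishes.  This kills all terms of the lowest order in h. *)
Lemma str_self a b (x : A) :
  \sum_i a i * (\sum_j b j * str (fun k => x * (b k - a k)) i j) = 0.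
Proof. by rewrite !sum3 !s_; ring. Qed.

Record derivation (d : A -> A) : Prop := Derivation {
  derD : {morph d : x y / x + y};
  derM : forall x y : A, d (x * y) = d x * y + x * d y }.

Section Derivation.
Variable d : A -> A.
Hypothesis hd : derivation d.

Lemma der0 : d 0 = 0.
Proof. by apply: (addrI (d 0)); rewrite -(derD hd) !addr0. Qed.
Lemma derN (x : A) : d (- x) = - d x.
Proof. by apply: (addrI (d x)); rewrite -(derD hd) !subrr der0. Qed.
Lemma derB (x y : A) : d (x - y) = d x - d y.
Proof. by rewrite (derD hd) derN. Qed.
Lemma der_sum I (r : seq I) (P : pred I) F :
  d (\sum_(i <- r | P i) F i) = \sum_(i <- r | P i) d (F i).
Proof. exact: (big_morph _ (derD hd) der0). Qed.
Lemma derMn (x : A) n : d (x *+ n) = d x *+ n.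
Proof. by elim: n => [|n IH]; rewrite ?der0 // !mulrS (derD hd) IH. Qed.
Lemma der1 : d 1 = 0.
Proof.
have := derM hd 1 1; rewrite !mulr1 mul1r => /eqP.
by rewrite -subr_eq0 opprD addNKr oppr_eq0 => /eqP.
Qed.
Lemma der_int (n : int) : d n%:~R = 0.
Proof. by case: n => n; rewrite ?NegzE ?rmorphN ?derN -?pmulrn derMn der1 mul0rn ?oppr0. Qed.
Lemma derX (x : A) n : d (x ^+ n) = (x ^+ n.-1 * d x) *+ n.
Proof.
elim: n => [|n IH]; first by rewrite expr0 der1.
rewrite exprS (derM hd) IH mulrS [d x * _]mulrC; congr (_ + _).
case: n {IH} => [|n]; first by rewrite !mulr0n mulr0.
by rewrite mulrnAr mulrA -exprS.
Qed.
Lemma der_dot u v : d (dot u v) = dot (d \o u) v + dot u (d \o v).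
Proof. by rewrite der_sum -big_split; apply: eq_bigr => i _; rewrite (derM hd). Qed.
Lemma der_norm2 u : d (norm2 u) = dot u (d \o u) *+ 2.
Proof. by rewrite norm2E der_dot dotC mulr2n. Qed.
Lemma der_norm2X u n : d (norm2 u ^+ n) = (norm2 u ^+ n.-1 * dot u (d \o u)) *+ 2 *+ n.
Proof. by rewrite derX der_norm2 mulrnAr. Qed.
Hypothesis dphi : d phi = 0.
Lemma der_str u i j : d (str u i j) = \sum_k phi * eps i j k * d (u k).
Proof.
rewrite der_sum; apply: eq_bigr => k _.
by rewrite !(derM hd) dphi der_int mul0r mulr0 addr0 mul0r add0r.
Qed.
End Derivation.

(** The value of two successive derivations on norm2 b ^ (N + 1), when they move b
    along the vectors q and p and the second one moves q along r; see
    [second_derivative]. *)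
Definition second (b p q r : 'I_3 -> A) (N : nat) (i a : 'I_3) : A :=
  ((norm2 b ^+ N.-1 * (\sum_j b j * str p i j)) *+ 2 *+ N * (\sum_j b j * str q a j)
   + norm2 b ^+ N * (\sum_j str p i j * str q a j
                     + \sum_j b j * \sum_k phi * eps a j k * str r i k)) *+ 2 *+ N.+1.

Lemma second_derivative (d d' : A -> A) b p q r N i a :
  derivation d -> derivation d' -> d' phi = 0 ->
  (forall j, d (b j) = str q a j) -> (forall j, d' (b j) = str p i j) ->
  (forall k, d' (q k) = str r i k) ->
  d' (d (norm2 b ^+ N.+1)) = second b p q r N i a.
Proof.
move=> hd hd' dphi h1 h2 h3; rewrite (der_norm2X hd) !(derMn hd') (derM hd') /=.
rewrite (der_norm2X hd') /second; congr (_ *+ _ *+ _).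
have -> : dot b (d \o b) = \sum_j b j * str q a j by apply: eq_bigr => j _; rewrite /= h1.
have -> : dot b (d' \o b) = \sum_j b j * str p i j by apply: eq_bigr => j _; rewrite /= h2.
congr (_ + _ * _); rewrite (der_sum hd') -big_split; apply: eq_bigr => j _ /=.
rewrite (derM hd') h2 (der_str hd' dphi); congr (_ + _ * _).
by apply: eq_bigr => k _; rewrite h3.
Qed.

Lemma second_trace b p q r N : \sum_i second b p q r N i i = phi * phi *
  ((norm2 b ^+ N.-1 * (norm2 b * dot p q - dot b p * dot b q)) *+ 2 *+ N
   + norm2 b ^+ N * (dot p q *+ 2 - dot b r *+ 2)) *+ 2 *+ N.+1.
Proof.
rewrite /second !sumrMnl; congr (_ *+ _ *+ _).
rewrite big_split /= -[X in _ + X]mulr_sumr big_split /= str_trace str_str_trace.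
under eq_bigr do rewrite !mulrnAl -mulrA.
rewrite !sumrMnl -mulr_sumr str_dot_sum norm2E.
by ring.
Qed.

(** The hypothesis removes the products of two first derivatives. *)
Lemma second_contract b p q r N u v :
  (\sum_i u i * (\sum_j b j * str p i j)) * (\sum_a v a * (\sum_j b j * str q a j)) = 0 ->
  \sum_i \sum_a u i * v a * second b p q r N i a = phi * phi *
  norm2 b ^+ N * (dot p q * dot u v - dot p v * dot u q
                  + dot v r * dot b u - dot v u * dot b r) *+ 2 *+ N.+1.
Proof.
move=> H; rewrite /second.
under eq_bigr => i _ do under eq_bigr => a _ do rewrite !mulrnAr.
under eq_bigr => i _ do rewrite !sumrMnl.
rewrite !sumrMnl; congr (_ *+ _ *+ _).
under eq_bigr => i _.
  under eq_bigr => a _.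
    rewrite mulrDr [u i * v a * (norm2 b ^+ N * _)]mulrCA mulrDr mulrDr addrA.
    over.
  rewrite !big_split -!mulr_sumr /=.
  over.
rewrite !big_split /= -!mulr_sumr str_contract str_str_contract.
rewrite (_ : \sum_i _ = 0) ?add0r; first by ring.
have G (B : A) (f g : 'I_3 -> A) : \sum_i \sum_a u i * v a * ((B * f i) *+ 2 *+ N * g a)
    = B * ((\sum_i u i * f i) * (\sum_a v a * g a)) *+ 2 *+ N.
  rewrite big_distrlr mulr_sumr -!sumrMnl; apply: eq_bigr => i _ /=.
  rewrite mulr_sumr -!sumrMnl; apply: eq_bigr => a _.
  by rewrite !mulrnAl !mulrnAr; congr (_ *+ _ *+ _); ring.
by rewrite G H mulr0 !mul0rn.
Qed.
End VectorAlgebra.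

(** * Symmetrized products *)

Lemma comder_derivation (K : comNzRingType) (G : Type) (D : free_datum K G)
    (d0 : {additive K -> K}) (d : G -> D) :
  (forall a b, d0 (a * b) = d0 a * b + a * d0 b) -> derivation (comder d0 d).
Proof.
move=> d0M; split=> x y; last exact: comderM.
rewrite -[x]sym_unsym -[y]sym_unsym -symD !(comderE d d0M) fd_derD symD.
by [].
Qed.

Section SymmetrizedProduct.
Variables (R : realType) (K : comNzRingType) (c : {rmorphism R[i] -> K}).
Variables (P : choiceType) (D : free_datum K (mode P)).
Local Notation lt := (fd_letter D).
Local Notation S := (@sym K (mode P) D).
Local Notation t := (@sym_delta R).
Local Notation cc := (csc D \o c : {rmorphism R[i] -> comalg D}).

Definition symprod (u : P) (s : seq 'I_3) : D :=
  c (size s)`!%:R^-1 *: \sum_(sigma : 'S_(size s)) \prod_(x <- permuted sigma) lt (Imode u x 0 (-1)).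

Lemma sym_symprod u s : S (symprod u s) = xprod (fun i => cvar D (Imode u i 0 (-1))) s.
Proof.
rewrite /symprod symZ sym_sum (eq_bigr (fun=> xprod (fun i => cvar D (Imode u i 0 (-1))) s)).
  rewrite sumr_const card_Sn -[X in _ * X]mulr_natl mulrA -[csc D _]/(cc _) -(rmorph_nat cc) -rmorphM.
  by rewrite mulVf ?rmorph1 ?mul1r // pnatr_eq0 -lt0n fact_gt0.
move=> p _; rewrite symbol_prod; apply: xprod_perm; exact: permuted_perm.
Qed.

(** The tensors t contract each leg separately by [sym_contract]; f stands for
    translation of the first leg, or for the identity. *)
Lemma contract_legs M N (x y : 'I_3 -> comalg D) (f : comalg D -> comalg D) :
  {morph f : x y / x + y} -> (forall d x, f (csc D d * x) = csc D d * f x) ->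
  \sum_(i : (2 * M).-tuple 'I_3) \sum_(j : (2 * N).-tuple 'I_3) \sum_e
    cc (t i * t j) * (f (xprod x (e :: i)) * xprod y (e :: j))
  = \sum_e f (x e * norm2 x ^+ M) * (y e * norm2 y ^+ N).
Proof.
move=> fD fZ; have f0 : f 0 = 0 by apply: (addrI (f 0)); rewrite -fD !addr0.
transitivity (\sum_e (\sum_(i : (2 * M).-tuple 'I_3) cc (t i) * f (xprod x (e :: i)))
   * (\sum_(j : (2 * N).-tuple 'I_3) cc (t j) * xprod y (e :: j))).
  under eq_bigr do rewrite exchange_big; rewrite exchange_big; apply: eq_bigr => e _ /=.
  rewrite mulr_suml; apply: eq_bigr => i _; rewrite mulr_sumr; apply: eq_bigr => j _.
  by rewrite -[csc D (c (_ * _))]/(cc _) (rmorphM cc) mulrACA.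
apply: eq_bigr => e _; congr (_ * _).
  rewrite -(sym_contract cc x) /tsum mulr_sumr (big_morph f fD f0); apply: eq_bigr => i _.
  by rewrite -[cc (t i) * f _]/(csc D (c (t i)) * f _) -fZ xprod_cons mulrCA.
rewrite -(sym_contract cc y) /tsum mulr_sumr; apply: eq_bigr => i _.
by rewrite xprod_cons mulrCA.
Qed.
End SymmetrizedProduct.

(** * The two-point current algebra *)

Section TwoPoint.
Variables (R : realType) (K : comNzRingType) (c : {rmorphism R[i] -> K}) (h X : K).
Variables (D : free_datum K (mode point)) (V : lmodType D) (vac : V).
Variable beta : mode point -> mode point -> D.
Local Notation lt := (fd_letter D).
Local Notation Ok := (@Ok K (mode point) D V h).
Local Notation eqm := (@eqm K (mode point) D V h).
Local Notation sc := (@sc K (mode point) D V).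
Local Notation S := (@sym K (mode point) D).
Local Notation has_symbol := (@has_symbol K (mode point) D V h vac).
Local Notation null := (\0 : {additive K -> K}).

Hypothesis comm : forall g k v,
  lt g *: (lt k *: v) = lt k *: (lt g *: v) + sc h (beta g k *: v).
Hypothesis gen : forall v, exists x : D, v = x *: vac.
Hypothesis annv : forall g, annihilator g -> lt g *: vac = 0.

Variable flow : point -> 'I_3 -> 'I_3 -> int -> int -> nat -> D.
Hypothesis flowE : forall u a b r s j, flow u a b r s j =
  \sum_k c (sl2f R a b k) *: lt (Imode u k j (r + s))
  - (h * s%:~R * ((a == b) && (r + s == 0))%:R) *: lt (Kmode u j).

Hypothesis beta_same : forall u a p r b q s,
  beta (Imode u a p r) (Imode u b q s)
  = (- c ((p`! * q`!)%:R / (p + q).+1`!%:R)) *: flow u a b r s (p + q).+1.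
Hypothesis beta_zw : forall a p r b q s,
  beta (Imode ptz a p r) (Imode ptw b q s) =
  (\sum_(j < p.+1) ((-1) ^+ (p.+1 - j) * ('C(p, j) * (p + q - j)`!)%:R
      * X ^+ ((p + q).+1 - j)) *: flow ptz a b r s j)
  - (\sum_(j < q.+1) ((-1) ^+ p.+1 * ('C(q, j) * (p + q - j)`!)%:R
      * X ^+ ((p + q).+1 - j)) *: flow ptw a b r s j).
Hypothesis beta_wz : forall a p r b q s,
  beta (Imode ptw a p r) (Imode ptz b q s) = - beta (Imode ptz b q s) (Imode ptw a p r).
Hypothesis betaIK : forall g v q, beta g (Kmode v q) = 0.

Lemma divK n : exists d : K, n.+1%:R * d = 1.
Proof.
exists (c n.+1%:R^-1); rewrite -(rmorph_nat c) -rmorphM mulfV ?rmorph1 //.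
by rewrite pnatr_eq0.
Qed.

(** The symbols are written in the variables a = I_{-1}(z), b = I_{-1}(w), with
    a1, b1 the variables of the modes with a prime, a2, b2 those of I_{-2}, and a12
    that of I_{-2} with a prime; [cX] is (z - w)^-1 and [level v] is k(v). *)
Definition cc : {rmorphism R[i] -> comalg D} := (csc D \o c).
Definition cX : comalg D := csc D X.
Definition vec u p (r : int) (i : 'I_3) : comalg D := cvar D (Imode u i p r).
Definition phi : comalg D := cc ('i * sqrtC 2).

Lemma phi_sqr : phi * phi = - 2.
Proof.
rewrite /phi -rmorphM mulrACA -[_ * _]/('i ^+ 2 * sqrtC 2 ^+ 2) sqrCi sqrtCK.
by rewrite mulN1r rmorphN /= !rmorph_nat.
Qed.

Lemma cc_sl2f a b k : cc (sl2f R a b k) = phi * eps (comalg D) a b k.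
Proof. by rewrite /sl2f rmorphM rmorph_int. Qed.

Lemma csc_sl2f a b k : csc D (c (sl2f R a b k)) = phi * eps (comalg D) a b k.
Proof. exact: cc_sl2f. Qed.

Lemma sym_flow u a b (r s : int) j : r + s != 0 ->
  S (flow u a b r s j) = str phi (vec u j (r + s)) a b.
Proof.
move=> rs; rewrite flowE (negbTE rs) andbF mulr0 scale0r subr0 sym_sum.
by apply: eq_bigr => k _; rewrite symZ csc_sl2f.
Qed.

Lemma beta_zw00 a r b s : beta (Imode ptz a 0 r) (Imode ptw b 0 s)
  = X *: (flow ptw a b r s 0 - flow ptz a b r s 0).
Proof.
rewrite beta_zw !big_ord_recl !big_ord0 !addr0 /= !subn0 !bin0 !addn0 fact0 muln1.
by rewrite !expr1 !mulr1 mulN1r !scaleNr opprK [LHS]addrC -scalerBr.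
Qed.

Lemma sym_beta_zw00 a r b s : r + s != 0 ->
  S (beta (Imode ptz a 0 r) (Imode ptw b 0 s))
  = cX * (str phi (vec ptw 0 (r + s)) a b - str phi (vec ptz 0 (r + s)) a b).
Proof. by move=> rs; rewrite beta_zw00 symZ symB !sym_flow. Qed.

Lemma sym_beta_same00 u a r b s : r + s != 0 ->
  S (beta (Imode u a 0 r) (Imode u b 0 s)) = - str phi (vec u 1 (r + s)) a b.
Proof.
move=> rs; rewrite beta_same symZ sym_flow // fact0 muln1 divr1 rmorph1 rmorphN rmorph1.
by rewrite mulN1r.
Qed.

Lemma sym_beta_zw10 a r b s : r + s != 0 ->
  S (beta (Imode ptz a 1 r) (Imode ptw b 0 s))
  = cX ^+ 2 * (str phi (vec ptz 0 (r + s)) a b - str phi (vec ptw 0 (r + s)) a b)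
    - cX * str phi (vec ptz 1 (r + s)) a b.
Proof.
move=> rs; rewrite beta_zw !big_ord_recl !big_ord0 /= /bump /= !addr0 symB symD !symZ.
rewrite !sym_flow // !subn0 !subSS !subn0 !bin0 !bin1 /cX.
move: (str phi _ a b) (str phi _ a b) (str phi _ a b) => e1 e2 e3.
rewrite !(mul1n, addn0, add0n, factS, fact0, muln1).
by rewrite !rmorphM !rmorphXn /= !rmorphN !rmorph1; ring.
Qed.

Lemma sym_beta_zw01 a r b s : r + s != 0 ->
  S (beta (Imode ptz a 0 r) (Imode ptw b 1 s))
  = cX ^+ 2 * (str phi (vec ptw 0 (r + s)) a b - str phi (vec ptz 0 (r + s)) a b)
    + cX * str phi (vec ptw 1 (r + s)) a b.
Proof.
move=> rs; rewrite beta_zw !big_ord_recl !big_ord0 /= /bump /= !addr0 symB symD !symZ.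
rewrite !sym_flow // !subn0 !subSS !subn0 !bin0 !bin1 /cX.
move: (str phi _ a b) (str phi _ a b) (str phi _ a b) => e1 e2 e3.
rewrite !(mul1n, addn0, add0n, factS, fact0, muln1).
by rewrite !rmorphM !rmorphXn /= !rmorphN !rmorph1; ring.
Qed.

Local Notation Isp := (@Ispan K point D).
Local Notation Ksp := (@Kspan K point D).

(** The bracket has the shape that the mode estimates require: an I of mode r + s
    and, for r + s = 0, a central term with an additional factor h. *)
Lemma flow_span u a b (r s : int) j (d : K) : exists x y,
  [/\ Isp (r + s) x, Ksp y &
   d *: flow u a b r s j = x + (h * s%:~R * (r + s == 0)%:R) *: y].
Proof.
exists (d *: \sum_k c (sl2f R a b k) *: lt (Imode u k j (r + s))).
exists ((- d * (a == b)%:R) *: lt (Kmode u j)); split.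
- rewrite scaler_sumr; elim/big_ind: _ => [|x y|k _]; first exact: Ispan0.
    exact: IspanD.
  by rewrite scalerA; exact: IspanZ.
- exact: KspanZ.
rewrite flowE scalerBr !scalerA -scaleNr; congr (_ + _ *: _).
by case: (a == b) => /=; rewrite ?mulr0 ?mul0r ?mulr1 ?mulr0 ?oppr0 //; ring.
Qed.

Lemma span_add (r s : int) e x' : 
  (exists x y, [/\ Isp r x, Ksp y & e = x + (h * s%:~R * (r == 0)%:R) *: y]) ->
  (exists x y, [/\ Isp r x, Ksp y & x' = x + (h * s%:~R * (r == 0)%:R) *: y]) ->
  exists x y, [/\ Isp r x, Ksp y & e + x' = x + (h * s%:~R * (r == 0)%:R) *: y].
Proof.
move=> [x1 [y1 [a1 b1 ->]]] [x2 [y2 [a2 b2 ->]]]; exists (x1 + x2), (y1 + y2).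
by split; [exact: IspanD|exact: KspanD|rewrite scalerDr addrACA].
Qed.

Lemma betaII u a p r v b q s : exists x y,
  [/\ Isp (r + s) x, Ksp y &
  beta (Imode u a p r) (Imode v b q s) =
    x + (h * s%:~R * (r + s == 0)%:R) *: y].
Proof.
have zw a' p' (r' : int) b' q' (s' : int) : exists x y, [/\ Isp (r' + s') x, Ksp y &
    beta (Imode ptz a' p' r') (Imode ptw b' q' s')
    = x + (h * s'%:~R * (r' + s' == 0)%:R) *: y].
  have sums w k (d : 'I_k -> K) : exists x y, [/\ Isp (r' + s') x, Ksp y &
      \sum_(j < k) d j *: flow w a' b' r' s' j
      = x + (h * s'%:~R * (r' + s' == 0)%:R) *: y].
    elim/big_ind: _ => [|e x'|j _]; last exact: flow_span.
      by exists 0, 0; split; [exact: Ispan0|exact: Kspan0|rewrite scaler0 addr0].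
    exact: span_add.
  rewrite beta_zw; apply: span_add; first exact: sums.
  rewrite -sumrN (eq_bigr _ (fun j _ => esym (scaleNr _ _))); exact: sums.
case: u v => [] []; try (by rewrite beta_same; exact: flow_span); first exact: zw.
have [x [y [hx hy E]]] := zw b q s a p r; rewrite beta_wz E.
exists ((-1) *: x), y; split=> //; last first.
  rewrite opprD scaleN1r -scaleNr [s + r]addrC; congr (_ + _ *: _).
  have [/eqP|_] := eqVneq (r + s) 0; last by rewrite !mulr0 oppr0.
  by rewrite addr_eq0 => /eqP ->; rewrite mulrNz !mulr1 mulrN opprK.
rewrite addrC; elim: hx => [|x1 x2 _ h1 _ h2|d w i t].
- by rewrite scaler0; exact: Ispan0.
- by rewrite scalerDr; exact: IspanD.
- by rewrite scalerA; exact: IspanZ.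
Qed.

(** ** Symmetric tensors of modes *)

Local Notation t := (@sym_delta R).
Local Notation ad := (@ad K (mode point) D beta).
Local Notation cad g := (@comder K (mode point) D null (beta g)).
Local Notation field_mode := (@field_mode K point D).
Local Notation field_word := (@field_word K point D).
Local Notation trans := (@trans K point D).

Definition point_field u a : point * 'I_3 * nat := (u, a, 0%N).
Definition point_word u (s : seq 'I_3) : D := field_word [seq point_field u a | a <- s].
(** Words in the I_{-1}(u) contracted with a symmetric tensor; in [tensor1] and
    [tensor2] one or two indices of t are left free. *)
Definition tensor u n (tau : seq 'I_3 -> R[i]) : D :=
  tsum n (fun s => c (tau s) *: point_word u s).
Definition tensor1 u n a : D := tensor u n (fun s => t (a :: s)).
Definition tensor2 u n a b : D := tensor u n (fun s => t [:: a, b & s]).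
Local Notation pt u := (vec u 0 (-1)).

Lemma point_word_cons u a s : point_word u (a :: s) = lt (Imode u a 0 (-1)) * point_word u s.
Proof. exact: field_word_cons. Qed.

Lemma point_word_letters u s : point_word u s = \prod_(g <- [seq Imode u a 0 (-1) | a <- s]) lt g.
Proof. by elim: s => [|a s IH]; rewrite ?big_nil /point_word ?field_word_nil //= big_cons -IH field_word_cons. Qed.

Lemma sym_point_word u s : S (point_word u s) = xprod (pt u) s.
Proof.
elim: s => [|a s IH]; first by rewrite /point_word field_word_nil sym1 xprod_nil.
by rewrite point_word_cons symM IH xprod_cons.
Qed.

Lemma sym_tensor u n tau : S (tensor u n tau) = tsum n (fun s => cc (tau s) * xprod (pt u) s).
Proof. by rewrite /tensor sym_sum; apply: eq_bigr => s _; rewrite symZ sym_point_word. Qed.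

Lemma sym_tensor0 u N : S (tensor u (2 * N).+2 t) = norm2 (pt u) ^+ N.+1.
Proof.
rewrite sym_tensor (_ : (2 * N).+2 = (2 * N.+1)%N); last by rewrite mulnS.
exact: sym_contract.
Qed.
Lemma sym_tensor1 u N a : S (tensor1 u (2 * N).+1 a) = pt u a * norm2 (pt u) ^+ N.
Proof. by rewrite sym_tensor; exact: sym_contract1. Qed.
Lemma sym_tensor2 u N a b : S (tensor2 u (2 * N) a b) *+ (2 * N).+1
  = (a == b)%:R * norm2 (pt u) ^+ N + pt u a * pt u b * norm2 (pt u) ^+ N.-1 *+ (2 * N).
Proof. by rewrite sym_tensor; exact: sym_contract2. Qed.

Lemma sym_delta_cons_perm a s s' : perm_eq s s' -> t (a :: s) = t (a :: s').
Proof. by move=> H; apply: sym_delta_perm; rewrite perm_cons. Qed.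

Lemma tsum_rev (W : zmodType) n (F : seq 'I_3 -> W) : tsum n F = tsum n (fun s => F (rev s)).
Proof.
rewrite /tsum (reindex_inj (h := fun s : n.-tuple 'I_3 => [tuple of rev s])) //=.
by move=> x y /(congr1 val) /= /(congr1 rev); rewrite !revK => /val_inj.
Qed.

Lemma rev_tensor u n tau : (forall s, tau (rev s) = tau s) ->
  fd_rev (tensor u n tau) = tensor u n tau.
Proof.
move=> ht; rewrite [RHS]tsum_rev /tensor.
rewrite (big_morph _ (fd_revD (f := D)) (fd_rev0 D)); apply: eq_bigr => s _.
by rewrite fd_revZ ht !point_word_letters fd_rev_word map_rev.
Qed.

Lemma rev_tensor0 u n : fd_rev (tensor u n t) = tensor u n t.
Proof. by apply: rev_tensor => s; apply: sym_delta_perm; rewrite perm_rev. Qed.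
Lemma rev_tensor1 u n a : fd_rev (tensor1 u n a) = tensor1 u n a.
Proof. by apply: rev_tensor => s; apply: sym_delta_cons_perm; rewrite perm_rev. Qed.

Lemma rev_Ispan r x : Isp r x -> fd_rev x = x.
Proof.
elim=> {x} [|x y _ hx _ hy|d u a p]; first exact: fd_rev0.
  by rewrite fd_revD hx hy.
by rewrite fd_revZ fd_rev_letter.
Qed.
Lemma rev_Kspan x : Ksp x -> fd_rev x = x.
Proof.
elim=> {x} [|x y _ hx _ hy|d u p]; first exact: fd_rev0.
  by rewrite fd_revD hx hy.
by rewrite fd_revZ fd_rev_letter.
Qed.
Lemma rev_beta u a p r g : fd_rev (beta (Imode u a p r) g) = beta (Imode u a p r) g.
Proof.
case: g => [v b q s|v q]; last by rewrite betaIK (fd_rev0 D).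
have [x [y [hx hy ->]]] := betaII u a p r v b q s.
by rewrite fd_revD fd_revZ (rev_Ispan hx) (rev_Kspan hy).
Qed.
Lemma rev_ad u a p r x : fd_rev x = x -> fd_rev (ad (Imode u a p r) x) = ad (Imode u a p r) x.
Proof. by move=> hx; rewrite fd_rev_der ?hx // => k; exact: rev_beta. Qed.

Lemma tensor_pull1 u n tau (y : 'I_3 -> D) :
  (forall s s', perm_eq s s' -> tau s = tau s') ->
  tsum n.+1 (fun s => c (tau s) *: pull1 (fun i s' => point_word u s' * y i) s)
  = (\sum_i tensor u n (fun s => tau (i :: s)) * y i) *+ n.+1.
Proof.
move=> tp; rewrite (tsum_pull1 _ (W := fun s x => c (tau s) *: x)) => [|s|s x z|s s' x ss'].
- congr (_ *+ _); apply: eq_bigr => i _; rewrite /tensor /tsum mulr_suml.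
  by apply: eq_bigr => s _; rewrite scalerAl.
- exact: scaler0.
- exact: scalerDr.
- by rewrite (tp _ _ ss').
Qed.

Lemma pull1_map (A B : Type) (W : zmodType) (f : A -> B) (F : B -> seq B -> W) s :
  pull1 F [seq f a | a <- s] = pull1 (fun a s' => F (f a) [seq f a | a <- s']) s.
Proof. by elim: s F => //= a s IH F; rewrite IH. Qed.
Lemma pull2_map (A B : Type) (W : zmodType) (f : A -> B) (F : B -> B -> seq B -> W) s :
  pull2 F [seq f a | a <- s] = pull2 (fun a b s' => F (f a) (f b) [seq f a | a <- s']) s.
Proof. by elim: s F => //= a s IH F; rewrite IH pull1_map. Qed.

Lemma sc_state d (x : D) : sc d (x *: vac) = (d *: x) *: vac.
Proof. exact: scE. Qed.

(** By symmetry of t each letter of the word contributes the same commutator. *)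
Lemma commutator_tensor1 M a (y : D) :
  has_symbol 1 ((tensor1 ptz (2 * M).+1 a * y - y * tensor1 ptz (2 * M).+1 a) *: vac)
    ((\sum_i S (tensor2 ptz (2 * M) a i) * cad (Imode ptz i 0 (-1)) (S y)) *+ (2 * M).+1).
Proof.
have -> : (tensor1 ptz (2 * M).+1 a * y - y * tensor1 ptz (2 * M).+1 a) *: vac
  = tsum (2 * M).+1 (fun s => sc (c (t (a :: s))) ((point_word ptz s * y - y * point_word ptz s) *: vac)).
  rewrite /tensor1 /tensor /tsum mulr_suml mulr_sumr -sumrB scaler_suml.
  by apply: eq_bigr => s _; rewrite scE -scalerAl -scalerAr -scalerBr.
exists ((\sum_i tensor2 ptz (2 * M) a i * ad (Imode ptz i 0 (-1)) y) *+ (2 * M).+1); last first.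
  rewrite rmorphMn /=; congr (_ *+ _); rewrite sym_sum; apply: eq_bigr => i _.
  by rewrite symM sym_ad.
rewrite -(tensor_pull1 (tau := fun s => t (a :: s)) _ _) => [|s s' ss']; last first.
  exact: sym_delta_cons_perm.
rewrite /tsum scaler_suml expr1 sc_sumr; apply: eqm_sum => s _.
rewrite -scE scA mulrC -scA; apply: eqm_scc.
rewrite point_word_letters; apply: eqm_trans (commutator_word comm _ _ _) _.
apply: eqm_eq; congr (sc h (_ *: _)); rewrite pull1_map.
by apply: eq_pull1 => i s'; rewrite point_word_letters.
Qed.

(** ** The leading terms *)

Lemma eq_has_symbol k v p q : p = q -> has_symbol k v p -> has_symbol k v q.
Proof. by move=> ->. Qed.

Lemma cad_derivation g : derivation (cad g).
Proof. exact: comder_derivation (@null_derM K). Qed.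

Lemma cad_csc g d : cad g (csc D d) = 0.
Proof. by rewrite comder_csc ?rmorph0 //; exact: null_derM. Qed.
Lemma cad_phi g : cad g phi = 0. Proof. exact: cad_csc. Qed.
Lemma cad_var g u a p r : cad g (vec u p r a) = S (beta g (Imode u a p r)).
Proof. by rewrite /vec comder_var //; exact: null_derM. Qed.

(** The zero mode I_0(z) rotates b along [qv] and [qv] along [rv]; the mode
    I_{-1}(z) rotates b along [pv] and [qv] along [rmv]. *)
Definition qv i : comalg D := cX * (pt ptw i - pt ptz i).
Definition pv i : comalg D := cX * (vec ptw 0 (-2) i - vec ptz 0 (-2) i).
Definition rv i : comalg D := cX * (qv i + vec ptz 1 (-1) i).
Definition rmv i : comalg D := cX * (pv i + vec ptz 1 (-2) i).

Lemma cad0_w a j : cad (Imode ptz a 0 0) (pt ptw j) = str phi qv a j.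
Proof. by rewrite cad_var sym_beta_zw00 // strZ strB. Qed.
Lemma cad0_z a j : cad (Imode ptz a 0 0) (pt ptz j) = - str phi (vec ptz 1 (-1)) a j.
Proof. by rewrite cad_var sym_beta_same00. Qed.
Lemma cadm_w a j : cad (Imode ptz a 0 (-1)) (pt ptw j) = str phi pv a j.
Proof. by rewrite cad_var sym_beta_zw00 // strZ strB. Qed.
Lemma cadm_z a j : cad (Imode ptz a 0 (-1)) (pt ptz j) = - str phi (vec ptz 1 (-2)) a j.
Proof. by rewrite cad_var sym_beta_same00. Qed.
Lemma cad0_q a k : cad (Imode ptz a 0 0) (qv k) = str phi rv a k.
Proof.
have hd := cad_derivation (Imode ptz a 0 0).
rewrite (derM hd) cad_csc mul0r add0r (derB hd) cad0_w cad0_z opprK.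
by rewrite [RHS]strZ strD.
Qed.
Lemma cadm_q a k : cad (Imode ptz a 0 (-1)) (qv k) = str phi rmv a k.
Proof.
have hd := cad_derivation (Imode ptz a 0 (-1)).
rewrite (derM hd) cad_csc mul0r add0r (derB hd) cadm_w cadm_z opprK.
by rewrite [RHS]strZ strD.
Qed.

Local Notation b := (pt ptw).
Local Notation a := (pt ptz).

Lemma cad0_norm i N : cad (Imode ptz i 0 0) (norm2 b ^+ N)
  = (norm2 b ^+ N.-1 * \sum_j b j * str phi qv i j) *+ 2 *+ N.
Proof.
rewrite (der_norm2X (cad_derivation _)); congr (_ * _ *+ _ *+ _).
by apply: eq_bigr => j _; rewrite /= cad0_w.
Qed.

Lemma half : c 2^-1 + c 2^-1 = 1.
Proof.
rewrite -rmorphD -[2^-1 + _]/(2^-1 *+ 2) -[_ *+ 2]mulr_natr mulVf ?rmorph1 //.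
by rewrite pnatr_eq0.
Qed.

(** The coefficient of h vanishes by [str_self].  Both factors are reversal
    invariant, so the coefficient of h ^ 2 is half of a sum of commutators. *)
Lemma single_contraction M N : has_symbol 2
  (\sum_i tensor1 ptz (2 * M).+1 i *:
     (lt (Imode ptz i 0 0) *: (tensor ptw (2 * N).+2 t *: vac)))
  (cc 2^-1 * \sum_i \sum_j
     ((i == j)%:R * norm2 a ^+ M + a i * a j * norm2 a ^+ M.-1 *+ (2 * M))
     * second phi b pv qv rmv N j i).
Proof.
pose y i := ad (Imode ptz i 0 0) (tensor ptw (2 * N).+2 t).
have -> : \sum_i tensor1 ptz (2 * M).+1 i *:
     (lt (Imode ptz i 0 0) *: (tensor ptw (2 * N).+2 t *: vac))
   = sc h (\sum_i (tensor1 ptz (2 * M).+1 i * y i) *: vac).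
  rewrite sc_sumr; apply: eq_bigr => i _.
  by rewrite (ann_state comm annv) // scZ scalerA.
apply: has_symbol_h; apply: (has_symbol_half_commutator comm half) => [i|i||].
- exact: rev_tensor1.
- by apply: rev_ad; exact: rev_tensor0.
- transitivity (norm2 a ^+ M * (norm2 b ^+ N *
     \sum_i a i * \sum_j b j * str phi qv i j) *+ 2 *+ N.+1); last first.
    by rewrite str_self !mulr0 !mul0rn.
  rewrite !mulr_sumr -!sumrMnl; apply: eq_bigr => i _.
  rewrite sym_ad sym_tensor1 sym_tensor0 cad0_norm /= -[in LHS]mulrA !mulrnAr.
  by congr (_ *+ _ *+ _); ring.
apply: eq_has_symbol; last first.
  by apply: has_symbol_sum => i _; exact: commutator_tensor1.
apply: eq_bigr => i _; rewrite -sumrMnl; apply: eq_bigr => j _.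
rewrite -[LHS]mulrnAl sym_tensor2 /y sym_ad sym_tensor0; congr (_ * _).
refine (second_derivative _ (cad_derivation (Imode ptz i 0 0))
  (cad_derivation (Imode ptz j 0 (-1))) _ _ _ _).
- exact: cad_phi.
- by move=> k; exact: cad0_w.
- by move=> k; exact: cadm_w.
- by move=> k; exact: cadm_q.
Qed.

Local Notation tcoef := (@translate_coef K point).
Local Notation cT := (@comder K (mode point) D null
  (fun g => tcoef g *: lt (translate_mode g))).

Lemma cT_derivation : derivation cT.
Proof. exact: comder_derivation (@null_derM K). Qed.
Lemma sym_trans x : S (trans x) = cT (S x).
Proof. by rewrite comderE //; exact: null_derM. Qed.

(** Two zero modes already give h ^ 2, so only classical brackets enter. *)
Lemma double_contraction M N : has_symbol 2
  ((\sum_i \sum_j trans (tensor2 ptz (2 * M) i j) *: (lt (Imode ptz j 0 0) *: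
     (lt (Imode ptz i 0 0) *: (tensor ptw (2 * N).+2 t *: vac)))) *+ (2 * M).+1)
  (\sum_i \sum_j
     cT ((i == j)%:R * norm2 a ^+ M + a i * a j * norm2 a ^+ M.-1 *+ (2 * M))
     * second phi b qv qv rv N j i).
Proof.
rewrite -sumrMnl; apply: has_symbol_sum => i _.
rewrite -sumrMnl; apply: has_symbol_sum => j _.
have H : has_symbol 2 (lt (Imode ptz j 0 0) *:
     (lt (Imode ptz i 0 0) *: (tensor ptw (2 * N).+2 t *: vac))) (second phi b qv qv rv N j i).
  rewrite (ann_state comm annv) // scZ (ann_state comm annv) //.
  do 2 apply: has_symbol_h; apply: eq_has_symbol (has_symbol_state _ _ _).
  rewrite !sym_ad sym_tensor0.
  refine (second_derivative _ (cad_derivation (Imode ptz i 0 0))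
    (cad_derivation (Imode ptz j 0 0)) _ _ _ _).
  - exact: cad_phi.
  - by move=> k; exact: cad0_w.
  - by move=> k; exact: cad0_w.
  - by move=> k; exact: cad0_q.
apply: eq_has_symbol (has_symbolMn _ (has_symbolZ _ H)).
by rewrite sym_trans -[LHS]mulrnAl -(derMn cT_derivation) sym_tensor2.
Qed.

(** The classical part of I_1(z) acting on two letters I^j_{-1}(w), I^k_{-1}(w):
    the first bracket produces zero modes at z and at w, which act on the second. *)
Definition pair_symbol i j k : comalg D :=
  cX * \sum_l phi * eps (comalg D) i j l
    * - (str phi (vec ptw 1 (-1)) l k + str phi qv l k).

(** The central part of I_1(z) acting on one letter. *)
Definition level_gap : comalg D := cX * (cvar D (Kmode ptw 0) - cvar D (Kmode ptz 0)).

Lemma pull1_sumMl (A : Type) (B : pzRingType) n (x : 'I_n -> B) (F : 'I_n -> A -> seq A -> B) s :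
  \sum_l x l * pull1 (F l) s = pull1 (fun k r => \sum_l x l * F l k r) s.
Proof.
elim: s F => [|k s IH] F /=; first by rewrite big1 // => l _; rewrite mulr0.
by rewrite -IH -big_split; apply: eq_bigr => l _; rewrite mulrDr.
Qed.

(** Both parts of the current of mode 0 carry a factor h here: its zero modes act on
    a word by commutators, and its central term has the factor explicitly. *)
Lemma flow_double u i j s : flow u i j 1 (-1) 0 *: (point_word ptw s *: vac)
  = sc h ((\sum_l c (sl2f R i j l) *: ad (Imode u l 0 0) (point_word ptw s)
           + (i == j)%:R *: (lt (Kmode u 0) * point_word ptw s)) *: vac).
Proof.
rewrite flowE scalerBl scalerDl scDr; congr (_ + _).
  rewrite !scaler_suml sc_sumr; apply: eq_bigr => l _.
  by rewrite -scE (ann_state comm annv) // -sc_state !scA mulrC.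
rewrite -!scE -scNl scalerA scA; congr (sc _ _).
by rewrite eqxx andbT !rmorphN rmorph1 mulrN1 mulNr opprK.
Qed.

(** The first bracket comes with I_0(w) - I_0(z), so only this difference is
    needed. *)
Lemma sym_adjoint_diff l s :
  S (ad (Imode ptw l 0 0) (point_word ptw s)) - S (ad (Imode ptz l 0 0) (point_word ptw s))
  = pull1 (fun k s' => - (str phi (vec ptw 1 (-1)) l k + str phi qv l k) * xprod b s') s.
Proof.
elim: s => [|k s IH]; first by rewrite /point_word field_word_nil !ad1 sym0 subrr.
rewrite point_word_cons !adM !symD !symM !ad_letter sym_point_word /=.
rewrite sym_beta_same00 // -[S (beta (Imode ptz _ _ _) _)]cad_var cad0_w.
rewrite -(eq_pull1 (G := fun k' r => b k *
  (- (str phi (vec ptw 1 (-1)) l k' + str phi qv l k') * xprod b r))) => [|k' r]; last first.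
  by rewrite xprod_cons mulrCA.
rewrite pull1Ml -IH -[S (lt _)]/(b k).
move: (S _) (S _) (xprod _ _) (str _ _ _ _) (str _ _ _ _) => x1 x2 x3 x4 x5.
ring.
Qed.

(** I_1(z) annihilates the vacuum; moving it to the right it either meets the
    central term of one letter or is lowered to a zero mode by one letter, which then
    acts on the letters to the right. *)
Lemma double_pole i s : exists2 L : D,
  lt (Imode ptz i 0 1) *: (point_word ptw s *: vac) = sc (h ^+ 2) (L *: vac)
  & S L = pull1 (fun j s' => (i == j)%:R * level_gap * xprod b s') s
          + pull2 (fun j k s' => pair_symbol i j k * xprod b s') s.
Proof.
elim: s => [|j s [L HL SL]].
  exists 0; last by rewrite /= addr0 sym0.
  by rewrite /point_word field_word_nil scale1r annv // scale0r sc0r.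
pose M u := \sum_l c (sl2f R i j l) *: ad (Imode u l 0 0) (point_word ptw s)
           + (i == j)%:R *: (lt (Kmode u 0) * point_word ptw s).
exists (lt (Imode ptw j 0 (-1)) * L + X *: (M ptw - M ptz)).
  rewrite point_word_cons -scalerA comm HL beta_zw00 scalerDl scDr scZ scalerA.
  by rewrite -!scE scalerBl !flow_double -scBr -scalerBl !scA mulrC expr2 mulrAC mulrC.
rewrite symD symM SL symZ symB !symD !symZ !symM !sym_sum.
rewrite (pull1_cons _ j s) (pull2_cons _ j s).
have -> : pull1 (fun j' r => (i == j')%:R * level_gap * xprod b (j :: r)) s
    = b j * pull1 (fun j' r => (i == j')%:R * level_gap * xprod b r) s.
  by rewrite -pull1Ml; apply: eq_pull1 => j' r; rewrite xprod_cons mulrCA.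
have -> : pull2 (fun j' k r => pair_symbol i j' k * xprod b (j :: r)) s
    = b j * pull2 (fun j' k r => pair_symbol i j' k * xprod b r) s.
  by rewrite -pull2Ml; apply: eq_pull2 => j' k r; rewrite xprod_cons mulrCA.
have -> : pull1 (fun k s' => pair_symbol i j k * xprod b s') s
  = cX * (\sum_l phi * eps (comalg D) i j l *
     (S (ad (Imode ptw l 0 0) (point_word ptw s)) - S (ad (Imode ptz l 0 0) (point_word ptw s)))).
  under [in RHS]eq_bigr do rewrite sym_adjoint_diff.
  rewrite pull1_sumMl -pull1Ml; apply: eq_pull1 => k r.
  rewrite /pair_symbol -mulrA mulr_suml; congr (_ * _).
  by apply: eq_bigr => l _; rewrite mulrA.
under eq_bigr do rewrite symZ csc_sl2f.
under [X in _ + _ * (_ - (X + _))]eq_bigr do rewrite symZ csc_sl2f.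
under [in RHS]eq_bigr do rewrite mulrBr.
rewrite sumrB !sym_point_word !rmorph_nat -[S (lt (Imode _ _ _ _))]/(b j).
rewrite -/(cvar D (Kmode ptw 0)) -/(cvar D (Kmode ptz 0)) /cX.
move: (pull1 _ s) (pull2 _ s) => p1 p2; rewrite /level_gap /cX.
move: (\sum_l _) (\sum_l _) (xprod _ _) (cvar _ _) (cvar _ _) (b j) => *.
ring.
Qed.

Lemma bin2_double N : 'C((2 * N).+2, 2) = ((2 * N).+1 * N.+1)%N.
Proof.
have E : ((2 * N).+2 = (N.+1).*2)%N by rewrite mul2n doubleS.
by rewrite bin2 {1}E -doubleMl doubleK mulnC.
Qed.

Definition pole_symbol N i : comalg D :=
  (level_gap * (b i * norm2 b ^+ N)) *+ (2 * N).+2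
  + (\sum_j \sum_k pair_symbol i j k *
      ((j == k)%:R * norm2 b ^+ N + b j * b k * norm2 b ^+ N.-1 *+ (2 * N))) *+ N.+1.

Lemma cc_weight tau (hp : forall s s', perm_eq s s' -> tau s = tau s') :
  [/\ forall s, cc (tau s) * 0 = 0,
      forall s x y, cc (tau s) * (x + y) = cc (tau s) * x + cc (tau s) * y &
      forall (s s' : seq 'I_3) x, perm_eq s s' -> cc (tau s) * x = cc (tau s') * x].
Proof.
split=> [s|s x y|s s' x /hp -> //]; [exact: mulr0|exact: mulrDr].
Qed.

Lemma has_symbol_double_pole N i :
  has_symbol 2 (lt (Imode ptz i 0 1) *: (tensor ptw (2 * N).+2 t *: vac)) (pole_symbol N i).
Proof.
have -> : lt (Imode ptz i 0 1) *: (tensor ptw (2 * N).+2 t *: vac)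
  = tsum (2 * N).+2 (fun s => sc (c (t s)) (lt (Imode ptz i 0 1) *: (point_word ptw s *: vac))).
  rewrite /tensor /tsum scaler_suml scaler_sumr; apply: eq_bigr => s _.
  by rewrite -scE scZ.
apply: eq_has_symbol; last first.
  apply: has_symbol_sum => s _; apply: has_symbol_sc.
  have [L -> SL] := double_pole i s.
  by exists L; [exact: eqm_refl|exact: SL].
have [W0 WD Wp] := cc_weight (@sym_delta_perm R).
transitivity (tsum (2 * N).+2 (fun s => cc (t s) * pull1 (fun j s' => (i == j)%:R * level_gap * xprod b s') s
   + cc (t s) * pull2 (fun j k s' => pair_symbol i j k * xprod b s') s)).
  by apply: eq_bigr => s _; rewrite -mulrDr.
rewrite tsumD (tsum_pull1 _ _ W0 WD Wp) (tsum_pull2 _ _ W0 WD Wp) bin2_double mulrnA.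
rewrite /pole_symbol; congr (_ *+ _ + _ *+ _).
  rewrite (bigD1 i) //= big1 ?addr0 => [|j ji]; last first.
    by rewrite /tsum big1 // => s _; rewrite eq_sym (negbTE ji) !mul0r mulr0.
  rewrite eqxx -sym_tensor1 sym_tensor /tsum mulr_sumr; apply: eq_bigr => s _.
  by rewrite mul1r mulrCA.
rewrite -sumrMnl; apply: eq_bigr => j _; rewrite -sumrMnl; apply: eq_bigr => k _.
rewrite -sym_tensor2 sym_tensor -[LHS]mulr_natr -[in RHS]mulr_natr mulrA; congr (_ * _).
by rewrite /tsum mulr_sumr; apply: eq_bigr => s _; rewrite mulrCA.
Qed.

Lemma pole_contraction M N : has_symbol 2
  (\sum_i trans (tensor1 ptz (2 * M).+1 i) *:
     (lt (Imode ptz i 0 1) *: (tensor ptw (2 * N).+2 t *: vac)))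
  (\sum_i cT (a i * norm2 a ^+ M) * pole_symbol N i).
Proof.
apply: has_symbol_sum => i _; rewrite -sym_tensor1 -sym_trans.
exact/has_symbolZ/has_symbol_double_pole.
Qed.

(** ** Zeroth products *)

Variables (Tv : V -> V) (Y : V -> int -> V -> V).
Hypothesis TvE : forall x : D, Tv (x *: vac) = trans x *: vac.
Hypothesis Ylin_state : forall c X X' r v, Y (sc c X + X') r v = sc c (Y X r v) + Y X' r v.
Hypothesis Ylin : forall X r c v v', Y X r (sc c v + v') = sc c (Y X r v) + Y X r v'.
Hypothesis Yfield : forall X v, exists N : int, forall r, N <= r -> Y X r v = 0.
Hypothesis Yvac : forall r v, Y vac r v = if r == -1 then v else 0.
Hypothesis Ygen : forall u a p r v,
  Y (lt (Imode u a p (-1)) *: vac) r v = lt (Imode u a p r) *: v.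
Hypothesis Ycen : forall u p X r v, Y (lt (Kmode u p) *: X) r v = lt (Kmode u p) *: Y X r v.
Hypothesis Ytrans : forall X r v, Y (Tv X) r v = - ((r%:~R : D) *: Y X (r - 1) v).
Hypothesis Yno : forall X X' r v (N : nat),
    (forall j : nat, (N <= j)%N -> Y X j%:Z v = 0 /\ Y X' (r + j%:Z) v = 0) ->
    Y (Y X (-1) X') r v =
      \sum_(j < N) (Y X (- 1 - j%:Z) (Y X' (r + j%:Z) v)
                    + Y X' (r - 1 - j%:Z) (Y X j%:Z v)).

Local Notation U := (@U K point D V vac).
Local Notation Yo1 := (Y_Ok1 comm gen annv divK TvE Ylin_state Ylin Yfield Yvac Ygen Ycen Ytrans Yno).
Local Notation Ystar := (YU_0_3 comm gen annv divK betaII betaIK TvE Ylin_state Ylin Yfield Yvac Ygen Ycen Ytrans Yno).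
Local Notation Yord2 := (Y_0_2 comm gen annv divK TvE Ylin_state Ylin Yfield Yvac Ygen Ycen Ytrans Yno).
Local Notation Ytr2 := (YU_translate_0_2 comm gen annv divK betaII betaIK TvE Ylin_state Ylin Yfield Yvac Ygen Ycen Ytrans Yno).

Lemma U_state_field_word s : U (field_word s *: vac).
Proof.
elim: s => [|f s IH]; first by rewrite field_word_nil scale1r; exact: U_vac.
by rewrite field_word_cons -scalerA; apply: U_I.
Qed.
Lemma U_tensor u n tau : U (tensor u n tau *: vac).
Proof.
rewrite /tensor /tsum scaler_suml; elim/big_ind: _ => [|x y|s _].
- exact: U_0.
- exact: U_D.
- by rewrite -sc_state; apply/U_sc/U_state_field_word.
Qed.

Lemma Y_suml I (r : seq I) (P : pred I) F n v :
  Y (\sum_(i <- r | P i) F i) n v = \sum_(i <- r | P i) Y (F i) n v.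
Proof.
apply: (big_morph (fun X => Y X n v)) => [x y|]; first exact: (YDl Ylin_state).
exact: (Y0l Ylin_state).
Qed.

Lemma Y_tensor u n tau r v :
  Y (tensor u n tau *: vac) r v = tsum n (fun s => sc (c (tau s)) (Y (point_word u s *: vac) r v)).
Proof.
rewrite /tensor /tsum scaler_suml Y_suml; apply: eq_bigr => s _.
by rewrite -sc_state (Yscl Ylin_state).
Qed.

Lemma transD x y : trans (x + y) = trans x + trans y.
Proof. exact: fd_derD. Qed.
Lemma trans_tensor u n tau : trans (tensor u n tau) = tsum n (fun s => c (tau s) *: trans (point_word u s)).
Proof.
rewrite /trans fd_der_sum; apply: eq_bigr => s _.
by rewrite fd_derZ; [rewrite scale0r add0r|exact: null_derM].
Qed.

Lemma scale_weight (tau : seq 'I_3 -> R[i]) (hp : forall s s', perm_eq s s' -> tau s = tau s') :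
  [/\ forall s, c (tau s) *: (0 : D) = 0,
      forall s (x y : D), c (tau s) *: (x + y) = c (tau s) *: x + c (tau s) *: y &
      forall (s s' : seq 'I_3) (x : D), perm_eq s s' -> c (tau s) *: x = c (tau s') *: x].
Proof.
split=> [s|s x y|s s' x /hp -> //]; [exact: scaler0|exact: scalerDr].
Qed.

Lemma tensor_ann1 u n r : tsum n.+1 (fun s => c (t s) *: ann1 D [seq point_field u i | i <- s] r)
  = (\sum_i tensor1 u n i * lt (Imode u i 0 r)) *+ n.+1.
Proof.
rewrite -(tensor_pull1 (tau := t) _ _); last exact: sym_delta_perm.
by apply: eq_bigr => s _; rewrite /ann1 pull1_map.
Qed.
Lemma tensor_dann1 u n r : tsum n.+1 (fun s => c (t s) *: dann1 D [seq point_field u i | i <- s] r)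
  = (\sum_i trans (tensor1 u n i) * lt (Imode u i 0 r)) *+ n.+1.
Proof.
have [W0 WD Wp] := scale_weight (@sym_delta_perm R).
transitivity (tsum n.+1 (fun s => c (t s) *:
    pull1 (fun i s' => trans (point_word u s') * lt (Imode u i 0 r)) s)).
  by apply: eq_bigr => s _; rewrite /dann1 pull1_map.
rewrite (tsum_pull1 _ _ W0 WD Wp); congr (_ *+ _); apply: eq_bigr => i _.
by rewrite trans_tensor /tsum mulr_suml; apply: eq_bigr => s _; rewrite scalerAl.
Qed.
Lemma tensor_dann2 u n : tsum n.+2 (fun s => c (t s) *: dann2 D [seq point_field u i | i <- s])
  = (\sum_i \sum_j trans (tensor2 u n i j) * lt (Imode u j 0 0) * lt (Imode u i 0 0)) *+ 'C(n.+2, 2).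
Proof.
have [W0 WD Wp] := scale_weight (@sym_delta_perm R).
transitivity (tsum n.+2 (fun s => c (t s) *: pull2 (fun i j s' =>
    trans (point_word u s') * lt (Imode u j 0 0) * lt (Imode u i 0 0)) s)).
  by apply: eq_bigr => s _; rewrite /dann2 pull2_map.
rewrite (tsum_pull2 _ _ W0 WD Wp); congr (_ *+ _); apply: eq_bigr => i _.
apply: eq_bigr => j _; rewrite trans_tensor /tsum !mulr_suml.
by apply: eq_bigr => s _; rewrite !scalerAl.
Qed.

Definition leading_symbol M N : comalg D :=
  (cc 2^-1 * \sum_i \sum_j
     ((i == j)%:R * norm2 a ^+ M + a i * a j * norm2 a ^+ M.-1 *+ (2 * M))
     * second phi b pv qv rmv N j i) *+ (2 * M).+2
  + (\sum_i cT (a i * norm2 a ^+ M) * pole_symbol N i) *+ (2 * M).+2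
  + (\sum_i \sum_j
     cT ((i == j)%:R * norm2 a ^+ M + a i * a j * norm2 a ^+ M.-1 *+ (2 * M))
     * second phi b qv qv rv N j i) *+ M.+1.

(** The three contributions are the three contraction terms of [YU_0_3]. *)
Lemma leading_product M N : has_symbol 2
  (Y (tensor ptz (2 * M).+2 t *: vac) 0 (tensor ptw (2 * N).+2 t *: vac)) (leading_symbol M N).
Proof.
set v := tensor ptw _ _ *: vac.
have Uv : U v by exact: U_tensor.
pose th s := ann1 D [seq point_field ptz i | i <- s] 0 + dann1 D [seq point_field ptz i | i <- s] 1
             + dann2 D [seq point_field ptz i | i <- s].
apply: (has_symbol_eqm (w := tsum (2 * M).+2 (fun s => c (t s) *: th s) *: v)).
  rewrite Y_tensor /tsum scaler_suml; apply: eqm_sum => s _.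
  by rewrite -scE; apply: eqm_scc; exact: Ystar.
have -> : tsum (2 * M).+2 (fun s => c (t s) *: th s)
   = tsum (2 * M).+2 (fun s => c (t s) *: ann1 D [seq point_field ptz i | i <- s] 0)
   + tsum (2 * M).+2 (fun s => c (t s) *: dann1 D [seq point_field ptz i | i <- s] 1)
   + tsum (2 * M).+2 (fun s => c (t s) *: dann2 D [seq point_field ptz i | i <- s]).
  by rewrite -!tsumD; apply: eq_bigr => s _; rewrite -!scalerDr.
rewrite tensor_ann1 tensor_dann1 tensor_dann2 2!scalerDl bin2_double mulrnA -!scalerMnl.
apply: has_symbolD; first apply: has_symbolD; apply: has_symbolMn; rewrite scaler_suml.
- apply: has_symbol_eqm (single_contraction M N); apply: eqm_eq; apply: eq_bigr => i _.
  by rewrite scalerA.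
- apply: has_symbol_eqm (pole_contraction M N); apply: eqm_eq; apply: eq_bigr => i _.
  by rewrite -[LHS]scalerA.
apply: has_symbol_eqm (double_contraction M N); apply: eqm_eq; congr (_ *+ _).
apply: eq_bigr => i _; rewrite scaler_suml; apply: eq_bigr => j _.
by rewrite -!scalerA.
Qed.

(** ** The corrections of order h *)

Local Notation symprod := (@symprod R K c point D).
(** The words of the term of order h of a charge; they have 2 L + 3 letters. *)
Definition correction u L : D := tsum (2 * L) (fun s => \sum_i \sum_j \sum_k
  c (t s * sl2f R i j k) *: (lt (Imode u i 0 (-2)) * lt (Imode u j 1 (-1)) * symprod u (k :: s))).

Lemma point_wordE u s : point_word u s = \prod_(x <- s) lt (Imode u x 0 (-1)).
Proof. by rewrite point_word_letters big_map. Qed.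

Lemma symprodE u s : symprod u s = c (size s)`!%:R^-1 *:
  \sum_(sigma : 'S_(size s)) point_word u (permuted sigma).
Proof. by congr (_ *: _); apply: eq_bigr => p _; rewrite point_wordE. Qed.

Section CorrectionLeft.
Variables (y : D).
Hypothesis Uy : U (y *: vac).

(** The derivation that replaces a field I^{a[p]} in a word by the action of its
    zero mode on y: to first order this is the zeroth product of a word with y. *)
Definition field_action (g : mode point) : D :=
  if g is Imode u i p _ then unsym (cad (Imode u i p 0) (S y)) else 0.
Local Notation cE := (@comder K (mode point) D null field_action).

Lemma has_symbol_ann1 s : has_symbol 1 (ann1 D s 0 *: (y *: vac)) (cE (S (field_word s))).
Proof.
have hE : derivation cE by exact: comder_derivation (@null_derM K).
elim: s => [|f s IH].
  by rewrite /ann1 /= scale0r field_word_nil sym1 (der1 hE); exact: has_symbol0.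
rewrite ann1_cons scalerDl -!scalerA field_word_cons symM (derM hE) mulrC.
apply: has_symbolD; last exact: has_symbolZ.
apply: has_symbolZ; rewrite /field_mode (ann_state comm annv) //.
apply: has_symbol_h; apply: eq_has_symbol (has_symbol_state _ _ _).
by rewrite sym_ad -[S (lt _)]/(cvar D _) comder_var /= ?sym_unsym //; exact: null_derM.
Qed.

Lemma correction_word f s : has_symbol 1 (Y ((field_mode f (-2) * field_word s) *: vac) 0 (y *: vac))
  (S (field_mode f (-2)) * cE (S (field_word s)) - cT (S (field_word s)) * cad (Imode f.1.1 f.1.2 f.2 0) (S y)).
Proof.
apply: has_symbol_eqm (Ytr2 f s Uy) _; rewrite scalerBl -!scalerA; apply: has_symbolB.
  exact/has_symbolZ/has_symbol_ann1.
rewrite -sym_trans; apply: has_symbolZ; rewrite /field_mode (ann_state comm annv) //.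
apply: has_symbol_h; apply: eq_has_symbol (has_symbol_state _ _ _).
by rewrite sym_ad.
Qed.

Definition correction_op i (Z : comalg D) : comalg D :=
  vec ptz 0 (-2) i * cE Z - cT Z * cad (Imode ptz i 0 0) (S y).

Lemma correction_left L : has_symbol 1 (Y (correction ptz L *: vac) 0 (y *: vac))
  (\sum_i \sum_j \sum_k phi * eps (comalg D) i j k *
     correction_op i (vec ptz 1 (-1) j * (a k * norm2 a ^+ L))).
Proof.
have hE : derivation cE by exact: comder_derivation (@null_derM K).
have opD i x z : correction_op i (x + z) = correction_op i x + correction_op i z.
  rewrite /correction_op (derD hE) (derD cT_derivation).
  by move: (cE x) (cE z) (cT x) (cT z) (cad _ _) => *; ring.
have op0 i : correction_op i 0 = 0.
  by apply: (addrI (correction_op i 0)); rewrite -opD !addr0.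
have opZ i d x : correction_op i (csc D d * x) = csc D d * correction_op i x.
  rewrite /correction_op (derM hE) (derM cT_derivation) !comder_csc ?rmorph0; try exact: null_derM.
  by ring.
rewrite /correction /tsum scaler_suml Y_suml; apply: eq_has_symbol; last first.
  apply: has_symbol_sum => s _; rewrite scaler_suml Y_suml.
  apply: has_symbol_sum => i _; rewrite scaler_suml Y_suml.
  apply: has_symbol_sum => j _; rewrite scaler_suml Y_suml.
  apply: has_symbol_sum => k _; rewrite symprodE -sc_state (Yscl Ylin_state).
  apply: has_symbol_sc; rewrite -scalerAr -sc_state (Yscl Ylin_state).
  apply: has_symbol_sc; rewrite mulr_sumr scaler_suml Y_suml.
  apply: has_symbol_sum => p _; rewrite -mulrA.
  rewrite -[lt (Imode ptz j 1 (-1)) * point_word _ _](field_word_cons D (ptz, j, 1%N)).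
  exact: (correction_word (ptz, i, 0%N)).
transitivity (\sum_(s : (2 * L).-tuple 'I_3) \sum_i \sum_j \sum_k
   phi * eps (comalg D) i j k * (cc (t s) * correction_op i (vec ptz 1 (-1) j * (a k * xprod a s)))).
  apply: eq_bigr => s _; apply: eq_bigr => i _; apply: eq_bigr => j _; apply: eq_bigr => k _.
  rewrite -[csc D (c (t s * _))]/(cc _) rmorphM /= -[csc D (c (sl2f R i j k))]/(cc _) cc_sl2f.
  rewrite [csc D _ * _]mulrC -!mulrA; congr (_ * (_ * (_ * _))).
  transitivity (csc D (c (size (k :: s))`!%:R^-1) * \sum_(p : 'S_(size (k :: s)))
      correction_op i (vec ptz 1 (-1) j * (a k * xprod a s))).
    congr (_ * _); apply: eq_bigr => p _; rewrite /correction_op field_word_cons symM.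
    rewrite -/(point_word ptz (@permuted (k :: s) p)) sym_point_word.
    by rewrite (xprod_perm a (@permuted_perm (k :: s) p)) xprod_cons.
  rewrite sumr_const card_Sn -[X in _ * X]mulr_natl mulrA -[csc D _]/(cc _) -(rmorph_nat cc).
  by rewrite -rmorphM mulVf ?rmorph1 ?mul1r // pnatr_eq0 -lt0n fact_gt0.
rewrite exchange_big; apply: eq_bigr => i _; rewrite exchange_big; apply: eq_bigr => j _.
rewrite exchange_big; apply: eq_bigr => k _; rewrite -mulr_sumr; congr (_ * _).
rewrite -(sym_contract cc a L) /tsum !mulr_sumr.
rewrite (big_morph (correction_op i) (opD i) (op0 i)); apply: eq_bigr => s _.
by rewrite -opZ; congr (correction_op i _); rewrite /cc /=; ring.
Qed.
End CorrectionLeft.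

Local Notation a1 := (vec ptz 1 (-1)).
Local Notation b1 := (vec ptw 1 (-1)).
Local Notation a2 := (vec ptz 0 (-2)).
Local Notation b2 := (vec ptw 0 (-2)).
Local Notation a12 := (vec ptz 1 (-2)).

Lemma cT_vec u p i : cT (vec u p (-1) i) = vec u p (-2) i.
Proof.
rewrite /vec comder_var; last exact: null_derM.
by rewrite /= opprK scale1r.
Qed.

Definition qv1 i : comalg D := - (cX * (qv i + a1 i)).
Definition rv1 i : comalg D := cX * (qv i + b1 i).

Lemma cad0_b1 i j : cad (Imode ptz i 0 0) (b1 j) = str phi rv1 i j.
Proof.
rewrite cad_var sym_beta_zw01 // strZ strD strZ strB.
by move: (str _ _ _ _) (str _ _ _ _) (str _ _ _ _) => *; ring.
Qed.
Lemma cad1_b i j : cad (Imode ptz i 1 0) (b j) = str phi qv1 i j.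
Proof.
rewrite cad_var sym_beta_zw10 // (_ : str phi qv1 i j = - str phi (fun i => cX * (qv i + a1 i)) i j).
  rewrite strZ strD strZ strB.
  by move: (str _ _ _ _) (str _ _ _ _) (str _ _ _ _) => *; ring.
by rewrite /str -sumrN; apply: eq_bigr => k _; rewrite /qv1 mulrN.
Qed.

Definition fcon (q : 'I_3 -> comalg D) i : comalg D := \sum_j b j * str phi q i j.

Lemma triple_sum u v w :
  \sum_i \sum_j \sum_k phi * eps (comalg D) i j k * (u i * v j * w k) = triple phi u v w.
Proof.
apply: eq_bigr => i _; apply: eq_bigr => j _; rewrite /str mulr_sumr.
by apply: eq_bigr => k _; ring.
Qed.

Definition contract3 (F : 'I_3 -> 'I_3 -> 'I_3 -> comalg D) : comalg D :=
  \sum_i \sum_j \sum_k phi * eps (comalg D) i j k * F i j k.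
Lemma contract3D F G : contract3 (fun i j k => F i j k + G i j k) = contract3 F + contract3 G.
Proof.
rewrite -big_split; apply: eq_bigr => i _; rewrite -big_split; apply: eq_bigr => j _.
by rewrite -big_split; apply: eq_bigr => k _; rewrite /= mulrDr.
Qed.
Lemma contract3Z x F : contract3 (fun i j k => x * F i j k) = x * contract3 F.
Proof.
rewrite mulr_sumr; apply: eq_bigr => i _; rewrite mulr_sumr; apply: eq_bigr => j _.
by rewrite mulr_sumr; apply: eq_bigr => k _; rewrite mulrCA.
Qed.
Lemma contract3B F G : contract3 (fun i j k => F i j k - G i j k) = contract3 F - contract3 G.
Proof.
rewrite -sumrB; apply: eq_bigr => i _; rewrite -sumrB; apply: eq_bigr => j _.
by rewrite -sumrB; apply: eq_bigr => k _; rewrite /= mulrBr.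
Qed.

Definition correction_left_symbol L N : comalg D := (2 * N.+1)%:R * (norm2 b ^+ N *
  (norm2 a ^+ L * (triple phi a2 (fcon qv1) a + triple phi a2 a1 (fcon qv)
     - triple phi (fcon qv) a12 a - triple phi (fcon qv) a1 a2)
   - cT (norm2 a ^+ L) * triple phi (fcon qv) a1 a)).

Lemma mulrn2 (x : comalg D) n : x *+ 2 *+ n = (2 * n)%:R * x.
Proof. by rewrite mulr_natl mulrnA. Qed.

(** In [correction_left] the derivation kills norm2 a ^ L by [str_self], so only
    the three letters of the structure constant contribute. *)
Lemma correction_left_product L N : has_symbol 1
  (Y (correction ptz L *: vac) 0 (tensor ptw (2 * N).+2 t *: vac)) (correction_left_symbol L N).
Proof.
apply: eq_has_symbol (correction_left (U_tensor ptw _ t) L).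
set y := tensor ptw _ t; pose cE := @comder K (mode point) D null (field_action y).
have hE : derivation cE by exact: comder_derivation (@null_derM K).
have hT := cT_derivation.
have [kk kkE] : exists kk : comalg D, (2 * N.+1)%:R = kk by exists (2 * N.+1)%:R.
have E0 i : cad (Imode ptz i 0 0) (S y) = kk * (norm2 b ^+ N * fcon qv i).
  by rewrite sym_tensor0 cad0_norm mulrn2 kkE.
have Ea i : cE (a i) = kk * (norm2 b ^+ N * fcon qv i).
  by rewrite /cE /vec comder_var /= ?sym_unsym ?E0 //; exact: null_derM.
have E1 i : cE (a1 i) = kk * (norm2 b ^+ N * fcon qv1 i).
  rewrite /cE /vec comder_var /= ?sym_unsym; last exact: null_derM.
  rewrite sym_tensor0 (der_norm2X (cad_derivation _)) mulrn2 kkE; congr (_ * (_ * _)).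
  by apply: eq_bigr => j _; rewrite /= cad1_b.
have EL : cE (norm2 a ^+ L) = 0.
  rewrite (der_norm2X hE) (_ : dot _ _ = kk * (norm2 b ^+ N * \sum_i a i * fcon qv i)).
    by rewrite (str_self phi a b) !mulr0 !mul0rn.
  by rewrite !mulr_sumr; apply: eq_bigr => i _; rewrite /= Ea; ring.
transitivity (\sum_i \sum_j \sum_k phi * eps (comalg D) i j k *
   (kk * (norm2 b ^+ N * (norm2 a ^+ L * (a2 i * fcon qv1 j * a k + a2 i * a1 j * fcon qv k
     - fcon qv i * a12 j * a k - fcon qv i * a1 j * a2 k)
     - cT (norm2 a ^+ L) * (fcon qv i * a1 j * a k))))).
  apply: eq_bigr => i _; apply: eq_bigr => j _; apply: eq_bigr => k _; congr (_ * _).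
  rewrite /correction_op E0 -/cE !(derM hE) !(derM hT) EL Ea E1 !cT_vec.
  move: (cT (norm2 a ^+ L)) (fcon qv i) (fcon qv k) (fcon qv1 j) => *.
  move: (norm2 a ^+ L) (norm2 b ^+ N) (a i) (a j) (a k) (a1 j) (a2 i) (a2 k) (a12 j) => *.
  ring.
rewrite -[LHS]/(contract3 (fun i j k => _ * (_ * (_ * (_ i * _ j * _ k + _ i * _ j * _ k - _ i * _ j * _ k - _ i * _ j * _ k) - _ * (_ i * _ j * _ k))))) contract3Z contract3Z contract3B contract3Z contract3Z.
by rewrite !contract3B contract3D /contract3 !triple_sum /correction_left_symbol kkE.
Qed.
Lemma symprod_state_U u s : U (symprod u s *: vac).
Proof.
rewrite symprodE -sc_state; apply: U_sc; rewrite scaler_suml.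
elim/big_ind: _ => [|x y|p _]; [exact: U_0|exact: U_D|exact: U_state_field_word].
Qed.

Definition correction_rest u j k s : D := lt (Imode u j 1 (-1)) * symprod u (k :: s).

Lemma correction_rest_U u j k s : U (correction_rest u j k s *: vac).
Proof. by rewrite -scalerA; apply/U_I/symprod_state_U. Qed.

Lemma correction_state u L : correction u L *: vac = tsum (2 * L) (fun s => \sum_i \sum_j \sum_k
  sc (c (t s * sl2f R i j k)) (lt (Imode u i 0 (-2)) *: (correction_rest u j k s *: vac))).
Proof.
rewrite /correction /tsum scaler_suml; apply: eq_bigr => s _.
rewrite scaler_suml; apply: eq_bigr => i _; rewrite scaler_suml; apply: eq_bigr => j _.
rewrite scaler_suml; apply: eq_bigr => k _.
by rewrite -sc_state /correction_rest !scalerA mulrA.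
Qed.

(** The correction contains I_{-2}, so [U_ann] does not apply; a mode n >= 2 is
    lowered by two, with one factor h, to a mode n - 2 >= 0 that gains another one. *)
Lemma field_mode_m2_Ok f i r (y : D) (n : nat) : U (y *: vac) -> (2 <= n)%N ->
  Ok 2 (field_mode f n%:Z *: (lt (Imode ptw i r (-2)) *: (y *: vac))).
Proof.
move=> Uy hn; rewrite comm; apply: OkD.
  by apply/OkZ/(Ok_le _ (U_annOk comm annv betaII betaIK n f.1.1 f.1.2 f.2 Uy)); rewrite ltnW.
have [x [z [hx hz ->]]] := betaII f.1.1 f.1.2 f.2 n%:Z ptw i r (-2).
have E : n%:Z + - 2 = (n - 2)%:Z by rewrite subzn.
rewrite scalerDl scDr; apply: OkD.
  apply/Ok_sc1; apply: (Ok_le (k := (n - 2).+1)) => //; apply: UO_Ok.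
  apply: Ispan_UO hx => u a' p; rewrite E; exact: (U_ann comm annv betaII betaIK Uy).
by rewrite -scE -mulrA -scA scA -expr2; exists (sc ((-2)%:~R * (n%:Z - 2 == 0)%:R) (z *: (y *: vac))).
Qed.

Lemma correction_field_mode_Ok L f (n : nat) : (2 <= n)%N -> Ok 2 (field_mode f n%:Z *: (correction ptw L *: vac)).
Proof.
move=> hn; rewrite correction_state /tsum scaler_sumr; apply: Ok_sum => s _.
rewrite scaler_sumr; apply: Ok_sum => i _; rewrite scaler_sumr; apply: Ok_sum => j _.
rewrite scaler_sumr; apply: Ok_sum => k _; rewrite scZ; apply: Ok_scc.
exact/field_mode_m2_Ok/hn/correction_rest_U.
Qed.

Lemma sym_correction u L : S (correction u L)
  = norm2 (pt u) ^+ L * triple phi (vec u 0 (-2)) (vec u 1 (-1)) (pt u).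
Proof.
rewrite -(sym_contract cc (pt u) L) /correction /tsum sym_sum mulr_suml.
apply: eq_bigr => s _; rewrite -triple_sum sym_sum !mulr_sumr; apply: eq_bigr => i _.
rewrite sym_sum mulr_sumr; apply: eq_bigr => j _; rewrite sym_sum mulr_sumr.
apply: eq_bigr => k _; rewrite symZ !symM sym_symprod xprod_cons -[csc D _]/(cc _) rmorphM /=.
rewrite -[csc D (c (sl2f R i j k))]/(cc _) cc_sl2f -/(cvar D _) -/(cvar D _).
rewrite /vec /cc /=; ring.
Qed.

(** At first order only I_{-2} can turn I_1 into a negative mode. *)
Lemma correction_pole L i : has_symbol 1 (lt (Imode ptz i 0 1) *: (correction ptw L *: vac))
  (norm2 b ^+ L * triple phi (str phi qv i) b1 b).
Proof.
rewrite correction_state /tsum scaler_sumr.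
apply: (eq_has_symbol (p := \sum_(s : (2 * L).-tuple 'I_3) \sum_j \sum_k \sum_l
   csc D (c (t s * sl2f R j k l)) * (str phi qv i j * (b1 k * xprod b (l :: s))))).
  rewrite -(sym_contract cc b L) /tsum mulr_suml.
  apply: eq_bigr => s _; rewrite -triple_sum !mulr_sumr; apply: eq_bigr => j _.
  rewrite mulr_sumr; apply: eq_bigr => k _; rewrite mulr_sumr; apply: eq_bigr => l _.
  rewrite xprod_cons -[csc D _]/(cc _) rmorphM /= -[csc D (c (sl2f R j k l))]/(cc _) cc_sl2f.
  by rewrite /cc /=; ring.
apply: has_symbol_sum => s _; rewrite scaler_sumr; apply: has_symbol_sum => j _.
rewrite scaler_sumr; apply: has_symbol_sum => k _; rewrite scaler_sumr.
apply: has_symbol_sum => l _; rewrite scZ; apply: has_symbol_sc; rewrite comm.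
rewrite -[X in has_symbol 1 _ X]add0r; apply: has_symbolD.
  apply/has_symbol_Ok/OkZ; exact: (U_annOk comm annv betaII betaIK 1 ptz i 0 (correction_rest_U _ _ _ _)).
apply: has_symbol_h; rewrite scalerA; apply: eq_has_symbol (has_symbol_state _ _ _).
by rewrite symM -[S (beta _ _)]cad_var cad_var sym_beta_zw00 // strZ strB symM sym_symprod.
Qed.

Definition correction_right_symbol M L : comalg D :=
  (norm2 a ^+ M * \sum_i a i * cad (Imode ptz i 0 0)
      (norm2 b ^+ L * triple phi b2 b1 b)
   + \sum_i cT (a i * norm2 a ^+ M) * (norm2 b ^+ L * triple phi (str phi qv i) b1 b))
   *+ (2 * M).+2.

(** Two contraction terms of [Y_0_2] remain, since the correction has a factor h. *)
Lemma correction_right_product M L : has_symbol 1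
  (Y (tensor ptz (2 * M).+2 t *: vac) 0 (correction ptw L *: vac)) (correction_right_symbol M L).
Proof.
set v := correction ptw _ *: vac.
pose th s := ann1 D [seq point_field ptz i | i <- s] 0 + dann1 D [seq point_field ptz i | i <- s] 1.
apply: (has_symbol_eqm (w := tsum (2 * M).+2 (fun s => c (t s) *: th s) *: v)).
  rewrite Y_tensor /tsum scaler_suml; apply: eqm_sum => s _.
  rewrite -scE; apply: eqm_scc; apply: Yord2 => f n; exact: correction_field_mode_Ok.
have -> : tsum (2 * M).+2 (fun s => c (t s) *: th s)
   = tsum (2 * M).+2 (fun s => c (t s) *: ann1 D [seq point_field ptz i | i <- s] 0)
   + tsum (2 * M).+2 (fun s => c (t s) *: dann1 D [seq point_field ptz i | i <- s] 1).
  by rewrite -!tsumD; apply: eq_bigr => s _; rewrite -!scalerDr.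
rewrite tensor_ann1 tensor_dann1 scalerDl -!scalerMnl /correction_right_symbol mulrnDl.
apply: has_symbolD; apply: has_symbolMn; rewrite scaler_suml 1?mulr_sumr;
  apply: has_symbol_sum => i _; rewrite -scalerA.
  apply: eq_has_symbol (has_symbolZ _ _).
    by rewrite sym_tensor1 -mulrA mulrCA; congr (_ * (_ * _)).
  rewrite (ann_state comm annv) //; apply: has_symbol_h.
  apply: eq_has_symbol (has_symbol_state _ _ _); rewrite sym_ad sym_correction.
  by [].
rewrite -sym_tensor1 -sym_trans; exact/has_symbolZ/correction_pole.
Qed.

Local Notation dot := (@dot (comalg D)).

Lemma cT_norm M : cT (norm2 a ^+ M) = (norm2 a ^+ M.-1 * dot a a2) *+ 2 *+ M.
Proof.
rewrite (der_norm2X cT_derivation); congr (_ * _ *+ _ *+ _).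
by apply: eq_bigr => i _; rewrite /= cT_vec.
Qed.

Lemma cT_leg M (v : 'I_3 -> comalg D) : \sum_i cT (a i * norm2 a ^+ M) * v i
  = norm2 a ^+ M * dot a2 v + cT (norm2 a ^+ M) * dot a v.
Proof.
rewrite /dot !mulr_sumr -big_split; apply: eq_bigr => i _.
by rewrite (derM cT_derivation) cT_vec mulrDl /= mulrA [norm2 a ^+ M * _]mulrC mulrAC [a i * _]mulrC -!mulrA.
Qed.

Lemma weighted_diagonal x (w F : 'I_3 -> 'I_3 -> comalg D) :
  \sum_i \sum_j ((i == j)%:R * x + w i j) * F j i
  = x * (\sum_i F i i) + \sum_j \sum_i w i j * F j i.
Proof.
rewrite [X in _ = _ + X]exchange_big mulr_sumr -big_split; apply: eq_bigr => i _ /=.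
under eq_bigr do rewrite mulrDl; rewrite big_split /=; congr (_ + _).
rewrite (bigD1 i) //= eqxx mul1r big1 ?addr0 // => j ji.
by rewrite eq_sym (negbTE ji) !mul0r.
Qed.

Lemma cc_half (x : comalg D) : (cc 2^-1 * x) *+ 2 = x.
Proof. by rewrite mulr2n -mulrDl /cc /= -rmorphD half rmorph1 mul1r. Qed.

Lemma str_qv : \sum_i a i * (\sum_j b j * str phi qv i j) = 0.
Proof. exact: str_self. Qed.

(** The trace and the contraction with u_i v_j of [second], see [second_trace] and
    [second_contract], with phi ^ 2 = -2 inserted. *)
Definition trace_part p q r N : comalg D := - 2 *
  ((norm2 b ^+ N.-1 * (norm2 b * dot p q - dot b p * dot b q)) *+ 2 *+ N
   + norm2 b ^+ N * (dot p q *+ 2 - dot b r *+ 2)) *+ 2 *+ N.+1.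
Definition contraction_part p q r N u v : comalg D := - 2 *
  norm2 b ^+ N * (dot p q * dot u v - dot p v * dot u q
                  + dot v r * dot b u - dot v u * dot b r) *+ 2 *+ N.+1.

Lemma leading_symbolE M N : leading_symbol M N =
  (norm2 a ^+ M * trace_part pv qv rmv N + (norm2 a ^+ M.-1 * contraction_part pv qv rmv N a a) *+ (2 * M)) *+ M.+1
  + (norm2 a ^+ M * dot a2 (pole_symbol N) + cT (norm2 a ^+ M) * dot a (pole_symbol N)) *+ (2 * M).+2
  + (cT (norm2 a ^+ M) * trace_part qv qv rv N
     + (cT (norm2 a ^+ M.-1) * contraction_part qv qv rv N a a
        + norm2 a ^+ M.-1 * (contraction_part qv qv rv N a a2 + contraction_part qv qv rv N a2 a)) *+ (2 * M)) *+ M.+1.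
Proof.
have hT := cT_derivation.
rewrite /leading_symbol cT_leg; congr (_ + _ + _).
  rewrite weighted_diagonal second_trace phi_sqr -/(trace_part _ _ _ _).
  have E i j (F : comalg D) : a i * a j * norm2 a ^+ M.-1 *+ (2 * M) * F
      = (norm2 a ^+ M.-1 * (a j * a i * F)) *+ (2 * M).
    by rewrite mulrnAl; congr (_ *+ _); ring.
  under [X in _ + X]eq_bigr => j _ do under eq_bigr => i _ do rewrite E.
  under [X in _ + X]eq_bigr => j _ do rewrite sumrMnl -mulr_sumr.
  rewrite sumrMnl -mulr_sumr second_contract ?str_qv ?mulr0 // phi_sqr -/(contraction_part _ _ _ _ _ _).
  rewrite (_ : (2 * M).+2 = (2 * M.+1)%N); last by rewrite mulnS.
  by rewrite [LHS]mulrnA cc_half.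
congr (_ *+ _).
have Ew i j : cT ((i == j)%:R * norm2 a ^+ M + a i * a j * norm2 a ^+ M.-1 *+ (2 * M))
   = (i == j)%:R * cT (norm2 a ^+ M) +
     ((a2 i * a j + a i * a2 j) * norm2 a ^+ M.-1 + a i * a j * cT (norm2 a ^+ M.-1)) *+ (2 * M).
  rewrite (derD hT) (derMn hT); congr (_ + _ *+ _).
    by rewrite (derM hT) (derMn hT) (der1 hT) mul0rn mul0r add0r.
  by rewrite (derM hT) (derM hT) !cT_vec.
under eq_bigr => i _ do under eq_bigr => j _ do rewrite Ew.
rewrite weighted_diagonal second_trace phi_sqr -/(trace_part _ _ _ _); congr (_ + _).
have E i j : ((a2 i * a j + a i * a2 j) * norm2 a ^+ M.-1 + a i * a j * cT (norm2 a ^+ M.-1)) *+ (2 * M) * second phi b qv qv rv N j i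
   = (cT (norm2 a ^+ M.-1) * (a j * a i * second phi b qv qv rv N j i) + norm2 a ^+ M.-1 *
     (a j * a2 i * second phi b qv qv rv N j i + a2 j * a i * second phi b qv qv rv N j i)) *+ (2 * M).
  by rewrite mulrnAl; congr (_ *+ _); ring.
under eq_bigr => j _ do under eq_bigr => i _ do rewrite E.
under eq_bigr => j _ do rewrite sumrMnl big_split /= -!mulr_sumr big_split /=.
rewrite sumrMnl big_split /= -!mulr_sumr big_split /=.
rewrite !second_contract ?str_qv ?mulr0 ?mul0r // phi_sqr -!/(contraction_part _ _ _ _ _ _).
by [].
Qed.

Definition sv i : comalg D := b1 i + qv i.

Lemma pole_symbolE N i : pole_symbol N i =
   ((level_gap * norm2 b ^+ N) *+ (2 * N).+2 + (cX * norm2 b ^+ N.-1 * dot b sv) *+ 2 *+ (2 * N) *+ N.+1) * b i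
   - (cX * (norm2 b ^+ N *+ 4 + (norm2 b ^+ N.-1 * norm2 b) *+ 2 *+ (2 * N))) *+ N.+1 * sv i.
Proof.
have E j k : pair_symbol i j k = - cX * \sum_l phi * eps (comalg D) i j l * str phi sv l k.
  rewrite /pair_symbol mulNr -mulrN -sumrN; congr (_ * _); apply: eq_bigr => l _.
  by rewrite strD mulrN.
rewrite /pole_symbol; set w := fun j k => \sum_l phi * eps (comalg D) i j l * str phi sv l k.
have -> : \sum_j \sum_k pair_symbol i j k *
      ((j == k)%:R * norm2 b ^+ N + b j * b k * norm2 b ^+ N.-1 *+ (2 * N))
  = - cX * (norm2 b ^+ N * (\sum_j w j j)
            + (norm2 b ^+ N.-1 * (\sum_j \sum_k b j * b k * w j k)) *+ (2 * N)).
  transitivity (- cX * (\sum_j \sum_k ((j == k)%:R * norm2 b ^+ N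
      + b j * b k * norm2 b ^+ N.-1 *+ (2 * N)) * w j k)).
    rewrite mulr_sumr; apply: eq_bigr => j _; rewrite mulr_sumr; apply: eq_bigr => k _.
    by rewrite E mulrAC [RHS]mulrA.
  congr (_ * _); transitivity (\sum_j (norm2 b ^+ N * w j j
      + (norm2 b ^+ N.-1 * \sum_k b j * b k * w j k) *+ (2 * N))).
    apply: eq_bigr => j _; under eq_bigr do rewrite mulrDl; rewrite big_split /=; congr (_ + _).
      rewrite (bigD1 j) //= eqxx mul1r big1 ?addr0 // => k kj.
      by rewrite eq_sym (negbTE kj) !mul0r.
    rewrite mulr_sumr -sumrMnl; apply: eq_bigr => k _.
    by rewrite mulrnAl; congr (_ *+ _); ring.
  by rewrite big_split /= sumrMnl !mulr_sumr.
rewrite /w str_str_diag str_str_double phi_sqr -norm2E.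
move: (norm2 b ^+ N) (norm2 b ^+ N.-1) (norm2 b) (dot b sv) level_gap (b i) (sv i) cX => x1 x2 x3 x4 x5 x6 x7 x8.
rewrite !mulrnA; ring.
Qed.

Lemma triple_fcon u v q : triple phi u v (fcon q) = - 2 * (dot u b * dot v q - dot u q * dot v b).
Proof. by rewrite triple_str phi_sqr. Qed.

Lemma correction_left_symbolE L N : correction_left_symbol L N = (2 * N.+1)%:R * (norm2 b ^+ N *
  (norm2 a ^+ L * (- 2 * (dot a b * dot a2 qv1 - dot a qv1 * dot a2 b)
     + - 2 * (dot a2 b * dot a1 qv - dot a2 qv * dot a1 b)
     - - 2 * (dot a12 b * dot a qv - dot a12 qv * dot a b)
     - - 2 * (dot a1 b * dot a2 qv - dot a1 qv * dot a2 b))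
   - cT (norm2 a ^+ L) * (- 2 * (dot a1 b * dot a qv - dot a1 qv * dot a b)))).
Proof.
rewrite /correction_left_symbol [triple phi a2 (fcon qv1) a]triple_cyc.
rewrite -[triple phi (fcon qv) a12 a]triple_cyc -[triple phi (fcon qv) a1 a2]triple_cyc.
by rewrite -[triple phi (fcon qv) a1 a]triple_cyc !triple_fcon.
Qed.

Lemma der_triple d u v w : derivation d -> d phi = 0 ->
  d (triple phi u v w) = triple phi (d \o u) v w + triple phi u (d \o v) w + triple phi u v (d \o w).
Proof.
move=> hd dphi; rewrite -!triple_sum -!/(contract3 _) -!contract3D.
rewrite (der_sum hd); apply: eq_bigr => i _; rewrite (der_sum hd); apply: eq_bigr => j _.
rewrite (der_sum hd); apply: eq_bigr => k _.
by rewrite !(derM hd) dphi (der_int hd) /=; ring.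
Qed.

Lemma triple_suml (x : 'I_3 -> comalg D) f v w :
  \sum_i x i * triple phi (f i) v w = triple phi (fun j => \sum_i x i * f i j) v w.
Proof.
under eq_bigr do rewrite mulr_sumr; rewrite exchange_big; apply: eq_bigr => j _ /=.
under eq_bigr do rewrite mulr_sumr; rewrite exchange_big; apply: eq_bigr => k _ /=.
by rewrite !mulr_suml; apply: eq_bigr => i _; rewrite !mulrA.
Qed.

Lemma triple_str_suml (x : 'I_3 -> comalg D) q u v :
  \sum_i x i * triple phi (str phi q i) u v = - 2 * (dot q u * dot x v - dot q v * dot x u).
Proof. by rewrite triple_suml triple_str_contract phi_sqr. Qed.

Lemma correction_right_symbolE M L : correction_right_symbol M L =
  (norm2 a ^+ M * (norm2 b ^+ L *
     (- 2 * (dot pv b1 * dot a b - dot pv b * dot a b1)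
      + - 2 * (dot rv1 b * dot a b2 - dot rv1 b2 * dot a b)
      + - 2 * (dot qv b2 * dot a b1 - dot qv b1 * dot a b2)))
   + norm2 b ^+ L * (norm2 a ^+ M * (- 2 * (dot qv b1 * dot a2 b - dot qv b * dot a2 b1))
     + cT (norm2 a ^+ M) * (- 2 * (dot qv b1 * dot a b - dot qv b * dot a b1))))
   *+ (2 * M).+2.
Proof.
rewrite /correction_right_symbol; congr ((_ * _ + _) *+ _).
  transitivity (\sum_i (norm2 b ^+ L * (a i * triple phi (str phi pv i) b1 b
       + a i * triple phi (str phi rv1 i) b b2 + a i * triple phi (str phi qv i) b2 b1)
     + triple phi b2 b1 b * (norm2 b ^+ L.-1 *+ 2 *+ L) * (a i * \sum_j b j * str phi qv i j))).
    apply: eq_bigr => i _; have hd := cad_derivation (Imode ptz i 0 0).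
    rewrite (derM hd) cad0_norm (der_triple _ _ _ hd (cad_phi _)).
    have Et (u v u' v' w w' : 'I_3 -> comalg D) : u =1 u' -> v =1 v' -> w =1 w' ->
        triple phi u v w = triple phi u' v' w'.
      move=> hu hv hw; apply: eq_bigr => j _; apply: eq_bigr => k _; rewrite hu hv.
      by congr (_ * _); apply: eq_bigr => l _; rewrite hw.
    rewrite (Et (_ \o b2) b1 (str phi pv i) b1 b b) //; last by move=> j; rewrite /= cad_var sym_beta_zw00 // strZ strB.
    rewrite (Et b2 (_ \o b1) b2 (str phi rv1 i) b b) //; last by move=> j; exact: cad0_b1.
    rewrite (Et b2 b1 b2 b1 (_ \o b) (str phi qv i)) //; last by move=> j; exact: cad0_w.
    rewrite [triple phi (str phi rv1 i) b b2]triple_cyc.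
    rewrite [triple phi b2 b1 (str phi qv i)]triple_cyc.
    rewrite -!mulrnAl.
    move: (triple _ _ _ _) (triple _ _ _ _) (triple _ _ _ _) (triple _ _ _ _) => *; ring.
  rewrite big_split /= -!mulr_sumr str_qv mulr0 addr0 !big_split /=.
  by rewrite !triple_str_suml.
rewrite cT_leg mulrDr; set g := fun i => _.
have E x : dot x g = norm2 b ^+ L * (- 2 * (dot qv b1 * dot x b - dot qv b * dot x b1)).
  by rewrite -triple_str_suml mulr_sumr; apply: eq_bigr => i _; rewrite mulrCA.
by rewrite !E [_ * (_ * _)]mulrCA; congr (_ + _); rewrite mulrCA.
Qed.

(** ** The twisted derivatives *)

Variables (dv : point -> {additive K -> K}) (Pv : point -> V -> V).
Local Notation raise v := (fun g : mode point => raise_coef K v g *: lt (raise_mode g)).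
Hypothesis dvM : forall v x y, dv v (x * y) = dv v x * y + x * dv v y.
Hypothesis dvc : forall v x, dv v (c x) = 0.
Hypothesis dvh : forall v, dv v h = 0.
Hypothesis dvX : forall v, dv v X = if v is ptz then - X ^+ 2 else X ^+ 2.
Hypothesis PvE : forall v x, Pv v (x *: vac) = fd_der (dv v) (raise v) x *: vac.
Local Notation cP v := (@comder K (mode point) D (dv v) (raise v)).

Lemma cP_derivation v : derivation (cP v).
Proof. exact: comder_derivation (dvM v). Qed.
Lemma cP_vec v u p r i : cP v (vec u p r i) = (u == v)%:R * vec u p.+1 r i.
Proof.
rewrite /vec comder_var; last exact: dvM.
by rewrite /= symZ rmorph_nat.
Qed.

Definition Aform M N : D := \sum_(i : (2 * M).-tuple 'I_3) \sum_(j : (2 * N).-tuple 'I_3) \sum_e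
  c (t i * t j) *: (trans (symprod ptz (e :: i)) * symprod ptw (e :: j)).
Definition Bform M N : D := \sum_(i : (2 * M).-tuple 'I_3) \sum_(j : (2 * N).-tuple 'I_3) \sum_e
  c (t i * t j) *: (symprod ptz (e :: i) * symprod ptw (e :: j)).

Definition A_symbol M N : comalg D :=
  norm2 b ^+ N * (norm2 a ^+ M * dot a2 b + (norm2 a ^+ M.-1 * dot a a2) *+ 2 *+ M * dot a b).
Definition B_symbol M N : comalg D := norm2 a ^+ M * norm2 b ^+ N * dot a b.

Lemma sym_Aform M N : S (Aform M N) = A_symbol M N.
Proof.
have hT := cT_derivation.
transitivity (\sum_e cT (a e * norm2 a ^+ M) * (b e * norm2 b ^+ N)).
  rewrite -(contract_legs c M N a b (f := cT)) => [|x y|d x].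
  - rewrite sym_sum; apply: eq_bigr => i _; rewrite sym_sum; apply: eq_bigr => j _.
    rewrite sym_sum; apply: eq_bigr => e _; rewrite symZ symM sym_trans !sym_symprod.
    by [].
  - exact: (derD hT).
  - by rewrite (derM hT) comder_csc ?rmorph0 ?mul0r ?add0r //; exact: null_derM.
under eq_bigr do rewrite mulrA; rewrite -mulr_suml cT_leg cT_norm mulrC.
by [].
Qed.

Lemma sym_Bform M N : S (Bform M N) = B_symbol M N.
Proof.
transitivity (\sum_e a e * norm2 a ^+ M * (b e * norm2 b ^+ N)).
  rewrite -(contract_legs c M N a b (f := id)) //.
  rewrite sym_sum; apply: eq_bigr => i _; rewrite sym_sum; apply: eq_bigr => j _.
  rewrite sym_sum; apply: eq_bigr => e _; rewrite symZ symM !sym_symprod.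
  by [].
by rewrite /B_symbol /dot mulr_sumr; apply: eq_bigr => e _; ring.
Qed.

(** The states A and B of the theorem with coefficients left free, and the twisted
    derivatives. *)
Definition Astate z M N : V := sc (c z * h ^+ 2 * X) (Aform M N *: vac).
Definition Bstate z M N : V := sc (c z * h ^+ 2 * X ^+ 2) (Bform M N *: vac).
Definition twist v j (x : V) : V := Pv v x - (c (j%:R / 2) *: lt (Kmode v 0)) *: x.

Lemma has_symbol_A z M N : has_symbol 2 (Astate z M N) (cc z * cX * A_symbol M N).
Proof.
rewrite /Astate -mulrA mulrCA -scA; apply: (has_symbol_hn 2 (k := 0)).
rewrite -scA; apply: eq_has_symbol; last first.
  do 2 apply: has_symbol_sc; exact: has_symbol_state.
by rewrite sym_Aform mulrA.
Qed.

Definition level v : comalg D := cvar D (Kmode v 0).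

Lemma has_symbol_twist v j z M N : has_symbol 2 (twist v j (Astate z M N))
  (cc z * ((if v is ptz then - cX ^+ 2 else cX ^+ 2) * A_symbol M N + cX * cP v (A_symbol M N)
     - cc (j%:R / 2) * level v * cX * A_symbol M N)).
Proof.
have dXX : csc D (dv v X) = if v is ptz then - cX ^+ 2 else cX ^+ 2.
  by rewrite dvX; case: (v); rewrite ?rmorphN rmorphXn.
apply: eq_has_symbol; last first.
  apply: has_symbolB; last exact/has_symbolZ/has_symbol_A.
  rewrite /Astate scE PvE fd_derZ; last exact: dvM.
  rewrite dvM expr2 !dvM dvc dvh !(mul0r, mulr0, addr0, add0r).
  have -> : ((c z * (h * h) * dv v X) *: Aform M N
      + (c z * (h * h) * X) *: fd_der (dv v) (raise v) (Aform M N)) *: vac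
    = sc (h ^+ 2) (sc (c z * dv v X) (Aform M N *: vac)
                   + sc (c z * X) (fd_der (dv v) (raise v) (Aform M N) *: vac)).
    rewrite scalerDl -!scE scDr !scA expr2 ![h * h * (c z * _)]mulrCA.
    by rewrite ![c z * (h * h * _)]mulrA.
  apply: (has_symbol_hn 2 (k := 0)).
  apply: has_symbolD; apply: has_symbol_sc; exact: has_symbol_state.
rewrite -(comderE _ (dvM v)) sym_Aform symZ !(rmorphM (csc D)).
rewrite /= dXX -/cX.
rewrite -[csc D (c z)]/(cc z) -[csc D (c (_ / _))]/(cc _) -[S (lt _)]/(level v).
move: (cP v (A_symbol M N)) => dl.
move: (if v is ptz then _ else _) => dx.
move: (cc z) (cc (j%:R / 2)) (level v) (A_symbol M N) cX => *.
ring.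
Qed.

Lemma has_symbol_TB z M N : has_symbol 2 (Tv (Bstate z M N)) (cc z * cX ^+ 2 * cT (B_symbol M N)).
Proof.
have trZ d x : trans (d *: x) = d *: trans x.
  by rewrite /trans fd_derZ; [rewrite scale0r add0r|exact: null_derM].
rewrite /Bstate -mulrA mulrCA scE TvE trZ -scE -scA; apply: (has_symbol_hn 2 (k := 0)).
rewrite -scA; apply: eq_has_symbol; last first.
  do 2 apply: has_symbol_sc; exact: has_symbol_state.
by rewrite sym_trans sym_Bform mulrA rmorphXn.
Qed.

(** ** Comparison of the two sides *)

Lemma der_dot_eq d u v u' v' : derivation d -> (forall i, d (u i) = u' i) ->
  (forall i, d (v i) = v' i) -> d (dot u v) = dot u' v + dot u v'.
Proof.
move=> hd hu hv; rewrite (der_dot hd); congr (_ + _); apply: eq_bigr => i _ /=.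
  by rewrite hu.
by rewrite hv.
Qed.
Lemma der_norm_eq d u u' M : derivation d -> (forall i, d (u i) = u' i) ->
  d (norm2 u ^+ M) = (norm2 u ^+ M.-1 * dot u u') *+ 2 *+ M.
Proof.
move=> hd hu; rewrite (der_norm2X hd); congr (_ * _ *+ _ *+ _).
by apply: eq_bigr => i _ /=; rewrite hu.
Qed.

Definition zero3 : 'I_3 -> comalg D := fun=> 0.
Lemma dot0l u : dot zero3 u = 0.
Proof. by rewrite /dot big1 // => i _; rewrite mul0r. Qed.
Lemma dot0r u : dot u zero3 = 0.
Proof. by rewrite dotC dot0l. Qed.

Lemma dz_A_symbol M N : cP ptz (A_symbol M N) = norm2 b ^+ N *
  ((norm2 a ^+ M.-1 * dot a a1) *+ 2 *+ M * dot a2 b + norm2 a ^+ M * dot a12 b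
   + ((norm2 a ^+ M.-2 * dot a a1) *+ 2 *+ M.-1 * dot a a2
      + norm2 a ^+ M.-1 * (dot a1 a2 + dot a a12)) *+ 2 *+ M * dot a b
   + (norm2 a ^+ M.-1 * dot a a2) *+ 2 *+ M * dot a1 b).
Proof.
have hd := cP_derivation ptz.
have ha i : cP ptz (a i) = a1 i by rewrite cP_vec mul1r.
have ha2 i : cP ptz (a2 i) = a12 i by rewrite cP_vec mul1r.
have hb i : cP ptz (b i) = zero3 i by rewrite cP_vec mul0r.
have eN K' := der_norm_eq K' hd ha.
rewrite /A_symbol (derM hd) (der_norm_eq N hd hb) dot0r mulr0 !mul0rn mul0r add0r; congr (_ * _).
rewrite (derD hd) (derM hd) eN (der_dot_eq hd ha2 hb) dot0r addr0 (derM hd).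
rewrite !(derMn hd) (derM hd) eN (der_dot_eq hd ha ha2) (der_dot_eq hd ha hb) dot0r addr0.
by rewrite !addrA.
Qed.

Lemma dw_A_symbol M N : cP ptw (A_symbol M N) =
  (norm2 b ^+ N.-1 * dot b b1) *+ 2 *+ N *
    (norm2 a ^+ M * dot a2 b + (norm2 a ^+ M.-1 * dot a a2) *+ 2 *+ M * dot a b)
  + norm2 b ^+ N *
    (norm2 a ^+ M * dot a2 b1 + (norm2 a ^+ M.-1 * dot a a2) *+ 2 *+ M * dot a b1).
Proof.
have hd := cP_derivation ptw.
have ha i : cP ptw (a i) = zero3 i by rewrite cP_vec mul0r.
have ha2 i : cP ptw (a2 i) = zero3 i by rewrite cP_vec mul0r.
have hb i : cP ptw (b i) = b1 i by rewrite cP_vec mul1r.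
have eN K' : cP ptw (norm2 a ^+ K') = 0.
  by rewrite (der_norm_eq K' hd ha) dot0r mulr0 !mul0rn.
rewrite /A_symbol (derM hd) (der_norm_eq N hd hb); congr (_ + _ * _).
rewrite (derD hd) (derM hd) eN mul0r add0r (der_dot_eq hd ha2 hb) dot0l add0r (derM hd).
rewrite !(derMn hd) (derM hd) eN mul0r add0r (der_dot_eq hd ha ha2) dot0l dot0r addr0 mulr0.
by rewrite !mul0rn mul0r add0r (der_dot_eq hd ha hb) dot0l add0r.
Qed.

Lemma cT_B_symbol M N : cT (B_symbol M N) =
  ((norm2 a ^+ M.-1 * dot a a2) *+ 2 *+ M * norm2 b ^+ N
   + norm2 a ^+ M * ((norm2 b ^+ N.-1 * dot b b2) *+ 2 *+ N)) * dot a b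
  + norm2 a ^+ M * norm2 b ^+ N * (dot a2 b + dot a b2).
Proof.
have hd := cT_derivation.
have ha i : cT (a i) = a2 i by exact: cT_vec.
have hb i : cT (b i) = b2 i by exact: cT_vec.
rewrite /B_symbol (derM hd) (derM hd) (der_norm_eq M hd ha) (der_norm_eq N hd hb).
by rewrite (der_dot_eq hd ha hb).
Qed.

Lemma dot_qr x : dot x qv = cX * (dot x b - dot x a).
Proof. by rewrite dotZr dotBr. Qed.
Lemma dot_ql x : dot qv x = cX * (dot x b - dot x a).
Proof. by rewrite dotC dot_qr. Qed.
Lemma dot_pr x : dot x pv = cX * (dot x b2 - dot x a2).
Proof. by rewrite dotZr dotBr. Qed.
Lemma dot_pl x : dot pv x = cX * (dot x b2 - dot x a2).
Proof. by rewrite dotC dot_pr. Qed.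
Lemma dot_rr x : dot x rv = cX * (dot x qv + dot x a1).
Proof. by rewrite dotZr dotDr. Qed.
Lemma dot_rmr x : dot x rmv = cX * (dot x pv + dot x a12).
Proof. by rewrite dotZr dotDr. Qed.
Lemma dot_q1r x : dot x qv1 = - (cX * (dot x qv + dot x a1)).
Proof.
rewrite -mulNr -dotDr -dotZr /dot; apply: eq_bigr => i _; congr (_ * _).
by rewrite mulNr.
Qed.
Lemma dot_r1l x : dot rv1 x = cX * (dot x qv + dot x b1).
Proof. by rewrite dotC dotZr dotDr. Qed.
Lemma dot_sr x : dot x sv = dot x b1 + dot x qv.
Proof. exact: dotDr. Qed.
Lemma dot_pole x N : dot x (pole_symbol N) =
   ((level_gap * norm2 b ^+ N) *+ (2 * N).+2 + (cX * norm2 b ^+ N.-1 * dot b sv) *+ 2 *+ (2 * N) *+ N.+1)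
     * dot x b
   - (cX * (norm2 b ^+ N *+ 4 + (norm2 b ^+ N.-1 * norm2 b) *+ 2 *+ (2 * N))) *+ N.+1 * dot x sv.
Proof.
have E := pole_symbolE N; set k1 := (X in X * dot x b); set k2 := (X in _ - X * _).
transitivity (dot x (fun i => k1 * b i - k2 * sv i)); last by rewrite dotBr !dotZr.
by apply: eq_bigr => i _; congr (_ * _); exact: E.
Qed.

Definition dot_expand := (dot_qr, dot_ql, dot_pr, dot_pl, dot_rr, dot_rmr, dot_q1r, dot_r1l, dot_sr).
Definition dot_order := (dotC b a, dotC a1 a, dotC b1 a, dotC a2 a, dotC b2 a, dotC a12 a,
  dotC a1 b, dotC b1 b, dotC a2 b, dotC b2 b, dotC a12 b,
  dotC b1 a1, dotC a2 a1, dotC b2 a1, dotC a12 a1,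
  dotC a2 b1, dotC b2 b1, dotC a12 b1, dotC b2 a2, dotC a12 a2, dotC a12 b2).

(** After contraction of all structure constants in pairs both sides are polynomials
    in the scalar products of the seven vectors, and they agree without using any
    relation between these.  The powers of norm2 a are split off by cases because
    the exponents M - 1 and M - 2 are truncated.  The factor m n clears the
    denominators of zeta and of the coefficients of the corrections. *)
Lemma classical_identity M N m n : m = (2 * M).+1 -> n = (2 * N).+1 ->
  (m * n)%:R * leading_symbol M N
  + n%:R * (2 * M * M.+1 * (2 * M).+3)%:R * correction_left_symbol M.-1 N
  + m%:R * (2 * N * N.+1 * (2 * N).+3)%:R * correction_right_symbol M N.-1
  = (8 * M.+1 * N.+1)%:R *
     (n%:R * (- cX ^+ 2 * A_symbol M N + cX * cP ptz (A_symbol M N))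
      - m%:R * (cX ^+ 2 * A_symbol M N + cX * cP ptw (A_symbol M N))
      + m%:R * cX ^+ 2 * cT (B_symbol M N))
    + ((4 * M.+1 * N.+1 * n)%:R * m%:R * level ptw - (4 * M.+1 * N.+1 * m)%:R * n%:R * level ptz)
      * (cX * A_symbol M N).
Proof.
move=> -> ->; rewrite leading_symbolE correction_left_symbolE correction_right_symbolE.
rewrite dz_A_symbol dw_A_symbol cT_B_symbol !cT_norm /trace_part /contraction_part !dot_pole /A_symbol /level_gap -!/(level _) !dot_expand.
rewrite !dot_order -!norm2E.
move: (level ptw) (level ptz) cX => k1 k2 x.
move: (dot a b) (dot a a1) (dot a b1) (dot a a2) (dot a b2) (dot a a12) => d1 d2 d3 d4 d5 d6.
move: (dot b a1) (dot b b1) (dot b a2) (dot b b2) (dot b a12) => d7 d8 d9 d10 d11.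
move: (dot a1 b1) (dot a1 a2) (dot b1 a2) (dot b1 b2) => d12 d13 d14 d15.
move: (norm2 a) (norm2 b) => u v.
case: N => [|N]; rewrite ?expr0 /=; last first.
  rewrite [v ^+ N.+1]exprS; move: (v ^+ N) => y.
  case: M => [|[|M]]; rewrite ?expr0 ?expr1 /=.
  - ring.
  - ring.
  rewrite ![u ^+ M.+2]exprS ![u ^+ M.+1]exprS; move: (u ^+ M) => w.
  ring.
case: M => [|[|M]]; rewrite ?expr0 ?expr1 /=.
- ring.
- ring.
rewrite ![u ^+ M.+2]exprS ![u ^+ M.+1]exprS; move: (u ^+ M) => w.
ring.
Qed.

(** The coefficient of the term of order h in the charge of degree m + 1. *)
Definition correction_coef m : R[i] := (m.+1 * m.+2 * m.-1)%:R / (2 * m)%:R.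
Definition charge u M : V := tensor u (2 * M).+2 t *: vac
  + sc (h * c (correction_coef (2 * M).+1)) (correction u M.-1 *: vac).

Lemma cc_frac (k p q r : nat) : (0 < q)%N -> (k * p = r * q)%N ->
  k%:R * cc (p%:R / q%:R) = r%:R.
Proof.
move=> q0 E; rewrite -(rmorph_nat cc k) -rmorphM mulrA -natrM E natrM mulfK ?rmorph_nat //.
by rewrite pnatr_eq0 -lt0n.
Qed.

(** The product of the two corrections has the factor h ^ 2 and its zeroth product
    another factor h, so it does not contribute. *)
Lemma charges_symbol M N : has_symbol 2 (Y (charge ptz M) 0 (charge ptw N))
  (leading_symbol M N
   + cc (correction_coef (2 * M).+1) * correction_left_symbol M.-1 N
   + cc (correction_coef (2 * N).+1) * correction_right_symbol M N.-1).
Proof.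
rewrite /charge; set S1 := tensor ptz _ _ *: vac; set C1 := correction ptz _ *: vac.
set S2 := tensor ptw _ _ *: vac; set C2 := correction ptw _ *: vac.
set k1 := correction_coef _; set k2 := correction_coef _.
have -> : Y (S1 + sc (h * c k1) C1) 0 (S2 + sc (h * c k2) C2)
  = Y S1 0 S2 + sc h (sc (c k1) (Y C1 0 S2)) + sc h (sc (c k2) (Y S1 0 C2))
    + sc (h * c k1 * (h * c k2)) (Y C1 0 C2).
  rewrite (YDl Ylin_state) !(YDr Ylin) !(Yscl Ylin_state) !(Yscr Ylin) !scA.
  by rewrite -!addrA; congr (_ + _); rewrite addrCA.
rewrite -[X in has_symbol 2 _ X]addr0; apply: has_symbolD; last first.
  apply: has_symbol_Ok; rewrite mulrACA -scA; apply: (Ok_sc 2).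
  by apply: Ok_scc; exact: (Yo1 C1 0).
apply: has_symbolD; first apply: has_symbolD; first exact: leading_product.
  by apply: has_symbol_h; apply: has_symbol_sc; exact: correction_left_product.
by apply: has_symbol_h; apply: has_symbol_sc; exact: correction_right_product.
Qed.

Lemma target_symbol M N m n z :
  has_symbol 2 (twist ptz m (Astate z M N) *+ n - twist ptw n (Astate z M N) *+ m
                + Tv (Bstate (m%:R * z) M N))
   (n%:R * (cc z * (- cX ^+ 2 * A_symbol M N + cX * cP ptz (A_symbol M N)
        - cc (m%:R / 2) * level ptz * cX * A_symbol M N))
    - m%:R * (cc z * (cX ^+ 2 * A_symbol M N + cX * cP ptw (A_symbol M N)
        - cc (n%:R / 2) * level ptw * cX * A_symbol M N))
    + cc (m%:R * z) * cX ^+ 2 * cT (B_symbol M N)).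
Proof.
apply: has_symbolD; last exact: has_symbol_TB.
apply: has_symbolB; apply: eq_has_symbol (esym (mulr_natl _ _)) _.
  by apply: has_symbolMn; exact: has_symbol_twist.
by apply: has_symbolMn; exact: has_symbol_twist.
Qed.

Lemma zeroth_product M N m n z : m = (2 * M).+1 -> n = (2 * N).+1 -> z = zeta R m n ->
  eqm 3 (Y (charge ptz M) 0 (charge ptw N))
    (twist ptz m (Astate z M N) *+ n - twist ptw n (Astate z M N) *+ m
     + Tv (Bstate (m%:R * z) M N)).
Proof.
move=> mE nE zE'; apply: (has_symbol_inj comm (charges_symbol M N)).
apply: eq_has_symbol (target_symbol M N m n z); rewrite -mE -nE.
have mn0 : (0 < m * n)%N by rewrite muln_gt0 mE nE.
have zE : (m * n)%:R * cc z = (8 * M.+1 * N.+1)%:R :> comalg D.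
  by rewrite zE'; apply: cc_frac => //; lia.
have kM : m%:R * cc (correction_coef m) = (2 * M * M.+1 * (2 * M).+3)%:R :> comalg D.
  by apply: cc_frac; lia.
have kN : n%:R * cc (correction_coef n) = (2 * N * N.+1 * (2 * N).+3)%:R :> comalg D.
  by apply: cc_frac; lia.
have jE j : (m * n)%:R * cc z * cc (j%:R / 2) = (4 * M.+1 * N.+1 * j)%:R :> comalg D.
  by rewrite zE; apply: cc_frac => //; lia.
have := classical_identity mE nE; rewrite -kM -kN -zE -(jE m) -(jE n).
move=> E; apply: (@mulrn_inj R _ cc (m * n).-1); rewrite prednK // -[LHS]mulr_natl -[RHS]mulr_natl.
rewrite (rmorphM cc m%:R) rmorph_nat; move: E; rewrite !(natrM _ m n) => E.
move: E {kM kN zE jE}.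
move: (leading_symbol M N) (correction_left_symbol _ _) (correction_right_symbol _ _) => l cl r.
move: (cP ptz (A_symbol M N)) (cP ptw (A_symbol M N)) (cT (B_symbol M N)) => dz dw tb; move: (A_symbol M N) => p.
move: (level ptz) (level ptw) cX (cc (correction_coef m)) (cc (correction_coef n)) => k1 k2 x e1 e2.
move: (cc (m%:R / 2)) (cc (n%:R / 2)) (cc z) => e3 e4 e5.
move: (m%:R : comalg D) (n%:R : comalg D) => m' n' E.
transitivity (m' * n' * l + n' * (m' * e1) * cl + m' * (n' * e2) * r); last by ring.
by rewrite E; ring.
Qed.

Lemma Pv_additive v : {morph Pv v : x y / x + y}.
Proof.
move=> x y; have [x' ->] := gen x; have [y' ->] := gen y.
by rewrite -scalerDl !PvE fd_derD scalerDl.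
Qed.
Lemma Pv_Ok v k x : Ok k x -> Ok k (Pv v x).
Proof.
move=> [u ->]; have [u' ->] := gen u; exists (fd_der (dv v) (raise v) u' *: vac).
rewrite scE PvE fd_derZ; last exact: dvM.
have -> : dv v (h ^+ k) = 0.
  by elim: k => [|k IH]; rewrite ?expr0 ?(d0_1 (@dvM v)) // exprS dvM IH dvh mul0r mulr0 addr0.
by rewrite scale0r add0r scE.
Qed.
Lemma Tv_additive : {morph Tv : x y / x + y}.
Proof.
move=> x y; have [x' ->] := gen x; have [y' ->] := gen y.
by rewrite -scalerDl !TvE transD scalerDl.
Qed.
Lemma Tv_Ok k x : Ok k x -> Ok k (Tv x).
Proof.
move=> [u ->]; have [u' ->] := gen u; exists (trans u' *: vac).
by rewrite scE TvE /trans fd_derZ ?scale0r ?add0r ?scE //; exact: null_derM.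
Qed.

Lemma additive_eqm k (f : V -> V) x y : {morph f : x y / x + y} ->
  (forall x, Ok k x -> Ok k (f x)) -> eqm k x y -> eqm k (f x) (f y).
Proof. by move=> fD fOk /fOk H; rewrite /eqm -[X in f X](subrK y) fD addrK. Qed.

Lemma twist_eqm v j k x y : eqm k x y -> eqm k (twist v j x) (twist v j y).
Proof.
move=> H; apply: eqmB; last exact: eqmZ.
by apply: additive_eqm H; [exact: Pv_additive|exact: Pv_Ok].
Qed.

Lemma eqmMn k x y n : eqm k x y -> eqm k (x *+ n) (y *+ n).
Proof.
move=> H; elim: n => [|n IH]; first exact: eqm_refl.
by rewrite !mulrS; exact: eqmD.
Qed.

(** An error of order h ^ 2 in either state is harmless, since the zeroth product
    gains a factor h. *)
Lemma Y_eqm_2 X1 X2 W1 W2 : eqm 2 X1 X2 -> eqm 2 W1 W2 -> eqm 3 (Y X1 0 W1) (Y X2 0 W2).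
Proof.
have Yh (X' W : V) : Ok 3 (sc (h ^+ 2) (Y X' 0 W)) by apply: (Ok_sc 2); exact: (Yo1 X' 0).
move=> [x hx] [w hw]; apply: (eqm_trans (v := Y X2 0 W1)).
  by rewrite /eqm -(YNl Ylin_state) -(YDl Ylin_state) hx (Yscl Ylin_state); exact: Yh.
by rewrite /eqm -(YNr Ylin) -(YDr Ylin) hw (Yscr Ylin); exact: Yh.
Qed.

Lemma zeroth_product_mod M N m n z X1 W1 A1 B1 :
  m = (2 * M).+1 -> n = (2 * N).+1 -> z = zeta R m n ->
  eqm 2 X1 (charge ptz M) -> eqm 2 W1 (charge ptw N) ->
  eqm 3 A1 (Astate z M N) -> eqm 3 B1 (Bstate (m%:R * z) M N) ->
  eqm 3 (Y X1 0 W1) (twist ptz m A1 *+ n - twist ptw n A1 *+ m + Tv B1).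
Proof.
move=> mE nE zE hX hW hA hB; apply: eqm_trans (Y_eqm_2 hX hW) _.
apply: eqm_trans (zeroth_product mE nE zE) (eqm_sym _).
apply: eqmD; last by apply: additive_eqm hB; [exact: Tv_additive|exact: Tv_Ok].
by apply: eqmB; apply: eqmMn; exact: twist_eqm.
Qed.
End TwoPoint.

(** * The two modules *)

Section Flow.
Variables (R : realType) (K : comNzRingType) (io : {rmorphism fps R[i] -> K}) (P : choiceType).

Definition scal : {rmorphism R[i] -> K} := (io \o @fpsC R[i])%FUN.

(** The current F of the bracket relations, divided by h. *)
Definition flow (u : P) a b (r s : int) j : freealg K (mode P) :=
  \sum_k scal (sl2f R a b k) *: Igen K u k j (r + s)
  - (hbar io * s%:~R * ((a == b) && (r + s == 0))%:R) *: Kgen K u j.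
Definition flow_same u a p (r : int) b q (s : int) : freealg K (mode P) :=
  (- scal ((p`! * q`!)%:R / (p + q).+1`!%:R)) *: flow u a b r s (p + q).+1.

Lemma currentE u a b r s j : current io u a b r s j = hbar io *: flow u a b r s j.
Proof.
rewrite /current /flow scalerBr scaler_sumr scalerA !mulrA -expr2.
by congr (_ - _); apply: eq_bigr => k _; rewrite scalerA.
Qed.
Lemma bracket_sameE u a p r b q s :
  bracket_same io u a p r b q s = hbar io *: flow_same u a p r b q s.
Proof. by rewrite /bracket_same currentE /flow_same !scalerA mulrC. Qed.
End Flow.

Section InducedAction.
Variables (K : comNzRingType) (G : choiceType) (h : K).
Variables (br : G -> G -> freealg K G) (ann : pred G) (beta : G -> G -> freealg K G).
Hypothesis brE : forall g k, br g k = h *: beta g k.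
Local Notation W := (induced br ann).
Local Notation lt := (letter K).

Lemma induced_comm g k (v : W) : lt g *: (lt k *: v)
  = lt k *: (lt g *: v) + @sc K G (free_datum_of K G) W h (beta g k *: v).
Proof.
have : (lt g * lt k - lt k * lt g - br g k) *: v = 0.
  rewrite -[v]repK [LHS]cls_scale -[RHS](scale0r (vacuum br ann)) vacuumZ.
  by apply/cls_eq; rewrite subr0; exact: vanish_br.
rewrite brE; move/eqP; rewrite 2!scalerBl subr_eq0 subr_eq => /eqP.
by rewrite -!scalerA addrC => ->; congr (_ + _); rewrite [RHS]scE.
Qed.

Lemma induced_gen (v : W) : exists x : freealg K G, v = x *: vacuum br ann.
Proof. by exists (rep v); rewrite vacuumZ repK. Qed.

Lemma induced_ann g : ann g -> lt g *: vacuum br ann = 0.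
Proof.
move=> hg; rewrite -[RHS](scale0r (vacuum br ann)) !vacuumZ.
by apply/cls_eq; rewrite subr0; exact: vanish_ann.
Qed.
End InducedAction.

(** * Relabelling of the modes *)

Section Relabelling.
Variables (R : realType) (K K' : comNzRingType) (P P' : choiceType).
Variables (io : {rmorphism fps R[i] -> K}) (io' : {rmorphism fps R[i] -> K'}).
Variables (f : {rmorphism K -> K'}) (gp : P -> P') (ge : mode P -> mode P').
Hypothesis f_io : forall x, f (io x) = io' x.
Hypothesis geI : forall u a p r, ge (Imode u a p r) = Imode (gp u) a p r.
Hypothesis geK : forall u p, ge (Kmode u p) = Kmode (gp u) p.
Local Notation fm := (freemap f ge).

Lemma freemap_cst x : f (cst io x) = cst io' x.
Proof. exact: f_io. Qed.
Lemma freemap_Igen u a p r : fm (Igen K u a p r) = Igen K' (gp u) a p r.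
Proof. by rewrite [LHS]freemap_letter geI. Qed.
Lemma freemap1 : fm 1 = 1.
Proof.
by rewrite -(word0 K (mode P)) -[word _ _]scale1r freemap_word rmorph1 scale1r word0.
Qed.
Lemma freemap_prod (x : 'I_3 -> freealg K (mode P)) s :
  fm (\prod_(a <- s) x a) = \prod_(a <- s) fm (x a).
Proof. by elim: s => [|a s IH]; rewrite ?big_nil ?freemap1 // !big_cons freemapM IH. Qed.
Lemma freemapX x n : fm (x ^+ n) = fm x ^+ n.
Proof. by elim: n => [|n IH]; rewrite ?expr0 ?freemap1 // !exprS freemapM IH. Qed.

Lemma freemap_sym_prod u s : fm (sym_prod io u s) = sym_prod io' (gp u) s.
Proof.
rewrite /sym_prod freemapZ freemap_sum freemap_cst; congr (_ *: _).
apply: eq_bigr => p _; rewrite freemap_prod; apply: eq_bigr => a _; exact: freemap_Igen.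
Qed.

Lemma freemap_translation x : fm (free_translation x) = free_translation (fm x).
Proof.
have gT g : ge (translate_mode g) = translate_mode (ge g).
  by case: g => [u a p r|u p] /=; rewrite ?geI ?geK.
have gc g : f (translate_coef K g) = translate_coef K' (ge g).
  by case: g => [u a p r|u p] /=; rewrite ?geI ?geK ?rmorph0 // rmorphN rmorph_int.
rewrite /free_translation; elim/freealg_ind: x => [|x y hx hy|d s].
- by rewrite freeder0 !freemap0 freeder0.
- by rewrite freederD !freemapD freederD hx hy.
rewrite freeder_word freemapD !freemap_word freemapZ freeder_word; congr (_ + _ *: _).
  by rewrite rmorph0 !scale0r.
have wE w : word K' (map ge w) = fm (word K w).
  by rewrite -[word K w]scale1r freemap_word rmorph1 scale1r.
elim: s => [|g s IH] /=; first exact: freemap0.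
rewrite freemapD !freemapM freemapZ !freemap_letter IH wE gT gc.
by [].
Qed.
End Relabelling.

(** * The zeroth product of the charges *)

Section Instance.
Variable R : realType.
Local Notation A := (fps R[i]).
Local Notation iota := (polyC : {rmorphism A -> {poly A}}).
Local Notation K2 := (Ktwo R).
Local Notation M2 := (mode point).
Local Notation F := (freealg K2 M2).
Local Notation D2 := (free_datum_of K2 M2).
Local Notation Vac := (vacuum (@bracket2 R) (@annihilator point)).
Local Notation scal := (@scal R K2 iota).
Local Notation flow2 := (@flow R K2 iota point).
Local Notation beta2_same := (@flow_same R K2 iota point).

Definition beta2_zw a p (r : int) b q (s : int) : F :=
  (\sum_(j < p.+1) ((-1) ^+ (p.+1 - j) * ('C(p, j) * (p + q - j)`!)%:R
      * 'X ^+ ((p + q).+1 - j) : K2) *: flow2 ptz a b r s j)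
  - (\sum_(j < q.+1) ((-1) ^+ p.+1 * ('C(q, j) * (p + q - j)`!)%:R
      * 'X ^+ ((p + q).+1 - j) : K2) *: flow2 ptw a b r s j).
Definition beta2 (g k : M2) : F :=
  match g, k with
  | Imode ptz a p r, Imode ptw b q s => beta2_zw a p r b q s
  | Imode ptw a p r, Imode ptz b q s => - beta2_zw b q s a p r
  | Imode u a p r, Imode _ b q s => beta2_same u a p r b q s
  | _, _ => 0
  end.

Lemma bracket2E g k : bracket2 R g k = hbar2 R *: beta2 g k.
Proof.
have zw a p r b q s : bracket_zw R a p r b q s = hbar2 R *: beta2_zw a p r b q s.
  rewrite /bracket_zw /beta2_zw scalerBr !scaler_sumr; congr (_ - _); apply: eq_bigr => j _.
    by rewrite currentE !scalerA mulrC.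
  by rewrite currentE !scalerA mulrC.
case: g k => [[] a p r|u p] [[] b q s|v q] /=; rewrite ?bracket_sameE ?zw ?scaler0 //.
by rewrite scalerN.
Qed.

Lemma ground_partialX v : @ground_partial A v 'X
  = if v is ptz then - ('X : K2) ^+ 2 else 'X ^+ 2.
Proof.
have := @ground_partialXn A v 1; rewrite expr1 mulr1 => ->.
by case: v; rewrite ?mulN1r ?mul1r.
Qed.

Variables (Y : V2 R -> int -> V2 R -> V2 R) (hY : is_state_field_map Y).

Lemma zeroth_product2 M N m n z (X1 W1 A1 B1 : V2 R) :
  m = (2 * M).+1 -> n = (2 * N).+1 -> z = zeta R m n ->
  @eqm K2 M2 D2 (V2 R) (hbar2 R) 2 X1 (@charge R K2 scal (hbar2 R) D2 (V2 R) Vac ptz M) ->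
  @eqm K2 M2 D2 (V2 R) (hbar2 R) 2 W1 (@charge R K2 scal (hbar2 R) D2 (V2 R) Vac ptw N) ->
  @eqm K2 M2 D2 (V2 R) (hbar2 R) 3 A1 (@Astate R K2 scal (hbar2 R) 'X D2 (V2 R) Vac z M N) ->
  @eqm K2 M2 D2 (V2 R) (hbar2 R) 3 B1 (@Bstate R K2 scal (hbar2 R) 'X D2 (V2 R) Vac (m%:R * z) M N) ->
  @eqm K2 M2 D2 (V2 R) (hbar2 R) 3 (Y X1 0 W1)
   (twisted ptz m A1 *+ n - twisted ptw n A1 *+ m + translation B1).
Proof.
apply: (@zeroth_product_mod R K2 scal (hbar2 R) 'X D2 (V2 R) Vac beta2
  (induced_comm bracket2E) (@induced_gen _ _ _ _) (@induced_ann _ _ _ _) flow2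
  _ _ _ _ _ (@translation R) Y _ _ _ _ _ _ _ _ _ (fun v => @ground_partial A v) (@partial R)).
- by [].
- by case.
- by [].
- by [].
- by case=> [[] a p r|[] p].
- exact: translationE.
- exact: (sf_linear_state hY).
- exact: (sf_linear hY).
- exact: (sf_field hY).
- move=> r v; rewrite -(sf_vacuum hY) /state2 scale1r. by [].
- exact: (sf_generator hY).
- exact: (sf_central hY).
- exact: (sf_translation hY).
- exact: (sf_normal_order hY).
- by move=> v x y; exact: ground_partialM.
- by move=> v x; exact: ground_partialC.
- by move=> v; exact: ground_partialC.
- exact: ground_partialX.
- exact: partialE.
Qed.

Local Notation F1 := (freealg (Kone R) (mode unit)).
Local Notation charge2 := (@charge R K2 scal (hbar2 R) D2 (V2 R) Vac).
Local Notation eqm2 := (@eqm K2 M2 D2 (V2 R) (hbar2 R)).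

Lemma gen1 (v : V1 R) : exists x : F1, v = state1 x.
Proof. exact: induced_gen. Qed.

Lemma state1D (x y : F1) : state1 x + state1 y = state1 (x + y).
Proof. by rewrite /state1 scalerDl. Qed.
Lemma state2D (x y : F) : state2 x + state2 y = state2 (x + y).
Proof. by rewrite /state2 scalerDl. Qed.

Lemma embedD u : {morph @embed R u : x y / x + y}.
Proof.
move=> x y; have [x' ->] := gen1 x; have [y' ->] := gen1 y.
by rewrite state1D !embedE state2D freemapD.
Qed.

Lemma embed_scale u (d : Kone R) (v : V1 R) :
  embed u ((d%:A : F1) *: v) = @sc K2 M2 D2 (V2 R) (iota d) (embed u v).
Proof.
have [x ->] := gen1 v; rewrite /state1 scalerA -/(state1 _) embedE.
rewrite -scalerAl mul1r freemapZ -/(state1 x) embedE /state2.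
by rewrite [RHS]scE.
Qed.

Lemma embed_bigO u (v w : V1 R) : bigO1 2 (v - w) -> eqm2 2 (embed u v) (embed u w).
Proof.
move=> [x hx]; exists (embed u x).
have E : v = (((hbar1 R) ^+ 2)%:A : F1) *: x + w by rewrite -hx subrK.
by rewrite E embedD addrK embed_scale rmorphXn.
Qed.

Lemma freemap_Igen_at u a p r :
  freemap iota (mode_at u) (Igen (Kone R) tt a p r) = Igen K2 u a p r.
Proof. exact: freemap_letter. Qed.

Lemma freemap_sym_prod_at u s : freemap iota (mode_at u) (sym_prod (R := R) idfun tt s)
  = sym_prod (R := R) iota u s.
Proof.
exact: (@freemap_sym_prod R (Kone R) K2 unit point idfun iota iota (fun=> u) (mode_at u)
  (fun=> erefl) (fun _ _ _ _ => erefl)).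
Qed.

(** For M = 0 both sides lack the correction: on the right its coefficient is 0. *)
Lemma embed_sigma_form u M m : m = (2 * M).+1 -> embed u (sigma_form R m) = charge2 u M.
Proof.
move=> ->; rewrite /sigma_form embedE freemapD freemap_sum -state2D; congr (_ + _).
  rewrite /tensor /tsum /state2; congr (_ *: _); apply: eq_bigr => s _.
  rewrite freemapZ freemap_prod point_wordE; congr (_ *: _).
  by apply: eq_bigr => a _; exact: freemap_Igen_at.
case: M => [|M].
  by rewrite muln0 eqxx freemap0 /correction_coef /= mul0r !raddf0 mulr0 sc0l /state2 scale0r.
have -> : ((2 * M.+1).+1 == 1%N) = false by rewrite eqSS muln_eq0.
rewrite freemapZ /state2 [RHS]scE; congr ((_ *: _) *: _).
  by rewrite [LHS]rmorphM.
rewrite freemap_sum -/(tsum _ (fun i => freemap iota (mode_at u) (\sum_a \sum_b \sum_c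
   cst1 (sym_delta R i * sl2f R a b c) *: (Igen (Kone R) tt a 0 (-2) *
     Igen (Kone R) tt b 1 (-1) * sym_prod idfun tt (c :: i))))).
have -> : ((2 * M.+1).+1 - 3)%N = (2 * M)%N by lia.
apply: eq_bigr => i _; rewrite freemap_sum; apply: eq_bigr => a _.
rewrite freemap_sum; apply: eq_bigr => b _; rewrite freemap_sum; apply: eq_bigr => d _.
by rewrite freemapZ !freemapM !freemap_Igen_at freemap_sym_prod_at.
Qed.

Lemma A_formE M N m n : m = (2 * M).+1 -> n = (2 * N).+1 -> A_form R m n =
  @Astate R K2 scal (hbar2 R) 'X D2 (V2 R) Vac (zeta R m n) M N.
Proof. by move=> -> ->; rewrite /A_form /Astate /state2 [RHS]scE. Qed.

Lemma B_formE M N m n : m = (2 * M).+1 -> n = (2 * N).+1 -> B_form R m n =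
  @Bstate R K2 scal (hbar2 R) 'X D2 (V2 R) Vac (m%:R * zeta R m n) M N.
Proof. by move=> -> ->; rewrite /B_form /Bstate /state2 [RHS]scE. Qed.

Lemma zeroth_product_charges (sigma : nat -> V1 R) m n (A1 B1 : V2 R) :
  (forall m : nat, odd m -> bigO1 2 (sigma m - sigma_form R m)) -> odd m -> odd n ->
  bigO2 3 (A1 - A_form R m n) -> bigO2 3 (B1 - B_form R m n) ->
  bigO2 3 (Y (embed ptz (sigma m)) 0 (embed ptw (sigma n))
           - (twisted ptz m A1 *+ n - twisted ptw n A1 *+ m + translation B1)).
Proof.
move=> hs hm hn hA hB; have half k : odd k -> k = (2 * k./2).+1.
  by move=> hk; rewrite -{1}(odd_double_half k) hk add1n mul2n.
have hm' := half m hm; have hn' := half n hn.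
apply: (zeroth_product2 (M := m./2) (N := n./2) hm' hn' erefl).
- by rewrite -(embed_sigma_form _ hm'); apply/embed_bigO/hs.
- by rewrite -(embed_sigma_form _ hn'); apply/embed_bigO/hs.
- by rewrite -(A_formE hm' hn').
- by rewrite -(B_formE hm' hn').
Qed.
End Instance.

(** * Regularity on the diagonal *)

Section Expansion.
Variable R : realType.
Local Notation A := (fps R[i]).
Local Notation iota := (polyC : {rmorphism A -> {poly A}}).
Local Notation K1 := (Kone R).
Local Notation K2 := (Ktwo R).
Local Notation F := (freealg K2 (mode point)).
Local Notation F' := (freealg K1 (mode point)).
Local Notation F1 := (freealg K1 (mode unit)).

Definition word_expansion (s : seq (mode point)) (e : int) : F1 :=
  if e is Posz n then fcoef (\prod_(g <- s) expand_mode R g) n else 0.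
Definition term_expansion (e : int) (p : {poly A}) s : F1 :=
  \sum_(k < size p) ((-1) ^+ k * p`_k : K1) *: word_expansion s (e + k%:Z).

(** The bound of the sum depends on the polynomial; this makes it additive. *)
Lemma term_expansion_widen N e (p : {poly A}) s : (size p <= N)%N ->
  term_expansion e p s = \sum_(k < N) ((-1) ^+ k * p`_k : K1) *: word_expansion s (e + k%:Z).
Proof.
move=> pN; rewrite /term_expansion.
rewrite (big_ord_widen N (fun k => ((-1) ^+ k * p`_k : K1) *: word_expansion s (e + k%:Z)) pN).
rewrite [RHS](bigID (fun k : 'I_N => (k < size p)%N)) /=.
rewrite [X in _ = _ + X]big1 ?addr0 // => k.
by rewrite -leqNgt => kp; rewrite nth_default // mulr0 scale0r.
Qed.

Lemma term_expansionD e (p q : {poly A}) s :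
  term_expansion e (p + q) s = term_expansion e p s + term_expansion e q s.
Proof.
pose N := maxn (size p) (size q).
rewrite (@term_expansion_widen N) ?size_polyD // !(@term_expansion_widen N) ?leq_maxl ?leq_maxr //.
by rewrite -big_split; apply: eq_bigr => k _; rewrite coefD mulrDr scalerDl.
Qed.

Lemma expandD (x y : F) e : expand (x + y) e = expand x e + expand y e.
Proof. exact: (wordextD (@term_expansionD e)). Qed.
Lemma expand0 e : expand (0 : F) e = 0.
Proof. exact: (wordext0 (@term_expansionD e)). Qed.
Lemma expand_word p s e : expand (p *: word K2 s : F) e = term_expansion e p s.
Proof. exact: (wordextE (@term_expansionD e)). Qed.

Lemma expand_scale d (x : F) e : expand (iota d *: x) e = (d : K1) *: expand x e.
Proof.
elim/freealg_ind: x => [|x y hx hy|p s].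
- by rewrite scaler0 !expand0 scaler0.
- by rewrite scalerDr !expandD hx hy scalerDr.
rewrite scalerA !expand_word /term_expansion scaler_sumr.
rewrite -/(term_expansion e _ s) (@term_expansion_widen (size p)); last first.
  by rewrite mul_polyC; exact: size_scale_leq.
by apply: eq_bigr => k _; rewrite scalerA coefCM mulrCA.
Qed.

(** (z - w)^-1 is minus the inverse of the expansion variable w - z. *)
Lemma expand_X (x : F) e : expand (('X : K2) *: x) e = - expand x (e + 1).
Proof.
elim/freealg_ind: x => [|x y hx hy|p s].
- by rewrite scaler0 !expand0 oppr0.
- by rewrite scalerDr !expandD hx hy opprD.
rewrite scalerA !expand_word (@term_expansion_widen (size p).+1); last first.
  by rewrite (leq_trans (size_polyMleq _ _)) // size_polyX.
rewrite big_ord_recl /= coefXM eqxx mulr0 scale0r add0r -sumrN; apply: eq_bigr => k _.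
rewrite coefXM /= /bump /= add1n exprS mulN1r mulNr scaleNr.
by rewrite -addrA -PoszD add1n.
Qed.

Definition merge (g : mode point) : mode unit :=
  match g with Imode _ a p r => Imode tt a p r | Kmode _ p => Kmode tt p end.

Lemma fcoef_word0 s : fcoef (\prod_(g <- s) expand_mode R g) 0 = word K1 (map merge s).
Proof.
elim: s => [|g s IH]; first by rewrite big_nil /= word0.
rewrite big_cons /= big_ord1 subn0 IH word_cons; congr (_ * _).
by case: g => [[] a p r|[] p] //=; rewrite fact0 invr1 addn0 [cst1 _]rmorph1 scale1r.
Qed.

(** The identity, in the form of a relabelling. *)
Definition same_mode (g : mode point) : mode point :=
  match g with Imode u a p r => Imode u a p r | Kmode u p => Kmode u p end.

(** A state without poles has no singular terms, and its value at w = z is obtained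
    by merging the two points. *)
Lemma expand_const (x : F') e : e <= 0 ->
  expand (freemap iota same_mode x) e = if e == 0 then freemap idfun merge x else 0.
Proof.
have same s : map same_mode s = s by elim: s => //= -[u b p r|u p] s ->.
move=> e0; elim/freealg_ind: x => [|x y hx hy|d s].
- by rewrite !freemap0 expand0 if_same.
- by rewrite !freemapD expandD hx hy; case: ifP; rewrite ?addr0.
rewrite !freemap_word same expand_word (@term_expansion_widen 1); last exact: size_polyC_leq1.
rewrite big_ord1 expr0 mul1r coefC eqxx addr0 /word_expansion.
case: e e0 => [[|n]|n] //= _; last by rewrite scaler0.
by rewrite fcoef_word0.
Qed.
End Expansion.

Section TwoPointForm.
Variables (R : realType) (K : comNzRingType) (io : {rmorphism fps R[i] -> K}) (P : choiceType).
Definition two_point_form (u v : P) M N : freealg K (mode P) :=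
  \sum_(i : (2 * M).-tuple 'I_3) \sum_(j : (2 * N).-tuple 'I_3) \sum_e
    cst io (sym_delta R i * sym_delta R j) *:
      (free_translation (sym_prod io u (e :: i)) * sym_prod io v (e :: j)).
Definition casimir_form (u : P) n : freealg K (mode P) :=
  (\sum_e Igen K u e 0 (-1) * Igen K u e 0 (-1)) ^+ n.
End TwoPointForm.

Section RelabelForms.
Variables (R : realType) (K K' : comNzRingType) (P P' : choiceType).
Variables (io : {rmorphism fps R[i] -> K}) (io' : {rmorphism fps R[i] -> K'}).
Variables (f : {rmorphism K -> K'}) (gp : P -> P') (ge : mode P -> mode P').
Hypothesis f_io : forall x, f (io x) = io' x.
Hypothesis geI : forall u a p r, ge (Imode u a p r) = Imode (gp u) a p r.
Hypothesis geK : forall u p, ge (Kmode u p) = Kmode (gp u) p.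

Lemma freemap_two_point_form u v M N : freemap f ge (two_point_form io u v M N)
  = two_point_form io' (gp u) (gp v) M N.
Proof.
rewrite /two_point_form freemap_sum; apply: eq_bigr => i _.
rewrite freemap_sum; apply: eq_bigr => j _; rewrite freemap_sum; apply: eq_bigr => e _.
rewrite freemapZ (freemap_cst f_io) freemapM (freemap_translation f geI geK).
by rewrite !(freemap_sym_prod f_io geI).
Qed.
Lemma freemap_casimir_form u n : freemap f ge (casimir_form K u n) = casimir_form K' (gp u) n.
Proof.
rewrite /casimir_form freemapX freemap_sum; congr (_ ^+ _); apply: eq_bigr => e _.
by rewrite freemapM !(freemap_Igen f geI).
Qed.
End RelabelForms.

Section Diagonal.
Variables (R : realType) (K : comNzRingType) (c : {rmorphism R[i] -> K}).
Variables (P : choiceType) (D : free_datum K (mode P)) (u : P).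
Local Notation lt := (fd_letter D).
Local Notation S := (@sym K (mode P) D).
Local Notation t := (@sym_delta R).
Local Notation trans := (@trans K P D).
Local Notation symprod := (@symprod R K c P D).
Local Notation a := (fun i => cvar D (Imode u i 0 (-1))).
Local Notation a2 := (fun i => cvar D (Imode u i 0 (-2))).
Local Notation cT := (@comder K (mode P) D (\0 : {additive K -> K})
  (fun g => translate_coef K g *: lt (translate_mode g))).

Definition diagonal M N : D :=
  \sum_(i : (2 * M).-tuple 'I_3) \sum_(j : (2 * N).-tuple 'I_3) \sum_e
    c (t i * t j) *: (trans (symprod u (e :: i)) * symprod u (e :: j)).
Definition casimir n : D := (\sum_e lt (Imode u e 0 (-1)) * lt (Imode u e 0 (-1))) ^+ n.

Let hT : derivation cT. Proof. exact: comder_derivation (@null_derM K). Qed.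

Let cT_a i : cT (a i) = a2 i.
Proof.
rewrite comder_var; last exact: null_derM.
by rewrite /= opprK scale1r.
Qed.
Let cT_norm n : cT (norm2 a ^+ n) = (norm2 a ^+ n.-1 * dot a a2) *+ 2 *+ n.
Proof.
rewrite (der_norm2X hT); congr (_ * _ *+ _ *+ _).
by apply: eq_bigr => i _; rewrite /= cT_a.
Qed.
Let S_trans x : S (trans x) = cT (S x).
Proof. by rewrite comderE //; exact: null_derM. Qed.

Lemma sym_trans_casimir n :
  S (trans (casimir n)) = (norm2 a ^+ n.-1 * dot a a2) *+ 2 *+ n.
Proof.
rewrite S_trans symX sym_sum -cT_norm; congr (cT (_ ^+ _)).
by apply: eq_bigr => e _; rewrite symM.
Qed.

(** With b = a the symbol of A is a multiple of T(norm2 a ^ (M + N + 1)). *)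
Lemma sym_diagonal M N : S (diagonal M N) = (norm2 a ^+ (M + N) * dot a a2) *+ (2 * M).+1.
Proof.
transitivity (\sum_e cT (a e * norm2 a ^+ M) * (a e * norm2 a ^+ N)).
  rewrite -(contract_legs c M N a a (f := cT)) => [|x y|d x].
  - rewrite sym_sum; apply: eq_bigr => i _; rewrite sym_sum; apply: eq_bigr => j _.
    rewrite sym_sum; apply: eq_bigr => e _; rewrite symZ symM S_trans !sym_symprod.
    by [].
  - exact: (derD hT).
  - by rewrite (derM hT) comder_csc ?rmorph0 ?mul0r ?add0r //; exact: null_derM.
transitivity (norm2 a ^+ (M + N) * dot a a2 + cT (norm2 a ^+ M) * norm2 a ^+ N.+1).
  transitivity (\sum_e (norm2 a ^+ (M + N) * (a e * a2 e)
      + cT (norm2 a ^+ M) * norm2 a ^+ N * (a e * a e))).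
    apply: eq_bigr => e _; rewrite (derM hT) cT_a /= exprD.
    by move: (comder _ _ _) => dN; move: (norm2 a ^+ M) (norm2 a ^+ N) => *; ring.
  by rewrite big_split -!mulr_sumr /= [norm2 a ^+ N.+1]exprSr mulrA.
rewrite cT_norm [RHS]mulrS; congr (_ + _); case: M => [|M]; first by rewrite mulr0n mul0r.
rewrite /= addSnnS exprD [RHS]mulrnA; move: (norm2 a ^+ M) (norm2 a ^+ N.+1) (dot a a2) => *; ring.
Qed.

Lemma diagonal_casimir M N z z' : z * (2 * M).+1%:R = z' * (2 * (M + N).+1)%:R ->
  S (c z *: diagonal M N) = S (c z' *: trans (casimir (M + N).+1)).
Proof.
move=> E; rewrite !symZ sym_diagonal sym_trans_casimir /= -mulrnA.
have H n y : csc D (c y) * (norm2 a ^+ (M + N) * dot a a2) *+ n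
    = csc D (c (y * n%:R)) * (norm2 a ^+ (M + N) * dot a a2).
  by rewrite !rmorphM /= !rmorph_nat -[LHS]mulr_natr mulrAC.
by rewrite !mulrnAr !H E.
Qed.
End Diagonal.

Section Regularity.
Variable R : realType.
Local Notation A := (fps R[i]).
Local Notation iota := (polyC : {rmorphism A -> {poly A}}).
Local Notation K1 := (Kone R).
Local Notation K2 := (Ktwo R).
Local Notation F := (freealg K2 (mode point)).
Local Notation F' := (freealg K1 (mode point)).
Local Notation F1 := (freealg K1 (mode unit)).
Local Notation D1 := (free_datum_of K1 (mode unit)).
Local Notation idA := (idfun : {rmorphism A -> A}).

Definition beta1 (g k : mode unit) : F1 :=
  match g, k with
  | Imode u a p r, Imode _ b q s => flow_same idA u a p r b q s
  | _, _ => 0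
  end.

Lemma bracket1E g k : bracket1 R g k = hbar1 R *: beta1 g k.
Proof.
case: g k => [u a p r|u p] [v b q s|v q] /=; rewrite ?scaler0 //; exact: bracket_sameE.
Qed.

Lemma state1_congr (x y : F1) : @sym K1 (mode unit) D1 x = @sym K1 (mode unit) D1 y ->
  bigO1 1 (state1 x - state1 y).
Proof.
exact: (@sym_congr K1 (mode unit) D1 (V1 R) (hbar1 R) beta1 (induced_comm bracket1E) x y _).
Qed.

Variables (M N : nat) (z z' : R[i]).
Hypothesis zz' : z * (2 * M).+1%:R = z' * (2 * (M + N).+1)%:R.

(* The residue of A - T Z, where Z is a multiple of the (M + N + 1)-st power of the
   Casimir element at z. *)
Let difference : F' := cst idA z *: two_point_form idA ptz ptw M N
  - cst idA z' *: free_translation (casimir_form K1 ptz (M + N).+1).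

(** At coinciding points the two terms have the same symbol. *)
Lemma merge_difference : bigO1 1 (state1 (freemap idA merge difference)).
Proof.
have fT := @freemap_translation K1 K1 point unit idA (fun=> tt) merge
  (fun _ _ _ _ => erefl) (fun _ _ => erefl).
have fA := @freemap_two_point_form R K1 K1 point unit idA idA idA (fun=> tt) merge
  (fun=> erefl) (fun _ _ _ _ => erefl) (fun _ _ => erefl).
have fC := @freemap_casimir_form K1 K1 point unit idA (fun=> tt) merge (fun _ _ _ _ => erefl).
have -> : freemap idA merge difference = cst idA z *: two_point_form idA tt tt M N
    - cst idA z' *: free_translation (casimir_form K1 tt (M + N).+1).
  by rewrite freemapB !freemapZ fT fA fC.
rewrite /state1 scalerBl; apply: state1_congr.
exact: (@diagonal_casimir R K1 (@scal R K1 idA) unit D1 tt M N z z' zz').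
Qed.

Local Notation spread := (freemap iota same_mode).

Lemma spread_difference : spread difference
  = cst iota z *: two_point_form iota ptz ptw M N
    - cst iota z' *: free_translation (casimir_form K2 ptz (M + N).+1).
Proof.
have fT := @freemap_translation K1 K2 point point iota id same_mode
  (fun _ _ _ _ => erefl) (fun _ _ => erefl).
have fA := @freemap_two_point_form R K1 K2 point point idA iota iota id same_mode
  (fun=> erefl) (fun _ _ _ _ => erefl) (fun _ _ => erefl).
have fC := @freemap_casimir_form K1 K2 point point iota id same_mode (fun _ _ _ _ => erefl).
by rewrite freemapB !freemapZ fT fA fC.
Qed.

Local Notation sc1 := (@sc K1 (mode unit) D1 (V1 R)).

Lemma state1_sc d (x : F1) : state1 (d *: x) = sc1 d (state1 x).
Proof. by rewrite /state1 [RHS]scE. Qed.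

(** The only singular term is the residue, and it has the factor h ^ 2 besides the
    factor h of [merge_difference]. *)
Lemma expansion_singular (y : F) e : e < 0 ->
  bigO1 3 (state1 (expand ((hbar2 R ^+ 2 * 'X) *: spread difference + (hbar2 R ^+ 3) *: y) e)).
Proof.
move=> e0; have e1 : e + 1 <= 0 by rewrite -ltzD1 ltrD2r.
rewrite expandD -scalerA -!rmorphXn !expand_scale expand_X (expand_const _ e1).
rewrite /state1 scalerDl -!/(state1 _) !state1_sc.
apply: (@OkD K1 (mode unit) D1 (V1 R) (hbar1 R) 3); last by exists (state1 (expand y e)).
apply: (@Ok_sc K1 (mode unit) D1 (V1 R) (hbar1 R) 1 2).
rewrite /state1 scaleNr -/(state1 _); apply: (@OkN K1 (mode unit) D1 (V1 R) (hbar1 R) 1).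
case: ifP => _; first exact: merge_difference.
by rewrite /state1 scale0r; exact: (@Ok0 K1 (mode unit) D1 (V1 R) (hbar1 R) 1).
Qed.

Lemma form_regular (A1 : V2 R) :
  bigO2 3 (A1 - state2 ((cst2 z * hbar2 R ^+ 2 * inv_zw R) *: two_point_form iota ptz ptw M N)) ->
  regular_mod_translates 3 A1.
Proof.
move=> [v hv]; have [y yE] := @induced_gen _ _ _ _ v.
pose x : F := (hbar2 R ^+ 2 * 'X) *: spread difference + (hbar2 R ^+ 3) *: y.
exists (state2 ((cst2 z' * hbar2 R ^+ 2 * inv_zw R) *: casimir_form K2 ptz (M + N).+1)).
exists (fun e => state1 (expand x e)); split; last exact: expansion_singular.
exists x => //.
move/eqP: hv; rewrite subr_eq => /eqP ->; rewrite yE translationE.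
have -> : free_translation ((cst2 z' * hbar2 R ^+ 2 * inv_zw R) *: casimir_form K2 ptz (M + N).+1)
  = (cst2 z' * hbar2 R ^+ 2 * inv_zw R) *: free_translation (casimir_form K2 ptz (M + N).+1).
  by rewrite /free_translation freederZ ?scale0r ?add0r //; exact: null_derM.
have kE k : cst2 k * hbar2 R ^+ 2 * inv_zw R = hbar2 R ^+ 2 * 'X * cst iota k :> K2.
  by rewrite -mulrA mulrC.
rewrite /state2 /x spread_difference scalerBr !scalerA -scalerAl mul1r !kE -scalerDl -scalerBl.
by congr (_ *: _); rewrite -addrA addrC.
Qed.
End Regularity.

Lemma A_regular (R : realType) m n (A1 : V2 R) : odd m -> odd n ->
  bigO2 3 (A1 - A_form R m n) -> regular_mod_translates 3 A1.
Proof.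
move=> hm hn; have half k : odd k -> k = (2 * k./2).+1.
  by move=> hk; rewrite -{1}(odd_double_half k) hk add1n mul2n.
move: (m./2) (n./2) (half m hm) (half n hn) => M N mE nE {half hm hn}; subst m n.
set m := (2 * M).+1; set n := (2 * N).+1.
have mn0 : (m + n)%:R != 0 :> R[i] by rewrite pnatr_eq0.
(* The second coefficient makes the residues of A and T Z cancel: 2 M + 1 = m and
   2 (M + N + 1) = m + n. *)
apply: (@form_regular R M N (zeta R m n) (zeta R m n * (m%:R / (m + n)%:R))).
have -> : (2 * (M + N).+1 = m + n)%N by rewrite /m /n; lia.
by rewrite -mulrA divfK.
Qed.

Theorem theorem5p0p1 (R : realType)
    (Y : V2 R -> int -> V2 R -> V2 R) (hY : is_state_field_map Y)
    (sigma : nat -> V1 R)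
    (hsigma : forall m : nat, odd m -> bigO1 2 (sigma m - sigma_form R m))
    (m n : nat) (hm : odd m) (hn : odd n)
    (A B : V2 R)
    (hA : bigO2 3 (A - A_form R m n))
    (hB : bigO2 3 (B - B_form R m n)) :
  bigO2 3 (Y (embed ptz (sigma m)) 0 (embed ptw (sigma n))
           - (twisted ptz m A *+ n - twisted ptw n A *+ m + translation B))
  /\ regular_mod_translates 3 A.
Proof.
split; first exact: (zeroth_product_charges hY hsigma hm hn hA hB).
exact: A_regular hm hn hA.
Qed.
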